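(* Let $q=p^e$ for an odd prime $p$, and let $n\ge4$. Let $G$ be the group generated by $\{\sigma,\tau,\delta,z,U',V'\}$ subject to the following relations. Then $G$ is isomorphic to $\Omega^-(2n,q)$. (i) Defining relations for $\langle U',V'\rangle$ as the group of signed permutation matrices of determinant $1$ and degree $n-1$, but omitting the relation $U'^4=1$ (that is, a set of relations which together with $U'^4=1$ presents that group on $\{U',V'\}$); $[z,U'^{V'}]=1$; $[z,V'U'^{-1}]=1$ if $n>4$; $[\delta,U'^{V'}]=1$; $[\delta,V'U'^{-1}]=1$ if $n>4$. (ii) Relations stating that $\sigma$ is centralised by: $U'^{V'^2}$ if $n>4$; $V'U'^{-1}U'^{-V'}$ if $n>5$; $z^{V'^2}$; $\delta^{V'^2}$. (iii) Relations stating that $\tau$ is centralised by: $U'^{V'}$; $V'U'^{-1}$ if $n>4$. (iv) Relations that present $\Omega^-(6,q)$ on $\{\sigma,\tau,\delta,z,U'\}$. (v) $[\sigma,\sigma^{V'}]=\sigma^{V'U'^{-1}}$; $[\sigma,\sigma^{V'U'^{-1}}]=1$; $[\sigma,\sigma^W]=1$, where $W=U'^{V'U'^{-1}}$; and if $n>4$ then $[\sigma,\sigma^{V'^2}]=1$. (vi) $[\sigma^{V'},\tau]=1$.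
   Context: Conventions: $x^y=y^{-1}xy$, $[x,y]=x^{-1}y^{-1}xy$, $x^{-y}=(x^{-1})^y$. Linear maps act on the right and fix unmentioned basis vectors. Generators of the presented group are denoted by the same symbols as the corresponding matrices. ''Relations that present (defining relations for) a group on given elements $g_1,\dots,g_k$'' means any set of relators in the free group on $k$ letters whose normal closure is the kernel of the natural map onto $\langle g_1,\dots,g_k\rangle$. Signed cycles: $(v_1,\dots,v_m)^{\epsilon}$ denotes $v_i\mapsto v_{i+1}$ ($i<m$), $v_m\mapsto\epsilon v_1$; $\epsilon_m=(-1)^{m+1}$. Matrices: $\omega$ is a primitive element of $\mathrm{GF}(q^2)$, $\omega_0=\omega^{q+1}$, $\psi=\omega^{(q+1)/2}$. The natural module of $\Omega^-(2n,q)$ over $\mathrm{GF}(q)$ has basis $(e_1,f_1,\dots,e_{n-1},f_{n-1},w_1,w_2)$ with symmetric bilinear form $e_i.f_i=f_i.e_i=1$, $w_1.w_1=-2$, $w_2.w_2=2\omega_0$, all other products zero. With $A=(\omega^{q-1}+\omega^{1-q})/2$, $B=\psi(\omega^{1-q}-\omega^{q-1})/2$, $C=\psi^{-1}(\omega^{1-q}-\omega^{q-1})/2$: $\sigma=(e_1\mapsto e_1+e_2,\ f_2\mapsto f_2-f_1)$; $\tau=(e_1\mapsto e_1+f_1+w_1,\ w_1\mapsto w_1+2f_1)$; $\delta=(e_1\mapsto\omega_0^{-1}e_1,\ f_1\mapsto\omega_0f_1,\ w_1\mapsto Aw_1-Cw_2,\ w_2\mapsto-Bw_1+Aw_2)$;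 $z=(e_1\mapsto f_1,\ f_1\mapsto e_1,\ w_1\mapsto-w_1)$; $U'=(e_1,e_2)^-(f_1,f_2)^-$; $V'=(e_1,\dots,e_{n-1})^{\epsilon_{n-1}}(f_1,\dots,f_{n-1})^{\epsilon_{n-1}}$. In (i) $U'$ and $V'$ correspond to the signed permutations $(1,2)^-$ and $(1,\dots,n-1)^{\epsilon_{n-1}}$. In (iv), the five matrices $\sigma,\tau,\delta,z,U'$ generate a copy of $\Omega^-(6,q)$, acting naturally on $\langle e_1,f_1,e_2,f_2,w_1,w_2\rangle$ and fixing the remaining basis vectors. *)

(* Defs.v *)
From HB Require Import structures.
From mathcomp Require Import all_boot all_order all_algebra.
From mathcomp Require Import all_fingroup all_solvable all_field.
From mathcomp Require Import boolp ring.

Set Implicit Arguments.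
Unset Strict Implicit.
Unset Printing Implicit Defensive.

Import GroupScope GRing.Theory.

Section FreeGroup.
Variable k : nat.

(* (i, false) is the i-th generator, (i, true) its inverse. *)
Definition letter := ('I_k * bool)%type.

Definition letter_inv (x : letter) : letter := (x.1, ~~ x.2).

Definition reduced (w : seq letter) :=
  sorted (fun x y => y != letter_inv x) w.

Record free_group := FreeGroup {
  free_word : seq letter;
  _ : reduced free_word }.

HB.instance Definition _ := [isSub for free_word].
HB.instance Definition _ := [Choice of free_group by <:].

Definition push (x : letter) (w : seq letter) :=
  if w is y :: w' then if y == letter_inv x then w' else x :: w else [:: x].

Lemma letter_invK : involutive letter_inv.
Proof. by case=> i b; rewrite /letter_inv /= negbK. Qed.

Lemma push_reduced x w : reduced w -> reduced (push x w).
Proof.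
by case: w => [|y w] //=; case: ifP => [_ /path_sorted //|/negbT /= -> ->].
Qed.

Lemma push_neq x w : reduced (x :: w) -> push x w = x :: w.
Proof. by case: w => [|y w] //= /andP[/negbTE -> _]. Qed.

Lemma pushK x w : reduced w -> push (letter_inv x) (push x w) = w.
Proof.
case: w => [|y w] rw /=; first by rewrite letter_invK eqxx.
case: ifP => [/eqP <-|_]; last by rewrite /= letter_invK eqxx.
by rewrite push_neq.
Qed.

Definition word_mul (u v : seq letter) := foldr push v u.

Lemma word_mul_reduced u v : reduced v -> reduced (word_mul u v).
Proof. by move=> rv; elim: u => //= x u; apply: push_reduced. Qed.

Lemma word_mul_push x u v : reduced v ->
  word_mul (push x u) v = push x (word_mul u v).
Proof.
move=> rv; case: u => [|y u] //=; case: ifP => [/eqP ->|_] //=.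
by have := @pushK (letter_inv x) (word_mul u v); rewrite letter_invK => -> //;
  apply: word_mul_reduced.
Qed.

Lemma word_mulA u v w : reduced w ->
  word_mul u (word_mul v w) = word_mul (word_mul u v) w.
Proof. by move=> rw; elim: u => //= x u ->; rewrite word_mul_push. Qed.

Lemma word_mul_nil u : reduced u -> word_mul u [::] = u.
Proof.
elim: u => // x u IH rxu; have ru : reduced u by apply: path_sorted rxu.
by rewrite [LHS]/= -/(word_mul u [::]) IH // push_neq.
Qed.

Definition word_inv (u : seq letter) := rev (map letter_inv u).

Lemma word_inv_reduced u : reduced u -> reduced (word_inv u).
Proof.
rewrite /reduced /word_inv rev_sorted sorted_map; apply: sub_sorted => x y /=.
by rewrite letter_invK eq_sym.
Qed.

Lemma word_invK : involutive word_inv.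
Proof. by move=> u; rewrite /word_inv map_rev revK mapK //; apply: letter_invK. Qed.

Lemma word_mulV u : reduced u -> word_mul (word_inv u) u = [::].
Proof.
elim: u => // x u IH rxu; have ru : reduced u by apply: path_sorted rxu.
rewrite /word_inv map_cons rev_cons /word_mul foldr_rcons -push_neq //.
by rewrite pushK //; apply: IH.
Qed.

Definition free_one : free_group := FreeGroup (isT : reduced [::]).
Definition free_mul (u v : free_group) :=
  FreeGroup (word_mul_reduced (free_word u) (valP v)).
Definition free_inv (u : free_group) := FreeGroup (word_inv_reduced (valP u)).

Lemma free_mulA : associative free_mul.
Proof. by move=> u v w; apply/val_inj/word_mulA/(valP w). Qed.
Lemma free_mul1g : left_id free_one free_mul.
Proof. by move=> u; apply/val_inj. Qed.
Lemma free_mulg1 : right_id free_one free_mul.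
Proof. by move=> u; apply/val_inj/word_mul_nil/(valP u). Qed.
Lemma free_mulVg : left_inverse free_one free_inv free_mul.
Proof. by move=> u; apply/val_inj/word_mulV/(valP u). Qed.
Lemma free_mulgV : right_inverse free_one free_inv free_mul.
Proof.
move=> u; apply/val_inj; rewrite /= -{1}[free_word u]word_invK.
exact/word_mulV/word_inv_reduced/(valP u).
Qed.

HB.instance Definition _ :=
  isGroup.Build free_group free_mulA free_mul1g free_mulg1 free_mulVg free_mulgV.

Definition free_gen (i : 'I_k) : free_group :=
  FreeGroup (isT : reduced [:: (i, false)]).

Section Lift.
Variables (G : groupType) (g : k.-tuple G).

Definition letter_val (x : letter) : G :=
  if x.2 then (tnth g x.1)^-1 else tnth g x.1.

Definition free_lift (u : free_group) : G :=
  \prod_(x <- free_word u) letter_val x.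

Lemma free_lift_gen i : free_lift (free_gen i) = tnth g i.
Proof. by rewrite /free_lift big_seq1. Qed.

Lemma letter_valV x : letter_val (letter_inv x) = (letter_val x)^-1.
Proof. by case: x => i [] //=; rewrite /letter_val /= invgK. Qed.

Lemma free_lift_monoid : monoid.monoid_morphism free_lift.
Proof.
split=> [|[u ru] v]; rewrite /free_lift /=; first by rewrite big_nil.
elim: u {ru} => [|x u IH] /=; first by rewrite big_nil mul1g.
rewrite big_cons -mulgA -IH; case: (word_mul u _) => [|y w] /=.
  by rewrite big_seq1 big_nil mulg1.
case: ifP => [/eqP ->|_]; rewrite ?big_cons //.
by rewrite letter_valV mulgA mulgV mul1g.
Qed.

HB.instance Definition _ :=
  isUMagmaMorphism.Build free_group G free_lift free_lift_monoid.
End Lift.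
End FreeGroup.

Inductive normal_closure (G : groupType) (R : G -> Prop) : G -> Prop :=
| normal_closure_base x of R x : normal_closure R x
| normal_closure1 : normal_closure R 1
| normal_closureM x y of normal_closure R x & normal_closure R y :
    normal_closure R (x * y)
| normal_closureV x of normal_closure R x : normal_closure R x^-1
| normal_closureJ x y of normal_closure R x : normal_closure R (x ^ y).

(* The relators R present the subgroup generated by the entries of g, on g. *)
Definition presents (k : nat) (R : free_group k -> Prop)
    (G : groupType) (g : k.-tuple G) :=
  forall w : free_group k, normal_closure R w <-> free_lift g w = 1.

Section PresentedGroup.
Variables (k : nat) (R : free_group k -> Prop).
Local Notation N := (normal_closure R).

Definition presented_eq (x y : free_group k) : bool := `[< N (x * y^-1) >].

Lemma presented_eq_refl : reflexive presented_eq.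
Proof. by move=> x; apply/asboolP; rewrite mulgV; apply: normal_closure1. Qed.

Lemma presented_eq_sym : symmetric presented_eq.
Proof.
by move=> x y; apply/asboolP/asboolP => /normal_closureV; rewrite invgF.
Qed.

Lemma presented_eq_trans : transitive presented_eq.
Proof.
move=> y x z /asboolP Nxy /asboolP Nyz; apply/asboolP.
by rewrite -(mulgKV y x) -mulgA; apply: normal_closureM.
Qed.

Canonical presented_equiv :=
  EquivRel presented_eq presented_eq_refl presented_eq_sym presented_eq_trans.

(* The quotient of the free group by the normal closure of R. *)
Definition presented_group := {eq_quot presented_equiv}%qT.

HB.instance Definition _ := Choice.on presented_group.
HB.instance Definition _ := EqQuotient.on presented_group.

(* The name repr denotes coset representatives in fingroup. *)
Local Notation rep := generic_quotient.repr.
Local Notation Q := presented_group.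
Local Notation pi := (\pi_Q%qT : free_group k -> Q).

Definition presented_one : Q := pi 1.
Definition presented_mul (x y : Q) : Q := pi (rep x * rep y).
Definition presented_inv (x : Q) : Q := pi (rep x)^-1.

Lemma pi_eq (x y : free_group k) : pi x = pi y <-> N (x * y^-1).
Proof. by split=> [/eqmodP/asboolP|Nxy]; last apply/eqmodP/asboolP. Qed.

Lemma repr_pi (x : free_group k) : N (rep (pi x) * x^-1).
Proof. by apply/pi_eq; rewrite reprK. Qed.

Lemma presented_mulE (x y : free_group k) :
  presented_mul (pi x) (pi y) = pi (x * y).
Proof.
apply/pi_eq; rewrite invgM mulgA -[_ * _ * y^-1]mulgA.
rewrite -(mulgKV x (rep (pi x))) -(mulgA _ x) -mulgA.
apply: normal_closureM (repr_pi x) _.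
by have /(normal_closureJ x^-1) := repr_pi y; rewrite conjgE invgK mulgA.
Qed.

Lemma presented_invE (x : free_group k) : presented_inv (pi x) = pi x^-1.
Proof.
apply/pi_eq; rewrite invgK.
have /normal_closureV/(normal_closureJ x) := repr_pi x.
by rewrite conjgE invgF mulgA mulKg.
Qed.

Lemma presented_mulA : associative presented_mul.
Proof.
elim/quotW=> x; elim/quotW=> y; elim/quotW=> z.
rewrite (presented_mulE y z) (presented_mulE x (y * z)) mulgA.
by rewrite (presented_mulE x y) (presented_mulE (x * y) z).
Qed.
Lemma presented_mul1g : left_id presented_one presented_mul.
Proof. by elim/quotW=> x; rewrite presented_mulE mul1g. Qed.
Lemma presented_mulg1 : right_id presented_one presented_mul.
Proof. by elim/quotW=> x; rewrite presented_mulE mulg1. Qed.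
Lemma presented_mulVg : left_inverse presented_one presented_inv presented_mul.
Proof. by elim/quotW=> x; rewrite presented_invE presented_mulE mulVg. Qed.
Lemma presented_mulgV : right_inverse presented_one presented_inv presented_mul.
Proof. by elim/quotW=> x; rewrite presented_invE presented_mulE mulgV. Qed.

HB.instance Definition _ := isGroup.Build presented_group
  presented_mulA presented_mul1g presented_mulg1 presented_mulVg presented_mulgV.
End PresentedGroup.

Definition isomorphic (G H : groupType) :=
  exists f : {multiplicative G -> H}, bijective f.

(* Matrices act on row vectors on the right: row i is the image of the i-th
   basis vector. *)
Local Open Scope ring_scope.

Section LinearMaps.
Variables (F : finFieldType) (m : nat).

Definition bvec (i : 'I_m) : 'rV[F]_m := delta_mx 0 i.

(* The linear map sending basis vector i to v for (i, v) in l, and fixing the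
   basis vectors not mentioned in l. *)
Definition linear_map (l : seq ('I_m * 'rV[F]_m)) : 'M[F]_m :=
  \matrix_(i < m) foldr (fun p r => if i == p.1 then p.2 else r) (bvec i) l.

(* (v_1, ..., v_r)^eps : v_i |-> v_{i+1} for i < r, v_r |-> eps v_1. *)
Definition signed_cycle (s : seq 'I_m) (eps : F) : 'M[F]_m :=
  \matrix_(i < m) ((if i == last i s then eps else 1) *: bvec (next s i)).

Lemma bvec_mulmx (i : 'I_m) (M : 'M[F]_m) : bvec i *m M = row i M.
Proof. by rewrite -rowE. Qed.

Lemma linear_mapE i l : bvec i *m linear_map l =
  foldr (fun p r => if i == p.1 then p.2 else r) (bvec i) l.
Proof. by rewrite bvec_mulmx rowK. Qed.

Lemma signed_cycle_unit s eps :
  uniq s -> eps != 0 -> signed_cycle s eps \in unitmx.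
Proof.
move=> us eps0.
pose c (i : 'I_m) : F := if i == last i s then eps else 1.
have c0 i : c i != 0 by rewrite /c; case: ifP; rewrite ?oner_neq0.
pose M' : 'M[F]_m := \matrix_(j < m) ((c (prev s j))^-1 *: bvec (prev s j)).
suff /mulmx1_unit[] : signed_cycle s eps *m M' = 1%:M by [].
apply/row_matrixP => i; rewrite row_mul rowK -scalemxAl bvec_mulmx rowK.
rewrite prev_next // scalerA -/(c i) mulfV // scale1r.
by rewrite row1.
Qed.

Lemma linear_map_unit l l' :
    (forall i, bvec i *m linear_map l *m linear_map l' = bvec i) ->
  linear_map l \in unitmx.
Proof.
move=> ll'; suff /mulmx1_unit[] : linear_map l *m linear_map l' = 1%:M by [].
by apply/row_matrixP=> i; rewrite row_mul -bvec_mulmx ll' row1.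
Qed.
End LinearMaps.

(* An invertible matrix as an element of the general linear group. *)
Definition to_GL (F : finFieldType) (m : nat) (M : 'M[F]_m.-1.+1) :
  {'GL_m[F]} := insubd (1%g : {'GL_m[F]}) M.

Lemma to_GLK (F : finFieldType) (m : nat) (M : 'M[F]_m.-1.+1) :
  M \in unitmx -> GLval (to_GL M) = M.
Proof. by move=> uM; rewrite /to_GL; apply: insubdK. Qed.

Section Isometries.
Variables (F : finFieldType) (m : nat) (J : 'M[F]_m.-1.+1).

Definition isometries : {set {'GL_m[F]}} :=
  [set g | GLval g *m J *m (GLval g)^T == J].

Lemma isometries_group_set : group_set isometries.
Proof.
apply/group_setP; split=> [|g h]; rewrite !inE.
  by rewrite GL_1E trmx1 mulmx1 mul1mx.
move=> /eqP Jg /eqP Jh.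
rewrite GL_MxE trmx_mul !mulmxA -(mulmxA _ _ J) -(mulmxA _ (_ *m J)) Jh.
by rewrite Jg.
Qed.
Canonical isometries_group := Group isometries_group_set.
End Isometries.

Section Descend.
Variables (F L : finFieldType) (emb : {rmorphism F -> L}).

(* The element of F that emb identifies with x, for x in the image of emb. *)
Definition descend (x : L) : F := odflt 0 [pick a | emb a == x].

Lemma descendK x : x ^+ #|F| = x -> emb (descend x) = x.
Proof.
move=> xF; rewrite /descend; case: pickP => [a /eqP //|noa].
have : (map_poly emb ('X^#|F| - 'X)).[x] = 0.
  by rewrite rmorphB /= map_polyXn map_polyX !hornerE xF subrr.
rewrite finField_genPoly rmorph_prod horner_prod => /eqP/prodf_eq0[a _].
rewrite /= map_polyXsubC hornerXsubC subr_eq0 eq_sym.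
by rewrite noa.
Qed.
End Descend.

Section StandardGenerators.
Variables (F L : finFieldType) (emb : {rmorphism F -> L}) (omega : L) (n : nat).
Local Notation q := #|F|.
Local Notation N := (n.*2.-1.+1).

Definition omega0 : F := descend emb (omega ^+ q.+1).
Definition psi : L := omega ^+ (q.+1)./2.
Definition coefA : F :=
  descend emb ((omega ^+ q.-1 + omega ^- q.-1) / 2).
Definition coefB : F :=
  descend emb (psi * (omega ^- q.-1 - omega ^+ q.-1) / 2).
Definition coefC : F :=
  descend emb (psi^-1 * (omega ^- q.-1 - omega ^+ q.-1) / 2).

(* Positions in the basis (e_1, f_1, ..., e_{n-1}, f_{n-1}, w_1, w_2), with
   indices starting from 1 as in e_1. *)
Definition e_pos (i : nat) : 'I_N := inord i.-1.*2.
Definition f_pos (i : nat) : 'I_N := inord i.-1.*2.+1.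
Definition w1_pos : 'I_N := inord n.-1.*2.
Definition w2_pos : 'I_N := inord n.-1.*2.+1.

Local Notation e i := (bvec F (e_pos i)).
Local Notation f i := (bvec F (f_pos i)).
Local Notation w1 := (bvec F w1_pos).
Local Notation w2 := (bvec F w2_pos).

Definition gram : 'M[F]_N :=
  (\sum_(1 <= i < n)
     (delta_mx (e_pos i) (f_pos i) + delta_mx (f_pos i) (e_pos i)))
  + (- 2) *: delta_mx w1_pos w1_pos + (2 * omega0) *: delta_mx w2_pos w2_pos.

(* Omega^-(2n, q) as the derived subgroup of the full isometry group; for q odd
   and n > 1 this is also the kernel of the spinor norm on SO^-(2n, q). *)
Definition Omega_minus : {group {'GL_n.*2[F]}} :=
  [~: isometries gram, isometries gram]%G.

Definition sigma_mx : 'M[F]_N :=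
  linear_map [:: (e_pos 1, e 1 + e 2); (f_pos 2, f 2 - f 1)].
Definition tau_mx : 'M[F]_N :=
  linear_map [:: (e_pos 1, e 1 + f 1 + w1); (w1_pos, w1 + 2 *: f 1)].
Definition delta_gen_mx : 'M[F]_N :=
  linear_map [:: (e_pos 1, omega0^-1 *: e 1); (f_pos 1, omega0 *: f 1);
                 (w1_pos, coefA *: w1 - coefC *: w2);
                 (w2_pos, - coefB *: w1 + coefA *: w2)].
Definition z_mx : 'M[F]_N :=
  linear_map [:: (e_pos 1, f 1); (f_pos 1, e 1); (w1_pos, - w1)].
Definition U_mx : 'M[F]_N :=
  signed_cycle [:: e_pos 1; e_pos 2] (-1) *m
  signed_cycle [:: f_pos 1; f_pos 2] (-1).
Definition V_mx : 'M[F]_N :=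
  signed_cycle [seq e_pos i | i <- iota 1 n.-1] ((-1) ^+ n) *m
  signed_cycle [seq f_pos i | i <- iota 1 n.-1] ((-1) ^+ n).

Definition sigma_gen : {'GL_n.*2[F]} := to_GL sigma_mx.
Definition tau_gen : {'GL_n.*2[F]} := to_GL tau_mx.
Definition delta_gen : {'GL_n.*2[F]} := to_GL delta_gen_mx.
Definition z_gen : {'GL_n.*2[F]} := to_GL z_mx.
Definition U_gen : {'GL_n.*2[F]} := to_GL U_mx.
Definition V_gen : {'GL_n.*2[F]} := to_GL V_mx.

(* The signed permutation matrices of degree n - 1 of (1, 2)^- and
   (1, ..., n - 1)^eps, where eps = (-1)^n makes the determinant 1; F has odd
   characteristic, so its signs 1 and -1 are distinct. *)
Definition p_pos (i : nat) : 'I_n.-1.-1.+1 := inord i.-1.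
Definition signed_perm_U_mx : 'M[F]_n.-1.-1.+1 :=
  signed_cycle [:: p_pos 1; p_pos 2] (-1).
Definition signed_perm_V_mx : 'M[F]_n.-1.-1.+1 :=
  signed_cycle [seq p_pos i | i <- iota 1 n.-1] ((-1) ^+ n).

Definition signed_perm_U : {'GL_n.-1[F]} := to_GL signed_perm_U_mx.
Definition signed_perm_V : {'GL_n.-1[F]} := to_GL signed_perm_V_mx.

(* The coefficients above do come from F, and the matrices are invertible,
   hence the generators have the intended matrices. *)
Section Correctness.
Variables (p d : nat).
Hypotheses (p_pr : prime p) (p_odd : odd p) (card_F : q = (p ^ d)%N).
Hypotheses (card_L : #|L| = (q ^ 2)%N) (n_ge3 : (3 <= n)%N).
Hypotheses (omega_prim : #|L|.-1.-primitive_root omega).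

Let q_gt1 : (1 < q)%N. Proof. exact: finNzRing_gt1. Qed.

Let q_odd : odd q.
Proof. by rewrite card_F oddX p_odd orbT. Qed.

Let omega_q2 : omega ^+ (q ^ 2) = omega.
Proof. by rewrite -card_L expf_card. Qed.

Let omega_neq0 : omega != 0.
Proof.
apply/eqP => w0; have := prim_expr_order omega_prim.
by rewrite w0 expr0n card_L -subn1 subn_eq0 leqNgt (ltn_exp2l 0) // => /eqP;
  rewrite eq_sym oner_eq0.
Qed.

Let pcharL : p \in [pchar L].
Proof. by apply: (@card_finPcharP _ p (d * 2)) => //; rewrite card_L card_F expnM. Qed.

Let frobD (x y : L) : (x + y) ^+ q = x ^+ q + y ^+ q.
Proof.
apply: exprDn_pchar; rewrite card_F pnatX; apply/orP; left.
by rewrite pnatE.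
Qed.

Let frobN (x : L) : (- x) ^+ q = - x ^+ q.
Proof. by rewrite exprNn -signr_odd q_odd expr1 mulN1r. Qed.

Let frob_fix2 : (2 : L) ^+ q = 2.
Proof. by rewrite [2]mulr2n frobD expr1n. Qed.

Let neq0_2 (K : fieldType) : p \in [pchar K] -> (2 : K) != 0.
Proof.
move=> pK; rewrite -(dvdn_pcharf pK) dvdn_prime2 //.
by apply: contraL p_odd => /eqP ->.
Qed.

Let frob_root : (omega ^+ q.-1) ^+ q = omega ^- q.-1.
Proof.
apply: (mulIf (expf_neq0 q.-1 omega_neq0)); rewrite mulVf ?expf_neq0 //.
rewrite -exprM -exprD; apply: (mulIf omega_neq0); rewrite mul1r -exprSr.
rewrite -[RHS]omega_q2; congr (_ ^+ _).
by rewrite -addnS prednK 1?ltnW // -mulSnr prednK 1?ltnW.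
Qed.

Let frob_rootV : (omega ^- q.-1) ^+ q = omega ^+ q.-1.
Proof. by rewrite exprVn frob_root invrK. Qed.

Let half2 : (q.+1)./2.*2 = q.+1.
Proof. by rewrite -[RHS]odd_double_half /= q_odd. Qed.

Let expo_half : ((q.+1)./2 * q.-1 * 2 = #|L|.-1)%N.
Proof.
by rewrite mulnAC muln2 half2 card_L mulnC -!subn1 -(addn1 q) -subn_sqr exp1n.
Qed.

Let psi_frob : psi ^+ q = - psi.
Proof.
have := expo_half; rewrite /psi; set h := (q.+1)./2 => hq.
have h0 : (0 < h * q.-1)%N.
  by rewrite muln_gt0 -subn1 subn_gt0 q_gt1 andbT -double_gt0 /h half2.
have : (omega ^+ (h * q.-1)) ^+ 2 == 1.
  by rewrite -exprM hq prim_expr_order.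
rewrite sqrf_eq1 => /orP[|/eqP w1].
  rewrite -(prim_order_dvd omega_prim) => /(dvdn_leq h0).
  by rewrite -hq muln2 -addnn -leq_subRL ?leqnn // subnn leqNgt h0.
rewrite -exprM -{1}[q]prednK 1?ltnW // mulnSr.
by rewrite exprD w1 mulN1r.
Qed.

Lemma omega0E : emb omega0 = omega ^+ q.+1.
Proof.
apply: descendK; rewrite -exprM mulSn exprD mulnn omega_q2.
by rewrite -exprSr.
Qed.

Lemma coefAE : emb coefA = (omega ^+ q.-1 + omega ^- q.-1) / 2.
Proof.
by apply: descendK; rewrite exprMn exprVn frobD frob_fix2 frob_root frob_rootV addrC.
Qed.

Let diff_frob :
  (omega ^- q.-1 - omega ^+ q.-1) ^+ q = - (omega ^- q.-1 - omega ^+ q.-1).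
Proof. by rewrite frobD frobN frob_root frob_rootV opprB. Qed.

Lemma coefBE : emb coefB = psi * (omega ^- q.-1 - omega ^+ q.-1) / 2.
Proof.
by apply: descendK; rewrite !exprMn exprVn frob_fix2 psi_frob diff_frob mulrNN.
Qed.

Lemma coefCE : emb coefC = psi^-1 * (omega ^- q.-1 - omega ^+ q.-1) / 2.
Proof.
apply: descendK; rewrite !exprMn !exprVn frob_fix2 psi_frob diff_frob.
by rewrite invrN mulrNN.
Qed.

Let omega0_neq0 : omega0 != 0.
Proof. by rewrite -(fmorph_eq0 emb) omega0E expf_neq0. Qed.

Let coef_det : coefA * coefA - coefC * coefB = 1.
Proof.
apply: (fmorph_inj emb); rewrite rmorphB !rmorphM rmorph1 coefAE coefBE coefCE.
have psi0 : psi != 0 by rewrite expf_neq0.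
have L2 := neq0_2 pcharL; have wq0 : omega ^+ q.-1 != 0 by rewrite expf_neq0.
by field; rewrite L2 psi0 wq0.
Qed.

Let N_gt3 : (4 < n.*2.-1.+1)%N.
Proof. by case: (n) n_ge3 => [|[|[|m]]]. Qed.

Let inN i : (i < n)%N -> (i.*2.+1 < n.*2.-1.+1)%N.
Proof. by move=> ltin; rewrite prednK ?double_gt0 ?(leq_trans _ n_ge3) // -doubleS leq_double. Qed.

Let val_e i : (0 < i < n)%N -> e_pos i = i.-1.*2 :> nat.
Proof. by case: i => //= i; move=> /ltnW/inN lti; rewrite inordK // ltnW. Qed.
Let val_f i : (0 < i < n)%N -> f_pos i = i.-1.*2.+1 :> nat.
Proof. by case: i => //= i; move=> /ltnW/inN lti; rewrite inordK. Qed.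
Let val_w1 : w1_pos = n.-1.*2 :> nat.
Proof. by rewrite inordK // ltnW // inN // ltn_predL (leq_trans _ n_ge3). Qed.
Let val_w2 : w2_pos = n.-1.*2.+1 :> nat.
Proof. by rewrite inordK // inN // ltn_predL (leq_trans _ n_ge3). Qed.

Let posE := (val_e, val_f, val_w1, val_w2).

Let pos_uniq :
  uniq [:: e_pos 1; f_pos 1; e_pos 2; f_pos 2; w1_pos; w2_pos].
Proof.
rewrite -(map_inj_uniq val_inj) /= !posE //; try by rewrite (leq_trans _ n_ge3).
case: n n_ge3 => [|[|[|m]]] // _.
by rewrite /= !inE !doubleS !eqSS /= ltn_eqF.
Qed.

Let e1 := e_pos 1. Let f1 := f_pos 1. Let e2 := e_pos 2. Let f2 := f_pos 2.

Let neq (x y : 'I_N) := ((x == y = false) * (y == x = false))%type.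

Let posF :
  (neq e1 f1 * neq e1 e2 * neq e1 f2 * neq e1 w1_pos * neq e1 w2_pos *
   neq f1 e2 * neq f1 f2 * neq f1 w1_pos * neq f1 w2_pos *
   neq e2 f2 * neq e2 w1_pos * neq e2 w2_pos *
   neq f2 w1_pos * neq f2 w2_pos *
   neq w1_pos w2_pos)%type.
Proof.
have := pos_uniq; rewrite -/e1 -/e2 -/f1 -/f2 /= !inE !negb_or /neq.
move=> uniq_pos; repeat match goal with
  | H : is_true (_ && _) |- _ => case/andP: H => ? ? end.
by repeat split; apply/negbTE; rewrite // eq_sym.
Qed.

Local Ltac simpl_maps :=
  rewrite ?(mulmxDl, mulmxBl, mulNmx) -?scalemxAl ?linear_mapE /= ?(eqxx, posF) /=.

Lemma sigma_mx_unit : sigma_mx \in unitmx.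
Proof.
apply: (@linear_map_unit _ _ _ [:: (e1, e 1 - e 2); (f2, f 2 + f 1)]) => i.
rewrite linear_mapE /= -/e1 -/f2 -/e2 -/f1; case: (i =P e1) => [->|/eqP/negbTE ie1].
  by simpl_maps; rewrite subrK.
case: (i =P f2) => [->|/eqP/negbTE if2]; simpl_maps; first by rewrite addrK.
by rewrite ie1 if2.
Qed.

Lemma tau_mx_unit : tau_mx \in unitmx.
Proof.
apply: (@linear_map_unit _ _ _
  [:: (e1, e 1 + f 1 - w1); (w1_pos, w1 - 2 *: f 1)]) => i.
rewrite linear_mapE /= -/e1 -/f1; case: (i =P e1) => [->|/eqP/negbTE ie1].
  simpl_maps; rewrite -[_ + f 1 + _]addrA [f 1 + _]addrCA.
  rewrite [_ + (w1 + _)]addrA subrK -addrA [f 1 + _]addrA -mulr2n -scaler_nat.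
  by rewrite subrr addr0.
case: (i =P w1_pos) => [->|/eqP/negbTE iw1]; simpl_maps; first by rewrite subrK.
by rewrite ie1 iw1.
Qed.

Lemma delta_gen_mx_unit : delta_gen_mx \in unitmx.
Proof.
apply: (@linear_map_unit _ _ _
  [:: (e1, omega0 *: e 1); (f1, omega0^-1 *: f 1);
      (w1_pos, coefA *: w1 + coefC *: w2);
      (w2_pos, coefB *: w1 + coefA *: w2)]) => i.
rewrite linear_mapE /= -/e1 -/f1; case: (i =P e1) => [->|/eqP/negbTE ie1].
  by simpl_maps; rewrite scalerA mulVf // scale1r.
case: (i =P f1) => [->|/eqP/negbTE if1].
  by simpl_maps; rewrite scalerA mulfV // scale1r.
have cd := coef_det.
case: (i =P w1_pos) => [->|/eqP/negbTE iw1].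
  simpl_maps; rewrite !scalerDr !scalerA opprD addrACA -!scalerBl cd.
  by rewrite mulrC [coefC * _]mulrC subrr scale0r addr0 scale1r.
case: (i =P w2_pos) => [->|/eqP/negbTE iw2].
  simpl_maps; rewrite !scalerDr !scalerA addrACA -!scalerDl !mulNr.
  by rewrite [coefA * coefB]mulrC addNr scale0r add0r addrC [coefB * _]mulrC cd scale1r.
by simpl_maps; rewrite ie1 if1 iw1 iw2.
Qed.

Lemma z_mx_unit : z_mx \in unitmx.
Proof.
apply: (@linear_map_unit _ _ _ [:: (e1, f 1); (f1, e 1); (w1_pos, - w1)]) => i.
rewrite linear_mapE /= -/e1 -/f1; case: (i =P e1) => [->|/eqP/negbTE ie1].
  by simpl_maps.
case: (i =P f1) => [->|/eqP/negbTE if1]; first by simpl_maps.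
case: (i =P w1_pos) => [->|/eqP/negbTE iw1]; first by simpl_maps; rewrite opprK.
by simpl_maps; rewrite ie1 if1 iw1.
Qed.

Lemma U_mx_unit : U_mx \in unitmx.
Proof.
by rewrite unitmx_mul !signed_cycle_unit ?oppr_eq0 ?oner_eq0 //= inE
  -/e1 -/e2 -/f1 -/f2 posF.
Qed.

Let n_gt0 : (0 < n)%N. Proof. exact: leq_trans n_ge3. Qed.

Lemma V_mx_unit : V_mx \in unitmx.
Proof.
rewrite unitmx_mul !signed_cycle_unit ?signr_eq0 // map_inj_in_uniq ?iota_uniq //.
  move=> i j; rewrite !mem_iota !add1n (prednK n_gt0) => li lj.
  move/(congr1 val); rewrite /= !posE // => /succn_inj/double_inj.
  by case: i j li lj => [|i] [|j] //= _ _ ->.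
move=> i j; rewrite !mem_iota !add1n (prednK n_gt0) => li lj.
move/(congr1 val); rewrite /= !posE // => /double_inj.
by case: i j li lj => [|i] [|j] //= _ _ ->.
Qed.

Lemma signed_perm_U_unit : signed_perm_U_mx \in unitmx.
Proof.
rewrite signed_cycle_unit ?oppr_eq0 ?oner_eq0 //= inE -val_eqE /=.
by rewrite !inordK // ltnS -!subn1 -subnDA subn_gt0.
Qed.

Lemma signed_perm_V_unit : signed_perm_V_mx \in unitmx.
Proof.
rewrite signed_cycle_unit ?signr_eq0 // map_inj_in_uniq ?iota_uniq //.
move=> i j; rewrite !mem_iota; move: n_ge3.
rewrite /p_pos; case: n => [|[|m]] //= _; case: i j => [|i] [|j] //=.
by rewrite !add1n !ltnS => li lj /(congr1 val); rewrite /= !inordK // => ->.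
Qed.

Lemma standard_generatorsE :
  [/\ [/\ GLval sigma_gen = sigma_mx, GLval tau_gen = tau_mx & GLval delta_gen = delta_gen_mx],
      GLval z_gen = z_mx, GLval U_gen = U_mx & GLval V_gen = V_mx].
Proof.
by rewrite !to_GLK ?sigma_mx_unit ?tau_mx_unit ?delta_gen_mx_unit ?z_mx_unit
  ?U_mx_unit ?V_mx_unit.
Qed.

Lemma signed_permsE :
  GLval signed_perm_U = signed_perm_U_mx /\
  GLval signed_perm_V = signed_perm_V_mx.
Proof. by rewrite !to_GLK ?signed_perm_U_unit ?signed_perm_V_unit. Qed.
End Correctness.
End StandardGenerators.

Section Relators.
Local Open Scope group_scope.
Variables (n : nat) (R1 : free_group 2 -> Prop) (R4 : free_group 5 -> Prop).

Local Notation gen i := (free_gen (@Ordinal 6 i isT)).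
Local Notation sigma := (gen 0).
Local Notation tau := (gen 1).
Local Notation delta := (gen 2).
Local Notation z := (gen 3).
Local Notation U := (gen 4).
Local Notation V := (gen 5).

(* A relation x = y is encoded by the relator x * y^-1. *)
Inductive relator : free_group 6 -> Prop :=
| rel_signed_perm r of R1 r : relator (free_lift [tuple U; V] r)
| rel_z_UV : relator [~ z, U ^ V]
| rel_z_VU of (4 < n)%N : relator [~ z, V * U^-1]
| rel_delta_UV : relator [~ delta, U ^ V]
| rel_delta_VU of (4 < n)%N : relator [~ delta, V * U^-1]
| rel_sigma_UV2 of (4 < n)%N : relator [~ sigma, U ^ (V ^+ 2)]
| rel_sigma_VUUV of (5 < n)%N : relator [~ sigma, V * U^-1 * U^-1 ^ V]
| rel_sigma_zV2 : relator [~ sigma, z ^ (V ^+ 2)]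
| rel_sigma_deltaV2 : relator [~ sigma, delta ^ (V ^+ 2)]
| rel_tau_UV : relator [~ tau, U ^ V]
| rel_tau_VU of (4 < n)%N : relator [~ tau, V * U^-1]
| rel_Omega6 r of R4 r :
    relator (free_lift [tuple sigma; tau; delta; z; U] r)
| rel_sigma_sigmaV :
    relator ([~ sigma, sigma ^ V] * (sigma ^ (V * U^-1))^-1)
| rel_sigma_sigmaVU : relator [~ sigma, sigma ^ (V * U^-1)]
| rel_sigma_sigmaW : relator [~ sigma, sigma ^ (U ^ (V * U^-1))]
| rel_sigma_sigmaV2 of (4 < n)%N : relator [~ sigma, sigma ^ (V ^+ 2)]
| rel_sigmaV_tau : relator [~ sigma ^ V, tau].
End Relators.

(* Main.v *)
Require Import Defs.
From HB Require Import structures.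
From mathcomp Require Import all_boot all_order all_algebra.
From mathcomp Require Import all_fingroup all_solvable all_field.
From mathcomp Require Import boolp ring.

Set Implicit Arguments.
Unset Strict Implicit.
Unset Printing Implicit Defensive.

Import GroupScope GRing.Theory.

(** The matrices satisfy the relations, so the presented group G maps to the
isometry group O of the form; write pi for this map. The theorem says that pi
is injective and that its image is the derived group of O.

Everything is computed with the Eichler transformations
  E(u, v) : x |-> x + B(x,u) v - B(x,v) u - Q(v) B(x,u) u,
where u is singular and v is orthogonal to u. They satisfy
E(u,v) E(u,v') = E(u,v+v') and E(u,v)^g = E(ug,vg) for every isometry g. The
hyperbolic planes <e_i, f_i> are numbered from 0 to m-1, where m = n-1, and the
anisotropic plane W = <w_1, w_2> is identified with L = GF(q^2) so that Q is
minus the norm; wv x is the vector of the element x of L. Then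
sigma = E(f_0, e_1), tau = E(f_0, w_1), and U, V, z and z delta are products of
Eichler transformations.

Injectivity. Put u_i = U^(V^i), z_k = z^(V^k), d_k = delta^(V^k), all in G;
then V = u_(m-2) ... u_0. Let Gam k be generated by tau, delta, z, the u_i with
i+2 <= k and, if k >= 2, sigma: its image lives on W and the first k planes.
The relations presenting Omega^-(6,q) say that pi is faithful on Gam 2, and
those presenting the signed permutations make it faithful on <U, V>. By
induction pi is faithful on every Gam k, hence on Gam m = G. For the step, let
H = Gam k and let Q_k be the subgroup of Gam (k+1) of lifts of the E(f_k, v)
with v in the span of W and the first k planes. The remaining relations are
what is needed to see that Q_k is abelian and normalised by H (Qs_Xs,
Gam_nrm_Qs). Then, with D = <d_k> and P = Q_k H, the set
  P z_k D Q_k  |_|  P u_(k-1) Q_k H  |_|  P D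
is stable under right multiplication by generators, so that it is all of
Gam (k+1) (bruhat_cosets). The three parts are the double cosets of the
stabiliser of the point <f_k>: they move it to a point that is not orthogonal
to it, to an orthogonal point, or fix it. Therefore an element with trivial
image lies in P D, then in P, and then in H, where pi is faithful
(faithful_next). The identities needed for stability all come, by conjugation
with a power of V, from identities between elements of Gam 2, and these can be
read off from the matrices because pi is faithful there. No group order is
used.

Image. The generators are products of Eichler transformations and conjugates
of commutators, so that they lie in [O, O] (gens_D). Conversely, the group X
generated by the matrices is transitive enough on vectors to give O = X O(W),
where O(W) fixes every e_i and f_i (descend_OW). The group O(W) normalises X,
and its commutators are rotations of W that are powers of delta^(q-1); so
[O, O] is contained in X (D_gens). *)

(** * Eichler transformations *)

Local Open Scope ring_scope.

Notation "x *v g" := (x *m GLval g) (at level 40, left associativity) : ring_scope.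

Section Eichler.
Variables (F : finFieldType) (m : nat) (J : 'M[F]_m.-1.+1).
Hypotheses (symJ : J^T = J) (two : (2 : F) != 0).
Local Notation vec := 'rV[F]_m.-1.+1.
Local Notation GL := {'GL_m[F]}.

Definition bform (x y : vec) : F := (x *m J *m y^T) 0 0.
Local Notation B := bform.
Definition qform (x : vec) : F := B x x / 2.
Local Notation Q := qform.

Lemma bformC x y : B x y = B y x.
Proof.
by rewrite /B -[x *m J *m _]trmxK [in LHS]mxE !trmx_mul trmxK symJ mulmxA.
Qed.

Lemma bformDl x y z : B (x + y) z = B x z + B y z.
Proof. by rewrite /B !mulmxDl mxE. Qed.
Lemma bformZl a x z : B (a *: x) z = a * B x z.
Proof. by rewrite /B -!scalemxAl mxE. Qed.
Lemma bformNl x z : B (- x) z = - B x z.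
Proof. by rewrite -scaleN1r bformZl mulN1r. Qed.
Lemma bformDr x y z : B z (x + y) = B z x + B z y.
Proof. by rewrite !(bformC z) bformDl. Qed.
Lemma bformZr a x z : B z (a *: x) = a * B z x.
Proof. by rewrite !(bformC z) bformZl. Qed.
Lemma bformNr x z : B z (- x) = - B z x.
Proof. by rewrite !(bformC z) bformNl. Qed.
Lemma bform0l z : B 0 z = 0.
Proof. by rewrite -(scale0r z) bformZl mul0r. Qed.
Lemma bform0r z : B z 0 = 0.
Proof. by rewrite bformC bform0l. Qed.
Definition bformE := (bformDl, bformDr, bformZl, bformZr, bformNl, bformNr, bform0l, bform0r).

Lemma bformQ x : B x x = 2 * Q x.
Proof. by rewrite /Q mulrC divfK. Qed.

Lemma actM (x : vec) (g h : GL) : x *v (g * h)%g = x *v g *v h.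
Proof. by rewrite GL_MxE mulmxA. Qed.
Lemma act1 (x : vec) : x *v (1%g : GL) = x.
Proof. by rewrite GL_1E mulmx1. Qed.
Lemma actK (x : vec) (g : GL) : x *v g *v g^-1%g = x.
Proof. by rewrite -actM mulgV act1. Qed.
Lemma actKV (x : vec) (g : GL) : x *v g^-1%g *v g = x.
Proof. by rewrite -actM mulVg act1. Qed.
Lemma actE_ext (g h : GL) : (forall x : vec, x *v g = x *v h) -> g = h.
Proof. by move=> gh; apply/val_inj/row_matrixP=> i; rewrite !rowE gh. Qed.
Lemma act_inv (x y : vec) (g : GL) : x *v g = y -> y *v g^-1%g = x.
Proof. by move<-; rewrite actK. Qed.
Lemma actD (x y : vec) (g : GL) : (x + y) *v g = x *v g + y *v g.
Proof. exact: mulmxDl. Qed.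
Lemma actN (x : vec) (g : GL) : (- x) *v g = - (x *v g).
Proof. exact: mulNmx. Qed.
Lemma actB (x y : vec) (g : GL) : (x - y) *v g = x *v g - y *v g.
Proof. exact: mulmxBl. Qed.
Lemma actZ a (x : vec) (g : GL) : (a *: x) *v g = a *: (x *v g).
Proof. by rewrite scalemxAl. Qed.
Definition actL := (actD, actN, actB, actZ).

Local Notation O := (Defs.isometries J).

Lemma isometryP (g : GL) :
  reflect (forall x y, B (x *v g) (y *v g) = B x y) (g \in O).
Proof.
rewrite inE; apply: (iffP eqP) => [Jg x y | Bg].
  by rewrite /B trmx_mul !mulmxA -(mulmxA x) -(mulmxA x) Jg.
apply/matrixP=> i j; have := Bg (delta_mx 0 i) (delta_mx 0 j).
rewrite /B trmx_mul !mulmxA -(mulmxA (delta_mx 0 i)) -(mulmxA (delta_mx 0 i)).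
by rewrite !trmx_delta -!rowE -!colE !mxE.
Qed.

Lemma isomB g x y : g \in O -> B (x *v g) (y *v g) = B x y.
Proof. by move/isometryP. Qed.


Lemma isom1 : 1%g \in O.
Proof. by apply/isometryP=> x y; rewrite !act1. Qed.
Lemma isomM g h : g \in O -> h \in O -> (g * h)%g \in O.
Proof. by move=> Og Oh; apply/isometryP=> x y; rewrite !actM !isomB. Qed.
Lemma isomV g : g \in O -> g^-1%g \in O.
Proof. by move=> Og; apply/isometryP=> x y; rewrite -(isomB _ _ Og) !actKV. Qed.
Lemma isomX g k : g \in O -> (g ^+ k)%g \in O.
Proof. by move=> Og; elim: k => [|k IH]; [exact: isom1 | rewrite expgS isomM]. Qed.
Lemma isomJ g h : g \in O -> h \in O -> (g ^ h)%g \in O.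
Proof. by move=> Og Oh; rewrite conjgE !isomM ?isomV. Qed.

(** The condition under which E(u,v) is an isometry. *)
Definition eich (u v : vec) := (B u u = 0) /\ (B u v = 0).

Definition eichler_mx u v : 'M[F]_m.-1.+1 :=
  1%:M + J *m u^T *m v - J *m v^T *m u - Q v *: (J *m u^T *m u).

Lemma eichler_mxE x u v : x *m eichler_mx u v =
  x + B x u *: v - B x v *: u - (Q v * B x u) *: u.
Proof.
have E (a b : vec) : x *m (J *m a^T *m b) = B x a *: b.
  by rewrite !mulmxA [_ *m a^T]mx11_scalar mul_scalar_mx.
by rewrite /eichler_mx !mulmxBr mulmxDr mulmx1 -scalemxAr !E scalerA.
Qed.

Lemma qformZ a v : Q (a *: v) = a ^+ 2 * Q v.
Proof. by rewrite /Q !bformE; field. Qed.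
Lemma qformN v : Q (- v) = Q v.
Proof. by rewrite /Q !bformE opprK. Qed.
Lemma qformD v w : Q (v + w) = Q v + Q w + B v w.
Proof. by rewrite /Q !bformE (bformC w v); field. Qed.
Lemma qform_isom g v : g \in O -> Q (v *v g) = Q v.
Proof. by move=> Og; rewrite /Q isomB. Qed.
Lemma qform0 : Q 0 = 0. Proof. by rewrite /Q bform0l mul0r. Qed.

Lemma eichler_unit u v : eich u v -> eichler_mx u v \in unitmx.
Proof.
case=> uu uv; suff /mulmx1_unit[] : eichler_mx u v *m eichler_mx u (- v) = 1%:M by [].
apply/row_matrixP=> i; rewrite row_mul !rowE -mulmxA mulmxA; move: (delta_mx _ _) => x.
rewrite mulmx1 !eichler_mxE qformN !bformE (bformC v u) uv uu !bformQ.
by apply/rowP=> j; rewrite !mxE; ring.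
Qed.

Definition eichler u v : GL := to_GL (eichler_mx u v).
Local Notation E := eichler.

Lemma eichlerE u v : eich u v -> forall x : vec, x *v E u v =
  x + B x u *: v - B x v *: u - (Q v * B x u) *: u.
Proof. by move=> uv x; rewrite to_GLK ?eichler_unit // eichler_mxE. Qed.

Lemma eichler_isom u v : eich u v -> E u v \in O.
Proof.
move=> uv; apply/isometryP=> x y; rewrite !eichlerE //; case: uv => uu uv.
by rewrite !bformE (bformC v u) uu uv (bformC u y) (bformC v y) bformQ; ring.
Qed.

Lemma eichD u v v' : eich u v -> eich u v' -> eich u (v + v').
Proof. by case=> uu uv [_ uv']; split=> //; rewrite bformDr uv uv' addr0. Qed.
Lemma eichN u v : eich u v -> eich u (- v).
Proof. by case=> uu uv; split=> //; rewrite bformNr uv oppr0. Qed.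
Lemma eichZ u v a : eich u v -> eich u (a *: v).
Proof. by case=> uu uv; split=> //; rewrite bformZr uv mulr0. Qed.
Lemma eich_isom g u v : g \in O -> eich u v -> eich (u *v g) (v *v g).
Proof. by move=> Og [uu uv]; split; rewrite isomB. Qed.

Lemma eichlerD u v v' : eich u v -> eich u v' -> (E u v * E u v')%g = E u (v + v').
Proof.
move=> uv uv'; have uvv := eichD uv uv'; apply: actE_ext => x.
rewrite actM !eichlerE //; case: uv => uu uv; case: uv' => _ uv'.
rewrite qformD !bformE (bformC v u) uv uu uv'.
by apply/rowP=> j; rewrite !mxE; ring.
Qed.

Lemma eichler0 u : B u u = 0 -> E u 0 = 1%g.
Proof.
move=> uu; apply: actE_ext => x.
rewrite eichlerE; last by split; rewrite // bform0r.
by rewrite qform0 act1 bform0r mul0r !scale0r scaler0 !subr0 addr0.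
Qed.

Lemma eichlerN u v : eich u v -> (E u v)^-1%g = E u (- v).
Proof.
move=> uv; apply: mulg1_eq; rewrite eichlerD ?subrr ?eichler0 //; first by case: uv.
exact: eichN.
Qed.

Lemma eichlerJ g u v : g \in O -> eich u v -> (E u v ^ g)%g = E (u *v g) (v *v g).
Proof.
move=> Og uv; apply: actE_ext => x; rewrite conjgE !actM !eichlerE //; last exact: eich_isom.
have BV y : B (x *v g^-1%g) y = B x (y *v g) by rewrite -(isomB _ y Og) actKV.
by rewrite !actL actKV !BV qform_isom.
Qed.

Lemma eichlerZ u v c : eich u v -> E (c *: u) v = E u (c *: v).
Proof.
move=> uv; have uv2 := eichZ c uv; apply: actE_ext => x.
rewrite !eichlerE //; last by case: uv => uu uv; split; rewrite !bformE ?uu ?uv ?mulr0.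
by rewrite !bformE qformZ; apply/rowP=> j; rewrite !mxE; ring.
Qed.

Lemma eichler_swap u v : eich u v -> B v v = 0 -> E u v = E v (- u).
Proof.
move=> uv vv; case: (uv) => uu uv0; apply: actE_ext => x.
rewrite !eichlerE //; last by split; rewrite // bformNr bformC uv0 oppr0.
rewrite qformN /Q uu vv !bformE; apply/rowP=> j; rewrite !mxE; ring.
Qed.

(** E(u,v) moves e to e + v - Q(v) u when e pairs to 1 with u and to 0 with v; so
    it is trivial only if v is a multiple of u. *)
Lemma eichler_eq1 e u v : B e u = 1 -> eich u v -> B e v = 0 -> E u v = 1%g -> v = Q v *: u.
Proof.
move=> eu uv ev E1; have := eichlerE uv e; rewrite E1 act1 eu ev.
rewrite scale1r scale0r subr0 mulr1 => /eqP; rewrite -addrA -{1}[e]addr0.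
by rewrite (inj_eq (addrI e)) eq_sym subr_eq0 => /eqP.
Qed.

Definition hyp (e f : vec) := [/\ B e e = 0, B f f = 0 & B e f = 1].

(** The product that represents the reflection in the Weyl group of the rank one
    group generated by the E(f,_) and E(e,_). Two cases matter: v non-singular
    and x = v / Q(v), when the product exchanges the lines of e and f and reflects
    in v, and (v, x) a hyperbolic pair orthogonal to e and f, when it exchanges
    two hyperbolic planes. *)
Definition weyl (e f v x : vec) : GL := (E f x * E e v * E f x)%g.

Section Weyl.
Variables (e f v x : vec).
Hypotheses (ef : hyp e f) (ev : B e v = 0) (fv : B f v = 0).

Let ee : B e e = 0. Proof. by case: ef. Qed.
Let ff : B f f = 0. Proof. by case: ef. Qed.
Let e_f : B e f = 1. Proof. by case: ef. Qed.
Let f_e : B f e = 1. Proof. by rewrite bformC. Qed.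
Let v_e : B v e = 0. Proof. by rewrite bformC. Qed.
Let v_f : B v f = 0. Proof. by rewrite bformC. Qed.

Section NonSingular.
Hypothesis (v0 : Q v != 0) (xv : x = (Q v)^-1 *: v).

Let e1 : eich e v. Proof. by split. Qed.
Let e2 : eich f x. Proof. by split; rewrite // xv bformZr fv mulr0. Qed.

Local Ltac go := rewrite /weyl !actM !eichlerE // xv qformZ !(bformE, bformQ v, ee, ff, e_f, f_e, v_e, v_f, ev, fv).

Lemma weyl_f : f *v weyl e f v x = - Q v *: e.
Proof. by go; apply/rowP=> j; rewrite !mxE; field. Qed.
Lemma weyl_e : e *v weyl e f v x = - (Q v)^-1 *: f.
Proof. by go; apply/rowP=> j; rewrite !mxE; field. Qed.
Lemma weyl_r r : B e r = 0 -> B f r = 0 -> r *v weyl e f v x = r - (B r v / Q v) *: v.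
Proof.
move=> er fr; have re : B r e = 0 by rewrite bformC.
have rf : B r f = 0 by rewrite bformC.
by go; rewrite ?(re, rf); apply/rowP=> j; rewrite !mxE; field.
Qed.
End NonSingular.

Section Singular.
Hypotheses (ex : B e x = 0) (fx : B f x = 0) (vx : hyp v x).

Let vv : B v v = 0. Proof. by case: vx. Qed.
Let xx : B x x = 0. Proof. by case: vx. Qed.
Let v_x : B v x = 1. Proof. by case: vx. Qed.
Let x_v : B x v = 1. Proof. by rewrite bformC. Qed.
Let x_e : B x e = 0. Proof. by rewrite bformC. Qed.
Let x_f : B x f = 0. Proof. by rewrite bformC. Qed.
Let e1 : eich e v. Proof. by split. Qed.
Let e2 : eich f x. Proof. by split. Qed.
Let Qv : Q v = 0. Proof. by rewrite /Q vv mul0r. Qed.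
Let Qx : Q x = 0. Proof. by rewrite /Q xx mul0r. Qed.

Local Ltac go := rewrite /weyl !actM !eichlerE // !(bformE, ee, ff, e_f, f_e, v_e, v_f, ev, fv, Qv, Qx, vv, xx, v_x, x_v, x_e, x_f, ex, fx); apply/rowP=> j; rewrite !mxE; ring.

Lemma weyl_sf : f *v weyl e f v x = v. Proof. by go. Qed.
Lemma weyl_sv : v *v weyl e f v x = - f. Proof. by go. Qed.
Lemma weyl_se : e *v weyl e f v x = x. Proof. by go. Qed.
Lemma weyl_sx : x *v weyl e f v x = - e. Proof. by go. Qed.
Lemma weyl_sr r : B r e = 0 -> B r f = 0 -> B r v = 0 -> B r x = 0 ->
  r *v weyl e f v x = r.
Proof. by move=> re rf rv rx; rewrite /weyl !actM !eichlerE // !(bformE, re, rf, rv, rx); apply/rowP=> j; rewrite !mxE; ring. Qed.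
End Singular.
End Weyl.

Lemma weyl_isom e f v x : eich e v -> eich f x -> weyl e f v x \in O.
Proof. by move=> ev fx; rewrite !isomM ?eichler_isom. Qed.

Lemma weylJ e f v x g : eich e v -> eich f x -> g \in O ->
  (weyl e f v x ^ g)%g = weyl (e *v g) (f *v g) (v *v g) (x *v g).
Proof. by move=> ev fx Og; rewrite /weyl !conjMg !eichlerJ. Qed.
End Eichler.

Fact Um_key : unit. Proof. by []. Qed.

Fact z1_key : unit. Proof. by []. Qed.

(** * Signed cycles *)

Lemma signed_cycleE (F : finFieldType) M (s : seq 'I_M) (eps : F) i :
  bvec F i *m signed_cycle s eps = (if i == last i s then eps else 1) *: bvec F (next s i).
Proof. by rewrite bvec_mulmx rowK. Qed.

Lemma signed_cycle_notin (F : finFieldType) M x (s : seq 'I_M) (eps : F) i :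
  i \notin x :: s -> bvec F i *m signed_cycle (x :: s) eps = bvec F i.
Proof.
move=> si; rewrite signed_cycleE next_nth (negbTE si) /=; case: eqP => [E|_]; last by rewrite scale1r.
by case/negP: si; rewrite [X in X \in _]E mem_last.
Qed.

Lemma signed_cycle_iota (F : finFieldType) M (g : nat -> 'I_M) k (eps : F) j :
  (forall a b, (a < k)%N -> (b < k)%N -> g a.+1 = g b.+1 -> a = b) -> (j < k)%N ->
  bvec F (g j.+1) *m signed_cycle [seq g i | i <- iota 1 k] eps =
  if (j.+1 == k)%N then eps *: bvec F (g 1%N) else bvec F (g j.+2).
Proof.
case: k => // k injg jk; rewrite signed_cycleE next_nth.
set s := map g _; have us : uniq s.
  rewrite map_inj_in_uniq ?iota_uniq // => -[|a] [|b]; rewrite !mem_iota //= !add1n !ltnS.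
  by move=> ak bk /injg ->.
have nths a : (a < k.+1)%N -> nth (g 1%N) s a = g a.+1.
  by move=> ak; rewrite (nth_map 0%N) ?size_iota // nth_iota.
have szs : size s = k.+1 by rewrite size_map size_iota.
have ins : g j.+1 \in s by rewrite -nths // mem_nth ?szs.
have idx : index (g j.+1) s = j by rewrite -nths // index_uniq ?szs.
have lasts : last (g j.+1) s = g k.+1.
  have -> : last (g j.+1) s = last (g 1%N) s by [].
  by rewrite -nth_last szs nths.
rewrite ins idx lasts /s eqSS /=; case: (ltngtP j k) => jk'; last 1 first.
- rewrite jk' eqxx nth_default ?size_map ?size_iota //.
- case: eqP => [/injg E|_]; first by rewrite E ?ltnn // in jk'.
  by rewrite scale1r (nth_map 0%N) ?size_iota // nth_iota.
by rewrite ltnNge -ltnS jk in jk'.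
Qed.

(** * The form in coordinates *)

Record setting (p d n : nat) (F L : finFieldType) (emb : {rmorphism F -> L})
    (omega : L) : Prop := Setting {
  set_prime : prime p;
  set_odd : odd p;
  set_card_F : #|F| = (p ^ d)%N;
  set_card_L : #|L| = (#|F| ^ 2)%N;
  set_n_ge4 : (4 <= n)%N;
  set_prim : (#|L|.-1).-primitive_root omega }.

Section Coordinates.
Variables (p d n : nat) (F L : finFieldType) (emb : {rmorphism F -> L}) (omega : L).
Hypothesis H : setting p d n emb omega.
Local Notation q := #|F|.
Local Notation N := (n.*2.-1.+1).
Local Notation m := n.-1.
Local Notation vec := 'rV[F]_N.
Local Notation GL := {'GL_n.*2[F]}.
Local Notation om0 := (omega0 emb omega).
Local Notation psi := (psi F omega).
Local Notation J := (gram emb omega n).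
Local Notation p_pr := (set_prime H).
Local Notation odd_p := (set_odd H).
Local Notation card_F := (set_card_F H).
Local Notation card_L := (set_card_L H).
Local Notation n_ge4 := (set_n_ge4 H).
Local Notation omega_prim := (set_prim H).

Set Default Proof Using "All".

Lemma n_ge3 : (3 <= n)%N. Proof. exact: ltnW n_ge4. Qed.
Lemma n_gt0 : (0 < n)%N. Proof. exact: ltnW (ltnW n_ge3). Qed.
Lemma m_ge3 : (2 < m)%N. Proof. by rewrite -ltnS (prednK n_gt0) n_ge4. Qed.
Lemma m_gt0 : (0 < m)%N. Proof. exact: ltn_trans m_ge3. Qed.
Lemma m_gt1 : (1 < m)%N. Proof. exact: ltn_trans m_ge3. Qed.
Lemma n_pred : n = m.+1. Proof. by rewrite (prednK n_gt0). Qed.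

Lemma q_gt1 : (1 < q)%N. Proof. exact: finNzRing_gt1. Qed.
Lemma q_gt0 : (0 < q)%N. Proof. exact: ltnW q_gt1. Qed.
Lemma q1_gt0 : (0 < q.-1)%N. Proof. by rewrite -subn1 subn_gt0 q_gt1. Qed.
Lemma q_odd : odd q. Proof. by rewrite card_F oddX odd_p orbT. Qed.

Lemma pchar_L : p \in [pchar L].
Proof. by apply: (@card_finPcharP _ p (d * 2)); rewrite ?p_pr // card_L card_F expnM. Qed.

Lemma two_L : (2 : L) != 0.
Proof.
rewrite -(dvdn_pcharf pchar_L) dvdn_prime2 ?p_pr //.
by apply: contraL odd_p => /eqP ->.
Qed.

Lemma two_F : (2 : F) != 0.
Proof. by rewrite -(fmorph_eq0 emb) rmorph_nat two_L. Qed.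

Lemma omega_neq0 : omega != 0.
Proof.
apply/eqP => w0; have := prim_expr_order omega_prim.
have gt1 : (1 < #|L|)%N := finNzRing_gt1 L.
rewrite w0 expr0n; move: gt1; case: #|L| => [|[|k]] //= _.
by move/eqP; rewrite eq_sym oner_eq0.
Qed.

Definition frob (x : L) := x ^+ q.
Lemma frobD x y : frob (x + y) = frob x + frob y.
Proof.
apply: exprDn_pchar; rewrite card_F pnatX; apply/orP; left.
by rewrite pnatE ?p_pr // pchar_L.
Qed.
Lemma frobN x : frob (- x) = - frob x.
Proof. by rewrite /frob exprNn -signr_odd q_odd expr1 mulN1r. Qed.
Lemma frob1 : frob 1 = 1. Proof. exact: expr1n. Qed.
Lemma frobM x y : frob (x * y) = frob x * frob y.
Proof. exact: exprMn. Qed.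
Lemma frob_emb a : frob (emb a) = emb a.
Proof. by rewrite /frob -rmorphXn expf_card. Qed.
Lemma frobK x : frob (frob x) = x.
Proof. by rewrite /frob -exprM mulnn -card_L expf_card. Qed.
Lemma omega0_val : emb om0 = omega ^+ q.+1.
Proof. exact: omega0E (set_card_L H). Qed.
Lemma om0_neq0 : om0 != 0.
Proof. by rewrite -(fmorph_eq0 emb) omega0_val expf_neq0 ?omega_neq0. Qed.

Lemma card_L1 : (#|L|.-1 = q.-1 * q.+1)%N.
Proof. by rewrite card_L -!subn1 -(addn1 q) -subn_sqr exp1n. Qed.

Lemma omega_log (x : L) : x != 0 -> exists i, x = omega ^+ i.
Proof.
move=> x0; have : x ^+ #|L|.-1 = 1.
  by apply: (mulfI x0); rewrite -exprS prednK ?(ltnW (finNzRing_gt1 L)) // expf_card mulr1.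
by case/(prim_rootP omega_prim) => i ->; exists i.
Qed.

(** omega0 generates the multiplicative group of F: an element of F is a power
    omega^i fixed by x |-> x^q, which forces q+1 to divide i. *)
Lemma om0_log (a : F) : a != 0 -> exists i, a = om0 ^+ i.
Proof.
move=> a0; have /omega_log[i ai] : emb a != 0 by rewrite fmorph_eq0.
have : omega ^+ (i * q.-1) = 1.
  apply: (mulfI (_ : emb a != 0)); first by rewrite fmorph_eq0.
  by rewrite exprM -ai -exprS prednK ?q_gt0 // [LHS]frob_emb mulr1.
move/eqP; rewrite -(prim_order_dvd omega_prim) card_L1 mulnC.
rewrite dvdn_pmul2r ?q1_gt0 // => /dvdnP[j ij]; exists j.
by apply: (fmorph_inj emb); rewrite rmorphXn omega0_val ai ij mulnC exprM.
Qed.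

(** The elements of norm 1 are the powers of omega^(q-1). *)
Lemma norm1_log (x : L) : x ^+ q.+1 = 1 -> exists i, x = omega ^+ (q.-1 * i).
Proof.
move=> x1; have x0 : x != 0.
  by apply: contraTneq isT => x0; move: x1; rewrite x0 expr0n => /eqP; rewrite eq_sym oner_eq0.
have [i xi] := omega_log x0; move: x1; rewrite xi -exprM => /eqP.
rewrite -(prim_order_dvd omega_prim) card_L1 dvdn_pmul2r // => /dvdnP[j ->].
by exists j; rewrite mulnC.
Qed.

Lemma psi2 : psi ^+ 2 = emb om0.
Proof.
rewrite omega0_val -exprM muln2 -[in RHS](odd_double_half q.+1).
by rewrite /= q_odd.
Qed.
Lemma psi_neq0 : psi != 0. Proof. by rewrite expf_neq0 ?omega_neq0. Qed.

Lemma frob_psi : frob psi = - psi.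
Proof.
have : frob psi ^+ 2 == psi ^+ 2 by rewrite /frob exprAC psi2 [_ ^+ q]frob_emb.
rewrite eqf_sqr => /orP[/eqP E|/eqP //].
have h2 : ((q.+1)./2.*2 = q.+1)%N by rewrite -[RHS]odd_double_half /= q_odd.
have h0 : (0 < (q.+1)./2)%N by rewrite -double_gt0 h2.
have : omega ^+ ((q.+1)./2 * q.-1) == 1.
  by rewrite exprM -(inj_eq (mulfI psi_neq0)) -exprS prednK ?q_gt0 // mulr1; apply/eqP.
rewrite -(prim_order_dvd omega_prim) card_L1 mulnC dvdn_pmul2r ?q1_gt0 //.
by move=> /(dvdn_leq h0); rewrite -{1}h2 -addnn -[X in (_ <= X)%N]addn0 leq_add2l leqNgt h0.
Qed.

Lemma frob_omega_pow i : frob (omega ^+ (q.-1 * i)) = omega ^- (q.-1 * i).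
Proof.
rewrite !exprM -exprVn /frob exprAC; congr (_ ^+ _).
apply: (mulIf (expf_neq0 q.-1 omega_neq0)); rewrite mulVf ?expf_neq0 ?omega_neq0 //.
by rewrite -exprSr -exprM -card_L1 (prim_expr_order omega_prim).
Qed.

(** The elements x of L correspond to the vectors of W = <w_1, w_2> by writing
    x in the basis 1, psi of L over F; psi^q = - psi and psi^2 = omega0, which
    makes Q minus the norm (Q_w below). *)
Definition re (x : L) : F := descend emb ((x + frob x) / 2).
Definition im (x : L) : F := descend emb ((x - frob x) / 2 / psi).

Lemma frob2 : frob 2 = 2. Proof. by rewrite -(rmorph_nat emb 2) frob_emb. Qed.
Lemma frobV x : frob x^-1 = (frob x)^-1. Proof. exact: exprVn. Qed.

Lemma reE x : emb (re x) = (x + frob x) / 2.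
Proof.
by apply: descendK; rewrite -/(frob _) frobM frobV frobD frobK frob2 addrC.
Qed.
Lemma imE x : emb (im x) = (x - frob x) / 2 / psi.
Proof.
apply: descendK; rewrite -/(frob _) !frobM !frobV frobD frobN frobK frob2 frob_psi.
by have P := psi_neq0; have T := two_L; field; rewrite ?oppr_eq0 P T.
Qed.
Lemma re_im x : x = emb (re x) + emb (im x) * psi.
Proof.
by rewrite reE imE; have P := psi_neq0; have T := two_L; field; rewrite ?oppr_eq0 P T.
Qed.
Lemma re_comb a b : re (emb a + emb b * psi) = a.
Proof.
apply: (fmorph_inj emb); rewrite reE frobD frobM !frob_emb frob_psi.
by have T := two_L; field.
Qed.
Lemma im_comb a b : im (emb a + emb b * psi) = b.
Proof.
apply: (fmorph_inj emb); rewrite imE frobD frobM !frob_emb frob_psi.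
by have P := psi_neq0; have T := two_L; field; rewrite ?oppr_eq0 P T.
Qed.

Definition ev (i : nat) : vec := bvec F (e_pos n i.+1).
Definition fv (i : nat) : vec := bvec F (f_pos n i.+1).
Definition w1 : vec := bvec F (w1_pos n).
Definition w2 : vec := bvec F (w2_pos n).
Definition wv (x : L) : vec := re x *: w1 + im x *: w2.

Lemma wvE x : wv x = re x *: w1 + im x *: w2. Proof. by []. Qed.
Lemma wv_comb a b : wv (emb a + emb b * psi) = a *: w1 + b *: w2.
Proof. by rewrite /wv re_comb im_comb. Qed.
Lemma wvD x y : wv (x + y) = wv x + wv y.
Proof.
rewrite {1}(re_im x) {1}(re_im y) addrACA -mulrDl -!rmorphD wv_comb /wv.
by rewrite !scalerDl addrACA.
Qed.
Lemma wvZ c x : wv (emb c * x) = c *: wv x.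
Proof. by rewrite {1}(re_im x) mulrDr mulrA -!rmorphM wv_comb scalerDr !scalerA. Qed.
Lemma wvN x : wv (- x) = - wv x.
Proof. by rewrite -mulN1r -(rmorphN1 emb) wvZ scaleN1r. Qed.
Lemma wv0 : wv 0 = 0.
Proof. by have := wv_comb 0 0; rewrite rmorph0 mul0r addr0 !scale0r addr0. Qed.
Lemma wv1 : wv 1 = w1.
Proof. by have := wv_comb 1 0; rewrite rmorph1 rmorph0 mul0r addr0 scale1r scale0r addr0. Qed.
Lemma wvpsi : wv psi = w2.
Proof. by have := wv_comb 0 1; rewrite rmorph1 rmorph0 mul1r add0r scale1r scale0r add0r. Qed.

Lemma inN i : (i < n)%N -> (i.*2.+1 < N)%N.
Proof. by move=> ltin; rewrite prednK ?double_gt0 ?n_gt0 // -doubleS leq_double. Qed.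
Lemma inNm i : (i < m)%N -> (i < n)%N.
Proof. by move=> ltim; rewrite n_pred ltnS ltnW. Qed.

Lemma e_pos_val i : (i < m)%N -> e_pos n i.+1 = i.*2 :> nat.
Proof. by move=> /inNm/inN lti; rewrite inordK // ltnW. Qed.
Lemma f_pos_val i : (i < m)%N -> f_pos n i.+1 = i.*2.+1 :> nat.
Proof. by move=> /inNm/inN lti; rewrite inordK. Qed.
Lemma w1_pos_val : w1_pos n = m.*2 :> nat.
Proof. by rewrite inordK // ltnW // inN // ltn_predL n_gt0. Qed.
Lemma w2_pos_val : w2_pos n = m.*2.+1 :> nat.
Proof. by rewrite inordK // inN // ltn_predL n_gt0. Qed.

Variant pos_spec : 'I_N -> Prop :=
| PosE i of (i < m)%N : pos_spec (e_pos n i.+1)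
| PosF i of (i < m)%N : pos_spec (f_pos n i.+1)
| PosW1 : pos_spec (w1_pos n)
| PosW2 : pos_spec (w2_pos n).

(** Every position in the basis is that of some e_i, f_i, w_1 or w_2. *)
Lemma posP a : pos_spec a.
Proof.
have ha : (a./2 <= m)%N.
  rewrite -ltnS (prednK n_gt0) ltn_half_double.
  by apply: leq_trans (ltn_ord a) _; rewrite prednK ?double_gt0 ?n_gt0.
have va := odd_double_half a.
move: ha; rewrite leq_eqVlt => /orP[/eqP|] ha; case: (odd a) va => /= va.
- have -> : a = w2_pos n by apply: val_inj; rewrite [RHS]w2_pos_val -ha -[LHS]va.
  exact: PosW2.
- have -> : a = w1_pos n by apply: val_inj; rewrite [RHS]w1_pos_val -ha -[LHS]va.
  exact: PosW1.
- have -> : a = f_pos n (a./2).+1 by apply: val_inj; rewrite [RHS]f_pos_val // -[LHS]va.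
  exact: PosF.
have -> : a = e_pos n (a./2).+1 by apply: val_inj; rewrite [RHS]e_pos_val // -[LHS]va.
exact: PosE.
Qed.

Lemma odd_neq i j : (i.*2.+1 == j.*2) = false.
Proof. by apply/eqP=> /(congr1 odd); rewrite /= !odd_double. Qed.

Lemma pos_ee i j : (i < m)%N -> (j < m)%N -> (e_pos n i.+1 == e_pos n j.+1) = (i == j).
Proof. by move=> hi hj; rewrite -val_eqE /= !e_pos_val // (inj_eq double_inj). Qed.
Lemma pos_ff i j : (i < m)%N -> (j < m)%N -> (f_pos n i.+1 == f_pos n j.+1) = (i == j).
Proof. by move=> hi hj; rewrite -val_eqE /= !f_pos_val // eqSS (inj_eq double_inj). Qed.
Lemma pos_ef i j : (i < m)%N -> (j < m)%N -> (e_pos n i.+1 == f_pos n j.+1) = false.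
Proof. by move=> hi hj; rewrite -val_eqE /= e_pos_val // f_pos_val // eq_sym odd_neq. Qed.
Lemma pos_fe i j : (i < m)%N -> (j < m)%N -> (f_pos n i.+1 == e_pos n j.+1) = false.
Proof. by move=> hi hj; rewrite eq_sym pos_ef. Qed.
Lemma pos_ew i : (i < m)%N ->
  ((e_pos n i.+1 == w1_pos n = false) * (e_pos n i.+1 == w2_pos n = false) *
   (w1_pos n == e_pos n i.+1 = false) * (w2_pos n == e_pos n i.+1 = false))%type.
Proof.
move=> hi; have E1 : e_pos n i.+1 == w1_pos n = false.
  by rewrite -(inj_eq val_inj) [X in X == _]e_pos_val // [X in _ == X]w1_pos_val (inj_eq double_inj) ltn_eqF.
have E2 : e_pos n i.+1 == w2_pos n = false.
  by rewrite -(inj_eq val_inj) [X in X == _]e_pos_val // [X in _ == X]w2_pos_val eq_sym odd_neq.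
by split; [split; [split|]|]; rewrite // eq_sym.
Qed.
Lemma pos_fw i : (i < m)%N ->
  ((f_pos n i.+1 == w1_pos n = false) * (f_pos n i.+1 == w2_pos n = false) *
   (w1_pos n == f_pos n i.+1 = false) * (w2_pos n == f_pos n i.+1 = false))%type.
Proof.
move=> hi; have E1 : f_pos n i.+1 == w1_pos n = false.
  by rewrite -(inj_eq val_inj) [X in X == _]f_pos_val // [X in _ == X]w1_pos_val odd_neq.
have E2 : f_pos n i.+1 == w2_pos n = false.
  by rewrite -(inj_eq val_inj) [X in X == _]f_pos_val // [X in _ == X]w2_pos_val eqSS (inj_eq double_inj) ltn_eqF.
by split; [split; [split|]|]; rewrite // eq_sym.
Qed.
Lemma pos_ww : ((w1_pos n == w2_pos n = false) * (w2_pos n == w1_pos n = false))%type.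
Proof. by rewrite eq_sym -val_eqE /= w1_pos_val w2_pos_val odd_neq. Qed.
Definition posE := (pos_ee, pos_ff, pos_ef, pos_fe, pos_ew, pos_fw, pos_ww, eqxx).

Lemma basis_ext (g h : GL) :
  (forall i, (i < m)%N -> ev i *v g = ev i *v h) ->
  (forall i, (i < m)%N -> fv i *v g = fv i *v h) ->
  (forall x, wv x *v g = wv x *v h) -> g = h.
Proof.
move=> eg fg wg; apply/val_inj/row_matrixP=> a; rewrite !rowE.
case: (posP a) => [i|i||]; [exact: eg|exact: fg| |].
  by rewrite -/(bvec F _) -/w1 -wv1 wg.
by rewrite -/(bvec F _) -/w2 -wvpsi wg.
Qed.

Lemma bvec_delta (a b c : 'I_N) : bvec F a *m delta_mx b c = (a == b)%:R *: bvec F c.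
Proof.
rewrite /bvec; have [->|ab] := eqVneq a b; first by rewrite mul_delta_mx scale1r.
by rewrite mul_delta_mx_0 // scale0r.
Qed.

Lemma gramE : J = \sum_(i < m) (delta_mx (e_pos n i.+1) (f_pos n i.+1) + delta_mx (f_pos n i.+1) (e_pos n i.+1))
  + (- 2) *: delta_mx (w1_pos n) (w1_pos n) + (2 * om0) *: delta_mx (w2_pos n) (w2_pos n).
Proof. by rewrite /gram big_add1 big_mkord. Qed.

Lemma gram_sym : J^T = J.
Proof.
rewrite gramE !linearD /= !linearZ /= !trmx_delta; congr (_ + _ + _).
rewrite linear_sum; apply: eq_bigr => i _ /=; rewrite linearD /= !trmx_delta addrC.
by [].
Qed.

Lemma ev_gram i : (i < m)%N -> ev i *m J = fv i.
Proof.
move=> hi; rewrite gramE !mulmxDr mulmx_sumr -!scalemxAr !bvec_delta !posE // !scale0r !scaler0 !addr0.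
rewrite (bigD1 (Ordinal hi)) //= big1 ?addr0 => [|j ji].
  by rewrite mulmxDr !bvec_delta !posE // scale1r scale0r addr0.
by rewrite mulmxDr !bvec_delta !posE //= [i == j]eq_sym -(inj_eq val_inj) in ji *; rewrite (negbTE ji) !scale0r addr0.
Qed.

Lemma fv_gram i : (i < m)%N -> fv i *m J = ev i.
Proof.
move=> hi; rewrite gramE !mulmxDr mulmx_sumr -!scalemxAr !bvec_delta !posE // !scale0r !scaler0 !addr0.
rewrite (bigD1 (Ordinal hi)) //= big1 ?addr0 => [|j ji].
  by rewrite mulmxDr !bvec_delta !posE // scale1r scale0r add0r.
by rewrite mulmxDr !bvec_delta !posE //= [i == j]eq_sym -(inj_eq val_inj) in ji *; rewrite (negbTE ji) !scale0r addr0.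
Qed.

Lemma w1_gram : w1 *m J = -2 *: w1.
Proof.
rewrite gramE !mulmxDr mulmx_sumr -!scalemxAr !bvec_delta !posE // !scale0r !scaler0 !addr0 scale1r.
by rewrite big1 ?add0r // => j _; rewrite mulmxDr !bvec_delta !posE // !scale0r addr0.
Qed.
Lemma w2_gram : w2 *m J = (2 * om0) *: w2.
Proof.
rewrite gramE !mulmxDr mulmx_sumr -!scalemxAr !bvec_delta !posE // !scale0r !scaler0 !addr0 scale1r.
by rewrite big1 ?add0r // => j _; rewrite mulmxDr !bvec_delta !posE // !scale0r addr0.
Qed.

Local Notation B := (bform J).
Local Notation Q := (qform J).

Lemma bvec_dot (a b : 'I_N) : (bvec F a *m (bvec F b)^T) 0 0 = (a == b)%:R.
Proof.
rewrite /bvec trmx_delta; have [->|ab] := eqVneq a b; first by rewrite mul_delta_mx mxE !eqxx.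
by rewrite mul_delta_mx_0 // mxE.
Qed.

Lemma B_ee i j : (i < m)%N -> (j < m)%N -> B (ev i) (ev j) = 0.
Proof. by move=> hi hj; rewrite /bform ev_gram // bvec_dot posE. Qed.
Lemma B_ef i j : (i < m)%N -> (j < m)%N -> B (ev i) (fv j) = (i == j)%:R.
Proof. by move=> hi hj; rewrite /bform ev_gram // bvec_dot posE. Qed.
Lemma B_ff i j : (i < m)%N -> (j < m)%N -> B (fv i) (fv j) = 0.
Proof. by move=> hi hj; rewrite /bform fv_gram // bvec_dot posE. Qed.
Lemma B_fe i j : (i < m)%N -> (j < m)%N -> B (fv i) (ev j) = (i == j)%:R.
Proof. by move=> hi hj; rewrite /bform fv_gram // bvec_dot posE. Qed.
Lemma B_ew i x : (i < m)%N -> B (ev i) (wv x) = 0.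
Proof.
move=> hi; have E a : B (ev i) (bvec F a) = (f_pos n i.+1 == a)%:R by rewrite /bform ev_gram // bvec_dot.
by rewrite /wv !(bformE gram_sym) !E !posE // !mulr0 addr0.
Qed.
Lemma B_fw i x : (i < m)%N -> B (fv i) (wv x) = 0.
Proof.
move=> hi; have E a : B (fv i) (bvec F a) = (e_pos n i.+1 == a)%:R by rewrite /bform fv_gram // bvec_dot.
by rewrite /wv !(bformE gram_sym) !E !posE // !mulr0 addr0.
Qed.
Lemma B_we i x : (i < m)%N -> B (wv x) (ev i) = 0.
Proof. by move=> hi; rewrite (bformC gram_sym) B_ew. Qed.
Lemma B_wf i x : (i < m)%N -> B (wv x) (fv i) = 0.
Proof. by move=> hi; rewrite (bformC gram_sym) B_fw. Qed.
Definition bvecE := (B_ee, B_ef, B_ff, B_fe, B_ew, B_fw, B_we, B_wf).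

Lemma B_w x y : B (wv x) (wv y) = -2 * (re x * re y) + 2 * om0 * (im x * im y).
Proof.
have B11 : B w1 w1 = -2 by rewrite /bform w1_gram -scalemxAl mxE bvec_dot posE mulr1.
have B12 : B w1 w2 = 0 by rewrite /bform w1_gram -scalemxAl mxE bvec_dot posE mulr0.
have B22 : B w2 w2 = 2 * om0 by rewrite /bform w2_gram -scalemxAl mxE bvec_dot posE mulr1.
have B21 : B w2 w1 = 0 by rewrite (bformC gram_sym).
by rewrite /wv !(bformE gram_sym) B11 B12 B21 B22; ring.
Qed.

Lemma B_ww x y : emb (B (wv x) (wv y)) = - (x * frob y + frob x * y).
Proof.
rewrite B_w rmorphD !rmorphM rmorphN rmorph_nat -psi2 !reE !imE.
by have P := psi_neq0; have T := two_L; field; rewrite ?oppr_eq0 P T.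
Qed.
Lemma Q_w x : emb (Q (wv x)) = - (x * frob x).
Proof.
rewrite /qform rmorphM fmorphV rmorph_nat B_ww.
by have T := two_L; field.
Qed.
Lemma Q_w_eq0 x : (Q (wv x) == 0) = (x == 0).
Proof.
by rewrite -(fmorph_eq0 emb) Q_w oppr_eq0 mulf_eq0 /frob expf_eq0 q_gt0 orbb.
Qed.
Lemma Q_e i : (i < m)%N -> Q (ev i) = 0.
Proof. by move=> hi; rewrite /qform bvecE // mul0r. Qed.
Lemma Q_f i : (i < m)%N -> Q (fv i) = 0.
Proof. by move=> hi; rewrite /qform bvecE // mul0r. Qed.
Lemma hyp_ef i : (i < m)%N -> hyp J (ev i) (fv i).
Proof. by move=> hi; split; rewrite bvecE // eqxx. Qed.
Lemma hyp_fe i : (i < m)%N -> hyp J (fv i) (ev i).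
Proof. by move=> hi; split; rewrite bvecE // eqxx. Qed.


Local Hint Extern 0 (is_true (0 < _.-1)%N) => exact: m_gt0 : core.
Local Hint Extern 0 (is_true (1 < _.-1)%N) => exact: m_gt1 : core.
Local Hint Extern 0 (is_true (2 < _.-1)%N) => exact: m_ge3 : core.
Local Notation E := (eichler J).
Local Notation O := (Defs.isometries J).

Definition gens := standard_generatorsE emb (set_prime H) (set_odd H) (set_card_F H)
  (set_card_L H) n_ge3 (set_prim H).

(** * Action of the generators on the basis *)

Lemma sigma_act i : (i < m)%N ->
  (ev i *v sigma_gen F n = if i == 0%N then ev 0 + ev 1 else ev i) /\
  (fv i *v sigma_gen F n = if i == 1%N then fv 1 - fv 0 else fv i).
Proof.
case: gens => [[-> _ _] _ _ _] hi; rewrite !linear_mapE /= !posE //.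
Qed.
Lemma sigma_actw x : wv x *v sigma_gen F n = wv x.
Proof.
case: gens => [[-> _ _] _ _ _]; rewrite mulmxDl -!scalemxAl !linear_mapE /= !posE //.
Qed.

Lemma tau_act i : (i < m)%N ->
  (ev i *v tau_gen F n = if i == 0%N then ev 0 + fv 0 + w1 else ev i) /\
  (fv i *v tau_gen F n = fv i).
Proof.
case: gens => [[_ -> _] _ _ _] hi; rewrite !linear_mapE /= !posE //.
Qed.
Lemma tau_actw x : wv x *v tau_gen F n = wv x + (2 * re x) *: fv 0.
Proof.
case: gens => [[_ -> _] _ _ _]; rewrite mulmxDl -!scalemxAl !linear_mapE /= !posE //.
by rewrite scalerDr scalerA addrAC mulrC.
Qed.

Lemma delta_act i : (i < m)%N ->
  (ev i *v delta_gen emb omega n = if i == 0%N then om0^-1 *: ev 0 else ev i) /\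
  (fv i *v delta_gen emb omega n = if i == 0%N then om0 *: fv 0 else fv i).
Proof.
case: gens => [[_ _ ->] _ _ _] hi; rewrite !linear_mapE /= !posE //.
Qed.
Lemma delta_actw x : wv x *v delta_gen emb omega n = wv (omega ^+ q.-1 * x).
Proof.
case: gens => [[_ _ ->] _ _ _]; rewrite mulmxDl -!scalemxAl !linear_mapE /= !posE // /=.
have -> : omega ^+ q.-1 * x = emb (re x * Defs.coefA emb omega - im x * Defs.coefB emb omega) + emb (im x * Defs.coefA emb omega - re x * Defs.coefC emb omega) * psi.
  rewrite {1}(re_im x) !rmorphB !rmorphM.
  rewrite (coefAE emb (set_prime H) (set_card_F H) (set_card_L H) (set_prim H)).
  rewrite (coefBE emb (set_prime H) (set_odd H) (set_card_F H) (set_card_L H) (set_prim H)).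
  rewrite (coefCE emb (set_prime H) (set_odd H) (set_card_F H) (set_card_L H) (set_prim H)).
  have P := psi_neq0; have T := two_L; have W := expf_neq0 q.-1 omega_neq0.
  by field; rewrite P T W.
rewrite wv_comb !scalerDr !scalerN !scalerA -!/(Defs.bvec _ _) -/w1 -/w2.
by rewrite !mulrN !scalerBl !scaleNr addrACA [- _ + _]addrC.
Qed.

Lemma z_act i : (i < m)%N ->
  (ev i *v z_gen F n = if i == 0%N then fv 0 else ev i) /\
  (fv i *v z_gen F n = if i == 0%N then ev 0 else fv i).
Proof.
case: gens => [_ -> _ _] hi; rewrite !linear_mapE /= !posE //.
Qed.
Lemma z_actw x : wv x *v z_gen F n = wv (- frob x).
Proof.
case: gens => [_ -> _ _]; rewrite mulmxDl -!scalemxAl !linear_mapE /= !posE // /=.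
have -> : - frob x = emb (- re x) + emb (im x) * psi.
  by rewrite {1}(re_im x) frobD frobM !frob_emb frob_psi rmorphN; ring.
by rewrite wv_comb scaleNr scalerN.
Qed.

Lemma U_act i : (i < m)%N ->
  (ev i *v U_gen F n = if i == 0%N then ev 1 else if i == 1%N then - ev 0 else ev i) /\
  (fv i *v U_gen F n = if i == 0%N then fv 1 else if i == 1%N then - fv 0 else fv i).
Proof.
case: gens => [_ _ -> _] hi; rewrite /U_mx !mulmxA.
have ie a b : (a < 2)%N -> (b < 2)%N -> e_pos n a.+1 = e_pos n b.+1 -> a = b.
  by move=> ha hb /eqP; rewrite pos_ee ?(leq_trans ha m_gt1) ?(leq_trans hb m_gt1) // => /eqP.
have jf a b : (a < 2)%N -> (b < 2)%N -> f_pos n a.+1 = f_pos n b.+1 -> a = b.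
  by move=> ha hb /eqP; rewrite pos_ff ?(leq_trans ha m_gt1) ?(leq_trans hb m_gt1) // => /eqP.
have EF a : (a < m)%N -> ev a *m signed_cycle [:: f_pos n 1; f_pos n 2] (-1) = ev a.
  by move=> ha; rewrite signed_cycle_notin // !inE !posE.
have FE : fv i *m signed_cycle [:: e_pos n 1; e_pos n 2] (-1) = fv i.
  by rewrite signed_cycle_notin // !inE !posE.
rewrite FE; case: (ltnP i 2) => i2.
  have := @signed_cycle_iota F _ (e_pos n) 2 (-1) i ie i2; rewrite [map _ _]/= => ->.
  have := @signed_cycle_iota F _ (f_pos n) 2 (-1) i jf i2; rewrite [map _ _]/= => ->.
  case: i i2 {hi FE} => [|[|i]] //= _; first by rewrite EF.
  by rewrite -scalemxAl !scaleN1r EF.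
rewrite signed_cycle_notin; last by rewrite !inE !posE //; case: i i2 {hi FE} => [|[|]].
rewrite EF // signed_cycle_notin; last by rewrite !inE !posE //; case: i i2 {hi FE} => [|[|]].
by case: i i2 {hi FE} => [|[|]].
Qed.
Lemma U_actw x : wv x *v U_gen F n = wv x.
Proof.
case: gens => [_ _ -> _]; rewrite mulmxDl -!scalemxAl /U_mx !mulmxA.
by rewrite !signed_cycle_notin // !inE !posE.
Qed.

Lemma V_act i : (i < m)%N ->
  (ev i *v V_gen F n = if i.+1 == m then (-1) ^+ n *: ev 0 else ev i.+1) /\
  (fv i *v V_gen F n = if i.+1 == m then (-1) ^+ n *: fv 0 else fv i.+1).
Proof.
case: gens => [_ _ _ ->] hi; rewrite /V_mx !mulmxA.
have ie a b : (a < m)%N -> (b < m)%N -> e_pos n a.+1 = e_pos n b.+1 -> a = b.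
  by move=> ha hb /eqP; rewrite pos_ee // => /eqP.
have jf a b : (a < m)%N -> (b < m)%N -> f_pos n a.+1 = f_pos n b.+1 -> a = b.
  by move=> ha hb /eqP; rewrite pos_ff // => /eqP.
have ne (g : nat -> 'I_N) x eps : (forall j, (j < m)%N -> x != g j.+1) ->
    bvec F x *m signed_cycle [seq g i | i <- iota 1 m] eps = bvec F x.
  move=> xg; case E : m m_gt0 => [|k] // _; rewrite [iota _ _]/= map_cons signed_cycle_notin //.
  rewrite -map_cons; apply/mapP=> -[[|j]]; rewrite (mem_iota 1 k.+1) -E // => /andP[_ hj] xj.
  by case/negP: (xg j hj); rewrite xj.
rewrite (ne (e_pos n) (f_pos n i.+1)); last by move=> j hj; rewrite posE.
rewrite !(@signed_cycle_iota F _ _ m) //; split=> //.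
by case: eqP => [_|ni]; rewrite -?scalemxAl (ne (f_pos n)) // => j hj; rewrite posE // ltn_neqAle hi andbT; apply/eqP.
Qed.
Lemma V_actw x : wv x *v V_gen F n = wv x.
Proof.
case: gens => [_ _ _ ->]; rewrite mulmxDl -!scalemxAl /V_mx !mulmxA.
have ne (g : nat -> 'I_N) y eps : (forall j, (j < m)%N -> y != g j.+1) ->
    bvec F y *m signed_cycle [seq g i | i <- iota 1 m] eps = bvec F y.
  move=> xg; case E : m m_gt0 => [|k] // _; rewrite [iota _ _]/= map_cons signed_cycle_notin //.
  rewrite -map_cons; apply/mapP=> -[[|j]]; rewrite (mem_iota 1 k.+1) -E // => /andP[_ hj] xj.
  by case/negP: (xg j hj); rewrite xj.
by rewrite !ne // => j hj; rewrite posE.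
Qed.

Local Notation s := (sigma_gen F n).
Local Notation t := (tau_gen F n).
Local Notation dl := (delta_gen emb omega n).
Local Notation z := (z_gen F n).
Local Notation U := (U_gen F n).
Local Notation V := (V_gen F n).
Local Notation bE := bvecE.
Local Notation bfE := (bformE gram_sym).
Local Notation sJ := gram_sym.
Local Notation tF := two_F.
Local Notation mgt0 := m_gt0.
Local Notation mgt1 := m_gt1.
Local Notation mgt2 := m_ge3.

(** * The generators as products of Eichler transformations *)

Lemma eich_fe i j : (i < m)%N -> (j < m)%N -> i != j -> eich J (fv i) (ev j).
Proof. by move=> hi hj ij; split; rewrite bE // (negbTE ij). Qed.
Lemma eich_ef i j : (i < m)%N -> (j < m)%N -> i != j -> eich J (ev i) (fv j).
Proof. by move=> hi hj ij; split; rewrite bE // (negbTE ij). Qed.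
Lemma eich_ff i j : (i < m)%N -> (j < m)%N -> eich J (fv i) (fv j).
Proof. by move=> hi hj; split; rewrite bE. Qed.
Lemma eich_fw i x : (i < m)%N -> eich J (fv i) (wv x).
Proof. by move=> hi; split; rewrite bE. Qed.
Lemma eich_ew i x : (i < m)%N -> eich J (ev i) (wv x).
Proof. by move=> hi; split; rewrite bE. Qed.

Lemma s_eichler : s = E (fv 0) (ev 1).
Proof.
have u := eich_fe m_gt0 m_gt1 isT.
apply: basis_ext => [i hi|i hi|x]; rewrite (eichlerE sJ tF u) !bE // ?Q_e // ?sigma_actw.
- have [-> _] := sigma_act hi; case: i hi => [|i] hi /=; rewrite ?scale0r ?mul0r ?scale0r ?subr0 ?addr0 //.
  by rewrite scale1r.
- have [_ ->] := sigma_act hi; case: i hi => [|[|i]] hi /=; rewrite ?scale0r ?mul0r ?scale0r ?subr0 ?addr0 //.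
  by rewrite scale1r.
by rewrite mul0r !scale0r !subr0 addr0.
Qed.

Lemma Q_w1 : Q (wv 1) = -1.
Proof. by apply: (fmorph_inj emb); rewrite Q_w /frob expr1n mulr1 rmorphN rmorph1. Qed.

Lemma t_eichler : t = E (fv 0) (wv 1).
Proof.
have u := eich_fw 1 m_gt0.
apply: basis_ext => [i hi|i hi|x]; rewrite (eichlerE sJ tF u) ?bE // ?Q_w1 ?tau_actw.
- have [-> _] := tau_act hi; case: i hi => [|i] hi /=; rewrite ?scale0r ?mul0r ?mulr0 ?scale0r ?subr0 ?addr0 //.
  by rewrite scale1r mulN1r scaleN1r opprK wv1 addrAC.
- have [_ ->] := tau_act hi.
  by rewrite ?scale0r ?mul0r ?mulr0 ?scale0r ?subr0 ?addr0.
rewrite mulr0 !scale0r addr0 subr0 -scaleNr; congr (_ + _ *: _).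
by apply: (fmorph_inj emb); rewrite rmorphN B_ww opprK (expr1n _ _ : frob (1 : L) = 1) !mulr1 rmorphM rmorph_nat reE; have T := two_L; field.
Qed.

(** The matrix of U^(V^i), by UmVX below. *)
Definition Um i : GL := locked_with Um_key (weyl J (ev i) (fv i) (fv i.+1) (ev i.+1)).
Lemma UmE i : Um i = weyl J (ev i) (fv i) (fv i.+1) (ev i.+1).
Proof. exact: unlock. Qed.

Lemma Um_isom i : (i.+1 < m)%N -> Um i \in O.
Proof.
move=> hi; have hi' := ltnW hi; rewrite UmE; apply: (weyl_isom sJ tF).
  by apply: eich_ef; rewrite ?ltn_eqF.
by apply: eich_fe; rewrite ?ltn_eqF.
Qed.

Lemma Um_act i j : (i.+1 < m)%N -> (j < m)%N ->
  (ev j *v Um i = if j == i then ev i.+1 else if j == i.+1 then - ev i else ev j) /\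
  (fv j *v Um i = if j == i then fv i.+1 else if j == i.+1 then - fv i else fv j).
Proof.
move=> hi hj; have hi' := ltnW hi; have ne : i == i.+1 = false by rewrite ltn_eqF.
have ne' : i.+1 == i = false by rewrite eq_sym.
have A1 := weyl_se sJ tF (hyp_ef hi'); have A2 := weyl_sf sJ tF (hyp_ef hi').
have A3 := weyl_sv sJ tF (hyp_ef hi'); have A4 := weyl_sx sJ tF (hyp_ef hi').
have hvx := hyp_fe hi.
rewrite UmE; split; case: eqP => [->|ji].
- by rewrite A1 // !bE // ?ne.
- case: eqP => [->|ji']; first by rewrite A4 // !bE // ?ne.
  by rewrite (weyl_sr sJ tF (hyp_ef hi')) ?bE // ?ne //; case: eqP.
- by rewrite A2 // !bE // ?ne.
case: eqP => [->|ji']; first by rewrite A3 // !bE // ?ne.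
by rewrite (weyl_sr sJ tF (hyp_ef hi')) ?bE // ?ne //; case: eqP.
Qed.
Lemma Um_actw i x : (i.+1 < m)%N -> wv x *v Um i = wv x.
Proof.
move=> hi; have hi' := ltnW hi; have ne : i == i.+1 = false by rewrite ltn_eqF.
by rewrite UmE (weyl_sr sJ tF (hyp_ef hi')) ?bE // ?ne.
Qed.

Lemma Um0 : U = Um 0.
Proof.
apply: basis_ext => [i hi|i hi|x]; last by rewrite U_actw Um_actw.
  by have [-> _] := U_act hi; have [-> _] := Um_act m_gt1 hi.
by have [_ ->] := U_act hi; have [_ ->] := Um_act m_gt1 hi.
Qed.

(** Um (k-1) * ... * Um 0, the signed cycle on the planes 0 to k; the last one
    is V. *)
Fixpoint Pm k : GL := if k is k'.+1 then (Um k' * Pm k')%g else 1%g.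

Lemma PmS k : Pm k.+1 = (Um k * Pm k)%g. Proof. by []. Qed.

Lemma Pm_act k j : (k < m)%N -> (j < m)%N ->
  (ev j *v Pm k = if (j < k)%N then ev j.+1 else if j == k then (-1) ^+ k *: ev 0 else ev j) /\
  (fv j *v Pm k = if (j < k)%N then fv j.+1 else if j == k then (-1) ^+ k *: fv 0 else fv j).
Proof.
elim: k j => [|k IH] j hk hj; first by rewrite !act1 !scale1r; case: eqP => [->|].
have hk' := ltnW hk; have [A A'] := Um_act hk hj.
have [Bk Bk'] := IH k hk' hk'; have [B1 B1'] := IH _ hk' hk; have [Bj Bj'] := IH _ hk' hj.
rewrite PmS 2!actM A A'; case: (ltngtP j k) => jk.
- by rewrite ltnS (ltnW jk) ltn_eqF 1?ltnW // Bj Bj' jk.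
- rewrite ltnS leqNgt jk /=; case: eqP => jk1; last first.
    by rewrite Bj Bj' ltnNge ltnW // (gtn_eqF jk).
  by rewrite !actN Bk Bk' ltnn eqxx exprS mulN1r !scaleNr.
by rewrite jk B1 B1' ltnSn ltnNge leqnSn /= gtn_eqF.
Qed.
Lemma Pm_actw k x : (k < m)%N -> wv x *v Pm k = wv x.
Proof.
elim: k => [|k IH] hk; first by rewrite act1.
by rewrite PmS actM Um_actw // IH // ltnW.
Qed.

Lemma V_prod : V = Pm m.-1.
Proof.
have hm : (m.-1 < m)%N by rewrite prednK.
have sgn : (-1) ^+ n = (-1) ^+ m.-1 :> F.
  by rewrite {1}n_pred -{1}(prednK m_gt0) !exprS mulrA mulrNN mul1r mul1r.
have ltm i : (i < m)%N -> (i < m.-1)%N = (i.+1 != m).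
  by move=> hi; rewrite -ltnS prednK // ltn_neqAle hi andbT.
apply: basis_ext => [i hi|i hi|x]; last by rewrite V_actw Pm_actw.
  have [-> _] := V_act hi; have [-> _] := Pm_act hm hi.
  by rewrite ltm // sgn -{4}(prednK m_gt0); case: eqP => //= [<-]; rewrite eqxx.
have [_ ->] := V_act hi; have [_ ->] := Pm_act hm hi.
by rewrite ltm // sgn -{4}(prednK m_gt0); case: eqP => //= [<-]; rewrite eqxx.
Qed.

Lemma Pm_isom k : (k < m)%N -> Pm k \in O.
Proof.
elim: k => [|k IH] hk; first exact: isom1.
by rewrite isomM ?Um_isom ?IH // ltnW.
Qed.
Lemma V_isom : V \in O. Proof. by rewrite V_prod Pm_isom // prednK. Qed.
Lemma U_isom : U \in O. Proof. by rewrite Um0 Um_isom. Qed.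
Lemma s_isom : s \in O.
Proof. by rewrite s_eichler (eichler_isom sJ tF) //; apply: eich_fe. Qed.
Lemma t_isom : t \in O.
Proof. by rewrite t_eichler (eichler_isom sJ tF) //; apply: eich_fw. Qed.

Lemma weylJm i g : (i.+1 < m)%N -> g \in O ->
  (Um i ^ g)%g = weyl J (ev i *v g) (fv i *v g) (fv i.+1 *v g) (ev i.+1 *v g).
Proof.
move=> hi Og; have hi' := ltnW hi; rewrite UmE; apply: (weylJ sJ tF) => //.
  by apply: eich_ef; rewrite ?ltn_eqF.
by apply: eich_fe; rewrite ?ltn_eqF.
Qed.

Lemma V_step i : (i.+1 < m)%N -> (ev i *v V = ev i.+1) * (fv i *v V = fv i.+1).
Proof.
move=> hi; have [-> ->] := V_act (ltnW hi); by rewrite ltn_eqF.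
Qed.

Lemma UmV i : (i.+2 < m)%N -> (Um i ^ V)%g = Um i.+1.
Proof. by move=> hi; have hi' := ltnW hi; rewrite weylJm ?V_isom // !V_step // UmE. Qed.

Lemma UmVX i : (i.+1 < m)%N -> (U ^ (V ^+ i))%g = Um i.
Proof.
elim: i => [|i IH] hi; first by rewrite expg0 conjg1 Um0.
by rewrite expgSr conjgM IH ?UmV // ltnW.
Qed.

(** * Relations between the signed permutation matrices *)

Lemma weyl_inv e f v x : eich J f x -> eich J e v ->
  ((weyl J e f v x)^-1 = weyl J e f (- v) (- x))%g.
Proof. by move=> fx ex; rewrite /weyl !invgM !(eichlerN sJ tF) // mulgA. Qed.
Lemma weyl_opp e f v x : eich J f x -> eich J e v ->
  weyl J (- e) (- f) v x = weyl J e f (- v) (- x).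
Proof. by move=> fx ex; rewrite /weyl -!(scaleN1r e) -!(scaleN1r f) !(eichlerZ sJ tF) // !scaleN1r. Qed.

Lemma Um_far j : (1 < j)%N -> (j.+1 < m)%N -> (Um j ^ Um 0 = Um j)%g.
Proof.
move=> j1 hj; have hj' := ltnW hj; rewrite weylJm ?Um_isom //.
have [-> ->] := Um_act mgt1 hj'; have [-> ->] := Um_act mgt1 hj.
have j0 : j == 0%N = false by rewrite gtn_eqF // ltnW.
by rewrite (gtn_eqF j1) j0 /= eqSS j0 UmE.
Qed.

Lemma Um_braid : (Um 0 ^ (Um 1 * Um 0) = Um 1)%g.
Proof.
rewrite weylJm ?isomM ?Um_isom // !actM.
have [-> ->] := Um_act mgt2 mgt0; have [-> ->] := Um_act mgt2 mgt1.
rewrite /=; have [-> ->] := Um_act mgt1 mgt0; have [-> ->] := Um_act mgt1 mgt2.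
by rewrite UmE.
Qed.

Lemma Um_sign1 : (Um 1 ^ (Um 0 ^+ 2) = (Um 1)^-1)%g.
Proof.
rewrite expg2 weylJm ?isomM ?Um_isom // !actM.
have [-> ->] := Um_act mgt1 mgt1; have [-> ->] := Um_act mgt1 mgt2.
rewrite /= !actN; have [-> ->] := Um_act mgt1 mgt0; have [-> ->] := Um_act mgt1 mgt2.
rewrite UmE weyl_opp ?weyl_inv //; [exact: eich_fe|exact: eich_ef|exact: eich_fe|exact: eich_ef].
Qed.

Lemma Um_sign0 : (Um 0 ^ (Um 1 ^+ 2) = (Um 0)^-1)%g.
Proof.
rewrite expg2 weylJm ?isomM ?Um_isom // !actM.
have [-> ->] := Um_act mgt2 mgt0; have [-> ->] := Um_act mgt2 mgt1.
rewrite /=; have [-> ->] := Um_act mgt2 mgt0; have [-> ->] := Um_act mgt2 mgt2.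
rewrite UmE weyl_inv //; [exact: eich_fe|exact: eich_ef].
Qed.

Lemma VX_act k : (k < m)%N -> (ev 0 *v (V ^+ k)%g = ev k) * (fv 0 *v (V ^+ k)%g = fv k).
Proof.
elim: k => [|k IH] hk; first by rewrite expg0 !act1.
by rewrite expgSr !actM !IH 1?ltnW // !(V_step hk).
Qed.

(** V^m is a sign, the same on all planes, and commutes with U. *)
Lemma U_Vperiod : (U ^ (V ^+ m) = U)%g.
Proof.
have last : (m.-1 < m)%N by rewrite prednK.
have c0 : (ev 0 *v (V ^+ m)%g = (-1) ^+ n *: ev 0) * (fv 0 *v (V ^+ m)%g = (-1) ^+ n *: fv 0).
  have -> : (V ^+ m = V ^+ m.-1 * V)%g by rewrite -expgSr prednK.
  rewrite !actM !VX_act //; have [-> ->] := V_act last.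
  by have -> : (m.-1.+1 == m)%N by apply/eqP; exact: prednK.
have c1 : (ev 1 *v (V ^+ m)%g = (-1) ^+ n *: ev 1) * (fv 1 *v (V ^+ m)%g = (-1) ^+ n *: fv 1).
  have [E1 F1] := V_step mgt1.
  by split; rewrite -?E1 -?F1 -actM -expgS expgSr actM c0 actZ ?E1 ?F1.
have e1 := eich_fe mgt0 mgt1 isT; have e2 := eich_ef mgt0 mgt1 isT.
rewrite Um0 weylJm ?isomX ?V_isom // UmE !c0 !c1 /weyl.
rewrite !(eichlerZ sJ tF _ (eichZ sJ _ e1)) !(eichlerZ sJ tF _ (eichZ sJ _ e2)) !scalerA -exprMn.
by rewrite mulrNN mulr1 expr1n !scale1r.
Qed.

Local Notation r := (omega ^+ q.-1).

(** * Identities in the first two planes *)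

(** The copies of z and delta on the plane 1. *)
Definition zU : GL := locked_with z1_key (z ^ U)%g.
Definition dU : GL := locked_with z1_key (dl ^ U)%g.
Lemma z1E : zU = (z ^ U)%g. Proof. exact: unlock. Qed.
Lemma d1E : dU = (dl ^ U)%g. Proof. exact: unlock. Qed.

Lemma frob_r : frob r = r^-1.
Proof. by have := frob_omega_pow 1; rewrite muln1. Qed.
Lemma r_neq0 : r != 0. Proof. by rewrite expf_neq0 ?omega_neq0. Qed.
Lemma frob_rX i : frob (r ^+ i) = r ^- i.
Proof. by rewrite /frob exprAC [r ^+ q]frob_r exprVn. Qed.

(** In the planes 0 and 1 an equality of matrices is checked on e_0, f_0, e_1,
    f_1, on the other planes, where both sides are trivial, and on W. *)
Lemma ext01 (g h : GL) :
  [/\ ev 0 *v g = ev 0 *v h, fv 0 *v g = fv 0 *v h, ev 1 *v g = ev 1 *v h & fv 1 *v g = fv 1 *v h] ->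
  (forall j, (j.+2 < m)%N -> ev j.+2 *v g = ev j.+2 *v h /\ fv j.+2 *v g = fv j.+2 *v h) ->
  (forall x, wv x *v g = wv x *v h) -> g = h.
Proof.
move=> [e0 f0 e1 f1] far w; apply: basis_ext => // -[|[|j]] // hj; first by case: (far j hj).
by case: (far j hj).
Qed.

Lemma zA : (ev 0 *v z = fv 0) * (fv 0 *v z = ev 0) * (ev 1 *v z = ev 1) * (fv 1 *v z = fv 1).
Proof. by have [-> ->] := z_act mgt0; have [-> ->] := z_act mgt1. Qed.
Lemma zF j : (j.+1 < m)%N -> (ev j.+1 *v z = ev j.+1) * (fv j.+1 *v z = fv j.+1).
Proof. by move=> hj; have [-> ->] := z_act hj. Qed.
Lemma UA : (ev 0 *v U = ev 1) * (fv 0 *v U = fv 1) * (ev 1 *v U = - ev 0) * (fv 1 *v U = - fv 0).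
Proof. by have [-> ->] := U_act mgt0; have [-> ->] := U_act mgt1. Qed.
Lemma UF j : (j.+2 < m)%N -> (ev j.+2 *v U = ev j.+2) * (fv j.+2 *v U = fv j.+2).
Proof. by move=> hj; have [-> ->] := U_act hj. Qed.
Lemma UVA : (ev 1 *v U^-1%g = ev 0) * (fv 1 *v U^-1%g = fv 0) * (ev 0 *v U^-1%g = - ev 1) * (fv 0 *v U^-1%g = - fv 1).
Proof. by repeat split; apply: act_inv; rewrite ?actN !UA ?opprK. Qed.
Lemma UVF j : (j.+2 < m)%N -> (ev j.+2 *v U^-1%g = ev j.+2) * (fv j.+2 *v U^-1%g = fv j.+2).
Proof. by move=> hj; split; apply: act_inv; rewrite !UF. Qed.
Lemma UVw x : wv x *v U^-1%g = wv x.
Proof. by apply: act_inv; rewrite U_actw. Qed.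
Lemma dA i : (ev 0 *v (dl ^+ i)%g = om0 ^- i *: ev 0) * (fv 0 *v (dl ^+ i)%g = om0 ^+ i *: fv 0) *
  (ev 1 *v (dl ^+ i)%g = ev 1) * (fv 1 *v (dl ^+ i)%g = fv 1).
Proof.
elim: i => [|i IH]; first by rewrite expg0 !act1 expr0 invr1 !scale1r.
have [D1 D2] := delta_act mgt0; have [D3 D4] := delta_act mgt1.
rewrite expgSr !actM !IH !actZ D1 D2 D3 D4 /= !scalerA exprSr invfM.
by [].
Qed.
Lemma dF i j : (j.+1 < m)%N -> (ev j.+1 *v (dl ^+ i)%g = ev j.+1) * (fv j.+1 *v (dl ^+ i)%g = fv j.+1).
Proof.
move=> hj; elim: i => [|i IH]; first by rewrite expg0 !act1.
have [D1 D2] := delta_act hj.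
by rewrite expgSr !actM !IH D1 D2.
Qed.
Lemma dw i x : wv x *v (dl ^+ i)%g = wv (r ^+ i * x).
Proof.
elim: i => [|i IH]; first by rewrite expg0 act1 mul1r.
by rewrite expgSr actM IH delta_actw exprS mulrA.
Qed.
Lemma dVA i : (ev 0 *v (dl ^- i)%g = om0 ^+ i *: ev 0) * (fv 0 *v (dl ^- i)%g = om0 ^- i *: fv 0) *
  (ev 1 *v (dl ^- i)%g = ev 1) * (fv 1 *v (dl ^- i)%g = fv 1).
Proof.
have o0 := expf_neq0 i om0_neq0.
by repeat split; apply: act_inv; rewrite ?actZ !dA ?scalerA ?mulfV ?mulVf ?scale1r.
Qed.
Lemma dVF i j : (j.+1 < m)%N -> (ev j.+1 *v (dl ^- i)%g = ev j.+1) * (fv j.+1 *v (dl ^- i)%g = fv j.+1).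
Proof. by move=> hj; split; apply: act_inv; rewrite dF. Qed.
Lemma dVw i x : wv x *v (dl ^- i)%g = wv (r ^- i * x).
Proof. by apply: act_inv; rewrite dw mulrA mulfV ?mul1r // expf_neq0 ?r_neq0. Qed.

Lemma z1A : (ev 0 *v zU = ev 0) * (fv 0 *v zU = fv 0) * (ev 1 *v zU = fv 1) * (fv 1 *v zU = ev 1).
Proof. by rewrite z1E conjgE !actM !UVA !actN !zA !UA !opprK. Qed.
Lemma z1F j : (j.+2 < m)%N -> (ev j.+2 *v zU = ev j.+2) * (fv j.+2 *v zU = fv j.+2).
Proof. by move=> hj; rewrite z1E conjgE !actM !(UVF, zF, UF). Qed.
Lemma z1w x : wv x *v zU = wv (- frob x).
Proof. by rewrite z1E conjgE !actM UVw z_actw U_actw. Qed.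
Lemma d1A i : (ev 0 *v (dU ^+ i)%g = ev 0) * (fv 0 *v (dU ^+ i)%g = fv 0) *
  (ev 1 *v (dU ^+ i)%g = om0 ^- i *: ev 1) * (fv 1 *v (dU ^+ i)%g = om0 ^+ i *: fv 1).
Proof. by rewrite d1E -conjXg conjgE !actM !UVA !actN !dA !actZ !UA !opprK. Qed.
Lemma d1F i j : (j.+2 < m)%N -> (ev j.+2 *v (dU ^+ i)%g = ev j.+2) * (fv j.+2 *v (dU ^+ i)%g = fv j.+2).
Proof. by move=> hj; rewrite d1E -conjXg conjgE !actM !(UVF, dF, UF). Qed.
Lemma d1w i x : wv x *v (dU ^+ i)%g = wv (r ^+ i * x).
Proof. by rewrite d1E -conjXg conjgE !actM UVw dw U_actw. Qed.

Definition actA := (actZ, actN, zA, UA, UVA, dA, dVA, z1A, d1A).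
Definition actF := (zF, UF, UVF, dF, dVF, z1F, d1F).
Definition actW := (U_actw, UVw, z_actw, dw, dVw, z1w, d1w).

Lemma om0_q1 : om0 ^+ q.-1 = 1.
Proof. by apply: (mulfI om0_neq0); rewrite -exprS prednK ?q_gt0 // expf_card mulr1. Qed.

Lemma z_sqr : (z * z = 1)%g.
Proof.
apply: ext01 => [|j hj|x]; rewrite !actM !act1; [by rewrite !actA | by rewrite !actF | rewrite !actW].
by rewrite frobN frobK opprK.
Qed.

Lemma d_conj_z : (dl ^ z = dl^-1)%g.
Proof.
have -> : (dl^-1 = dl ^- 1)%g by rewrite expg1.
have zV : (z^-1 = z)%g by apply: mulg1_eq z_sqr.
rewrite -{1}[dl]expg1 conjgE zV.
apply: ext01 => [|j hj|x]; rewrite !actM; [by rewrite !actA | by rewrite !actF | rewrite !actW].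
rewrite frobM frobN frobK frob_rX; congr (wv _); ring.
Qed.

Lemma z_conj_z1 : (z ^ zU = z)%g.
Proof.
apply: (canLR (mulKg zU)).
apply: ext01 => [|j hj|x]; rewrite !actM; [by rewrite !actA | by rewrite !actF | by rewrite !actW].
Qed.

Lemma frob_X i : r ^+ (q * i) = r ^- i.
Proof. by rewrite exprM [r ^+ q]frob_r exprVn. Qed.

Lemma d_conj_z1 : (dl ^ zU = dl ^+ q)%g.
Proof.
apply: (canLR (mulKg zU)); rewrite -{1}[dl]expg1.
have o : om0 ^+ q = om0 by exact: expf_card.
apply: ext01 => [|j hj|x]; rewrite !actM; [by rewrite !actA o | by rewrite !actF | rewrite !actW].
by rewrite frobM frob_rX [r ^+ q]frob_r expr1 mulrN.
Qed.

Lemma d_conj_d1 : (dl ^ dU = dl)%g.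
Proof.
apply: (canLR (mulKg dU)); rewrite -{1 2}[dl]expg1 -[dU]expg1.
apply: ext01 => [|j hj|x]; rewrite !actM; [by rewrite !actA | by rewrite !actF | rewrite !actW].
by rewrite mulrCA.
Qed.

Lemma z_conj_d1 : (z ^ dU = z * dl ^+ (q * q.-1))%g.
Proof.
apply: (canLR (mulKg dU)); rewrite -[dU]expg1.
have o : om0 ^+ (q * q.-1) = 1 by rewrite mulnC exprM om0_q1 expr1n.
have rr : r ^+ (q * q.-1) = r * r.
  have R := r_neq0; rewrite frob_X -[RHS]invrK; congr (_^-1); apply: (mulIf R).
  by rewrite -exprSr prednK ?q_gt0 // [r ^+ q]frob_r; field.
apply: ext01 => [|j hj|x]; rewrite !actM; [by rewrite !actA o invr1 !scale1r | by rewrite !actF | rewrite !actW].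
rewrite rr expr1 frobM frob_r; congr (wv _).
by have R := r_neq0; field.
Qed.

Lemma U2_torus k : om0 ^+ k = -1 -> (U ^+ 2 = dU ^+ k * dl ^- k)%g.
Proof.
move=> ok; rewrite expg2; apply: ext01 => [|j hj|x]; rewrite !actM; [by rewrite !actA ok invrN invr1 !scaleN1r | by rewrite !actF | rewrite !actW].
by rewrite mulrA mulVf ?mul1r // expf_neq0 ?r_neq0.
Qed.

Lemma torus_eq k : om0 ^+ k = 1 -> (dU ^+ k = dl ^+ k)%g.
Proof.
by move=> ok; apply: ext01 => [|j hj|x]; [by rewrite !actA ok invr1 !scale1r | by rewrite !actF | rewrite !actW].
Qed.

(** z exchanges e_0 and f_0 and reflects W in w_1. *)
Lemma z_weyl : z = weyl J (ev 0) (fv 0) (wv 1) (- wv 1).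
Proof.
have Q1 := Q_w1; have Q0 : Q (wv 1) != 0 by rewrite Q1 oppr_eq0 oner_eq0.
have xv : - wv 1 = (Q (wv 1))^-1 *: wv 1 by rewrite Q1 invrN invr1 scaleN1r.
have h := hyp_ef mgt0.
have ew := B_ew 1 mgt0; have fw := B_fw 1 mgt0.
have far r0 : B (ev 0) r0 = 0 -> B (fv 0) r0 = 0 -> B r0 (wv 1) = 0 -> r0 *v weyl J (ev 0) (fv 0) (wv 1) (- wv 1) = r0.
  by move=> b1 b2 b3; rewrite (weyl_r sJ tF h ew fw Q0 xv) // b3 mul0r scale0r subr0.
apply: ext01 => [|j hj|x].
- rewrite (weyl_e sJ tF h ew fw Q0 xv) (weyl_f sJ tF h ew fw Q0 xv) !zA Q1 invrN invr1 opprK !scale1r.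
  by rewrite !far ?bE.
- by rewrite !far ?bE // !zF.
rewrite (weyl_r sJ tF h ew fw Q0 xv) ?bE // z_actw Q1 invrN invr1 mulrN1 scaleNr opprK.
rewrite -wvZ -wvD mulr1; congr (wv _).
by rewrite B_ww (expr1n _ _ : frob (1 : L) = 1) !mulr1 opprD addrA subrr add0r.
Qed.

Lemma z_isom : z \in O.
Proof.
rewrite z_weyl; exact: (weyl_isom sJ tF (eich_ew _ mgt0) (eichN sJ (eich_fw _ mgt0))).
Qed.

(** Composing z with delta moves the reflection vector in W, here to the vector
    of omega^-1, whose norm is omega0^-1. *)
Lemma zd_weyl : (z * dl)%g = weyl J (ev 0) (fv 0) (wv omega^-1) ((Q (wv omega^-1))^-1 *: wv omega^-1).
Proof.
set v := wv _; have w0 := omega_neq0; have wi0 : omega^-1 != 0 by rewrite invr_eq0.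
have Q0 : Q v != 0 by rewrite Q_w_eq0.
have Qv : - Q v = om0^-1.
  by apply: (fmorph_inj emb); rewrite rmorphN Q_w opprK fmorphV omega0_val /frob -exprS exprVn.
have h := hyp_ef mgt0; have ew := B_ew omega^-1 mgt0; have fw := B_fw omega^-1 mgt0.
have wE := (weyl_e sJ tF h ew fw Q0 erefl, weyl_f sJ tF h ew fw Q0 erefl).
have far r0 : B (ev 0) r0 = 0 -> B (fv 0) r0 = 0 -> B r0 v = 0 -> r0 *v weyl J (ev 0) (fv 0) v ((Q v)^-1 *: v) = r0.
  by move=> b1 b2 b3; rewrite (weyl_r sJ tF h ew fw Q0) // b3 mul0r scale0r subr0.
have wR := weyl_r sJ tF h ew fw Q0 erefl.
rewrite -[dl]expg1; move: (weyl _ _ _ _ _) wE wR far => wy wE wR far.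
apply: ext01 => [|j hj|x]; rewrite !actM.
- rewrite !wE !far ?bE // !actA !expr1 Qv; split=> //.
  by rewrite -invrN Qv invrK.
- by rewrite !far ?bE // !actF.
rewrite wR ?bE // !actW expr1.
rewrite -scaleNr -wvZ -wvD; congr (wv _).
rewrite rmorphN fmorph_div B_ww Q_w frobV.
have -> : frob omega = omega * r by rewrite -exprS prednK ?q_gt0.
by have R := r_neq0; field; rewrite oppr_eq0 oner_eq0 w0 R.
Qed.

Lemma d_isom : dl \in O.
Proof.
have -> : dl = (z^-1 * (z * dl))%g by rewrite mulKg.
rewrite isomM ?isomV ?z_isom // zd_weyl; exact: (weyl_isom sJ tF (eich_ew _ mgt0) (eichZ sJ _ (eich_fw _ mgt0))).
Qed.
Lemma z1_isom : zU \in O. Proof. by rewrite z1E isomJ ?z_isom ?U_isom. Qed.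
Lemma d1_isom : dU \in O. Proof. by rewrite d1E isomJ ?d_isom ?U_isom. Qed.

Lemma weyl_U_z : weyl J (ev 1) (fv 1) (- ev 0) (- fv 0) = (z * U * z)%g.
Proof.
have h := hyp_ef mgt1.
have hv : hyp J (- ev 0) (- fv 0) by split; rewrite !bfE ?bE //= ?oppr0 // opprK.
have b1 : B (ev 1) (- ev 0) = 0 by rewrite !bfE bE // oppr0.
have b2 : B (fv 1) (- ev 0) = 0 by rewrite !bfE bE // oppr0.
have b3 : B (ev 1) (- fv 0) = 0 by rewrite !bfE bE // oppr0.
have b4 : B (fv 1) (- fv 0) = 0 by rewrite !bfE bE // oppr0.
have wE := (weyl_sf sJ tF h b1 b2 b3 b4 hv, weyl_se sJ tF h b1 b2 b3 b4 hv).
have wv' := weyl_sv sJ tF h b1 b2 b3 b4 hv; have wx' := weyl_sx sJ tF h b1 b2 b3 b4 hv.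
have far r0 : B r0 (ev 1) = 0 -> B r0 (fv 1) = 0 -> B r0 (ev 0) = 0 -> B r0 (fv 0) = 0 ->
    r0 *v weyl J (ev 1) (fv 1) (- ev 0) (- fv 0) = r0.
  by move=> a1 a2 a3 a4; apply: (weyl_sr sJ tF h) => //; rewrite !bfE ?a3 ?a4 oppr0.
move: (weyl _ _ _ _ _) wE wv' wx' far => wy wE wv' wx' far.
apply: ext01 => [|j hj|x]; rewrite !actM.
- rewrite !wE !actA; split=> //; apply: oppr_inj; rewrite -actN ?wv' ?wx' //.
- by rewrite !far ?bE // !actF.
by rewrite far ?bE // !actW frobN frobK opprK.
Qed.

(** The rank one identity for a non-singular v in the plane 0, of norm c: the
    element exchanging e_1 and f_1 with reflection in v is a product of z_1, z
    and elements of the torus. *)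
Lemma weyl_torus c k : c != 0 -> - c = om0 ^- k ->
  weyl J (ev 1) (fv 1) (ev 0 + c *: fv 0) (c^-1 *: (ev 0 + c *: fv 0)) =
  (zU * dU ^+ k * z * dl ^- (q * k))%g.
Proof.
move=> c0 ck; set v := _ + _.
have Qv : Q v = c.
  by rewrite /v (qformD sJ tF) Q_e // (qformZ sJ tF) Q_f // !bfE bE // eqxx mulr0 !add0r mulr1.
have Q0 : Q v != 0 by rewrite Qv.
have xv : c^-1 *: v = (Q v)^-1 *: v by rewrite Qv.
have h := hyp_ef mgt1.
have b1 : B (ev 1) v = 0 by rewrite !bfE !bE // mulr0 addr0.
have b2 : B (fv 1) v = 0 by rewrite !bfE !bE // mulr0 addr0.
have wE := (weyl_e sJ tF h b1 b2 Q0 xv, weyl_f sJ tF h b1 b2 Q0 xv).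
have wR := weyl_r sJ tF h b1 b2 Q0 xv.
have oq : om0 ^+ (q * k) = om0 ^+ k by rewrite exprM [om0 ^+ q]expf_card.
have ck' : - c^-1 = om0 ^+ k by rewrite -invrN ck invrK.
move: (weyl _ _ _ _ _) wE wR => wy wE wR.
apply: ext01 => [|j hj|x]; rewrite !actM.
- rewrite !wE !wR ?bE // !bfE !bE // !eqxx !actA Qv oq -ck -ck' !mulr1 !mulr0 addr0 add0r; split=> //.
    by rewrite /v; apply/rowP=> i; rewrite !mxE; field.
  by rewrite /v /= ?mulr1n; apply/rowP=> i; rewrite !mxE; field.
- by rewrite !wR ?bE // !actF // !bfE !bE // mulr0 addr0 mul0r !scale0r !subr0.
rewrite wR ?bE // !actW (bformDr sJ) (bformZr sJ) !bE // mulr0 addr0 mul0r scale0r subr0; congr (wv _).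
by rewrite frob_X invrK !(frobM, frobN, frobK) frob_rX !mulrN opprK mulrA mulfV ?mul1r // expf_neq0 // r_neq0.
Qed.

Local Notation BC := (bformC sJ).

Lemma ev_coord i (x : vec) : (i < m)%N -> B (ev i) x = x 0 (f_pos n i.+1).
Proof. by move=> hi; rewrite /bform (ev_gram hi) /fv /bvec -rowE !mxE. Qed.
Lemma fv_coord i (x : vec) : (i < m)%N -> B (fv i) x = x 0 (e_pos n i.+1).
Proof. by move=> hi; rewrite /bform (fv_gram hi) /ev /bvec -rowE !mxE. Qed.

(** * Transitivity on vectors *)

(** Orthogonality to the planes from k on means lying in the span of W and the
    first k planes. *)
Definition inV k (x : vec) := forall i, (k <= i)%N -> (i < m)%N -> B (ev i) x = 0 /\ B (fv i) x = 0.

Lemma inVD k x y : inV k x -> inV k y -> inV k (x + y).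
Proof. by move=> Vx Vy i ki im; have [x1 x2] := Vx i ki im; have [y1 y2] := Vy i ki im; rewrite !(bformDr sJ) x1 x2 y1 y2 addr0. Qed.
Lemma inVZ k a x : inV k x -> inV k (a *: x).
Proof. by move=> Vx i ki im; have [x1 x2] := Vx i ki im; rewrite !(bformZr sJ) x1 x2 mulr0. Qed.
Lemma inV_wv k x : inV k (wv x).
Proof. by move=> i _ hi; rewrite !bE. Qed.
Lemma inV_e k i : (i < k)%N -> (k <= m)%N -> inV k (ev i) /\ inV k (fv i).
Proof.
move=> ik km; have hi := leq_trans ik km.
split=> j kj hj; rewrite !bE //; have ij : j == i = false by rewrite gtn_eqF // (leq_trans ik).
  by rewrite ij.
by rewrite ij.
Qed.
Lemma inV_sub k l x : (k <= l)%N -> inV k x -> inV l x.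
Proof. by move=> kl Vx i li; apply: Vx; apply: leq_trans li. Qed.

Lemma inV0 x : inV 0 x -> exists y, x = wv y.
Proof.
move=> Vx; exists (emb (x 0 (w1_pos n)) + emb (x 0 (w2_pos n)) * Defs.psi F omega).
rewrite wv_comb; apply/rowP=> a; rewrite !mxE eqxx /=.
case: (posP a) => [i hi|i hi||]; rewrite !posE ?mulr0 ?mulr1 ?addr0 ?add0r //.
  by have [_ <-] := Vx i (leq0n i) hi; rewrite fv_coord.
by have [<- _] := Vx i (leq0n i) hi; rewrite ev_coord.
Qed.

Lemma inV_dec k x : (k < m)%N -> inV k.+1 x -> exists2 r, inV k r &
  x = r + (B (fv k) x *: ev k + B (ev k) x *: fv k).
Proof.
move=> hk Vx; exists (x - (B (fv k) x *: ev k + B (ev k) x *: fv k)); last by rewrite subrK.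
move=> i; rewrite leq_eqVlt => /orP[/eqP<-|ki] hi.
  by rewrite !(bformDr sJ) !(bformNr sJ) !(bformDr sJ) !(bformZr sJ) !bE // !eqxx !mulr0 !mulr1 add0r addr0 !subrr.
have [e0 f0] := Vx i ki hi; have ik : i == k = false by rewrite gtn_eqF.
by rewrite !(bformDr sJ) !(bformNr sJ) !(bformDr sJ) !(bformZr sJ) !bE // ik e0 f0 /= !mulr0 !addr0 !subr0.
Qed.

(** The form is non-degenerate on W and the first k planes. *)
Lemma inV_nondeg k r : (k <= m)%N -> inV k r -> r != 0 -> exists2 u, inV k u & B r u != 0.
Proof.
elim: k r => [|k IH] r hk Vr r0.
  have [y ry] := inV0 Vr; exists r => //; rewrite ry (bformQ J tF) mulf_neq0 ?tF //.
  by rewrite Q_w_eq0; apply: contraNneq r0 => y0; rewrite ry y0 wv0.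
have [a0|a0] := eqVneq (B (fv k) r) 0; last first.
  by exists (fv k); [case: (inV_e (ltnSn k) hk)|rewrite BC].
have [b0|b0] := eqVneq (B (ev k) r) 0; last first.
  by exists (ev k); [case: (inV_e (ltnSn k) hk)|rewrite BC].
have [r' Vr' E] := inV_dec hk Vr; move: E; rewrite a0 b0 !scale0r !addr0 => E.
have [|u Vu bu] := IH r (ltnW hk) _ r0; first by rewrite E.
by exists u => //; apply: inV_sub Vu.
Qed.

Lemma eichV k v : (k < m)%N -> inV k v -> eich J (fv k) v.
Proof. by move=> hk Vv; have [_ f0] := Vv k (leqnn k) hk; split; rewrite ?bE. Qed.

Lemma inV_act k x g : g \in O -> (forall i, (k <= i)%N -> (i < m)%N -> ev i *v g = ev i /\ fv i *v g = fv i) ->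
  inV k x -> inV k (x *v g).
Proof.
move=> Og fix_g Vx i ki hi; have [eg fg] := fix_g i ki hi.
by rewrite -{1}eg -{1}fg !(isomB _ _ Og); apply: Vx.
Qed.

Lemma Um_fix k x : (k.+1 < m)%N -> inV k x -> x *v Um k = x.
Proof.
move=> hk Vx; have [e0 f0] := Vx k (leqnn k) (ltnW hk); have [e1 f1] := Vx k.+1 (leqnSn k) hk.
have ne : k == k.+1 = false by rewrite ltn_eqF.
by rewrite UmE (weyl_sr sJ tF (hyp_ef (ltnW hk))) ?bE ?ne ?(ltnW hk) // BC.
Qed.

Section Transitive.
Set Default Proof Using "All".
Variables (S : GL -> Prop) (j : nat).
Hypothesis hj : (j < m)%N.
Hypothesis SM : forall g h, S g -> S h -> S (g * h)%g.
Hypothesis SO : forall g, S g -> g \in O /\ forall i, (j < i)%N -> (i < m)%N -> ev i *v g = ev i /\ fv i *v g = fv i.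
Hypothesis SE : forall u, inV j u -> S (E (fv j) u).
Hypothesis SZ : exists2 g, S g & ev j *v g = fv j /\ fv j *v g = ev j.
Hypothesis SD : forall c, c != 0 -> exists2 g, S g & ev j *v g = c *: ev j /\ fv j *v g = c^-1 *: fv j.

Let act_V g x : S g -> inV j.+1 x -> inV j.+1 (x *v g).
Proof. by move=> Sg; have [Og fg] := SO Sg; apply: inV_act. Qed.

Let step1 x : inV j.+1 x -> B (fv j) x != 0 -> exists2 g, S g & exists c, x *v g = ev j + c *: fv j.
Proof.
move=> Vx a0; have [r Vr E] := inV_dec hj Vx.
set a := B (fv j) x in a0 E; set b := B (ev j) x in E.
have Vu : inV j (- a^-1 *: r) by apply: inVZ.
have ai0 : a^-1 != 0 by rewrite invr_eq0.
have [D SDD [De Df]] := SD ai0.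
exists (eichler J (fv j) (- a^-1 *: r) * D)%g; first exact: (SM (SE Vu) SDD).
rewrite actM (eichlerE sJ tF (eichV hj Vu)) (BC x) -/a.
have {1}-> : x + a *: (- a^-1 *: r) = a *: ev j + b *: fv j.
  by rewrite scalerA mulrN mulfV // scaleN1r {1}E addrAC subrr add0r.
move: (B x _) (Q _) => c1 c2.
have -> : a *: ev j + b *: fv j - c1 *: fv j - (c2 * a) *: fv j = a *: ev j + (b - c1 - c2 * a) *: fv j.
  by rewrite !scalerBl !addrA.
by exists ((b - c1 - c2 * a) * a); rewrite actD !actZ De Df !scalerA mulfV // scale1r invrK.
Qed.
Let step2 x : inV j.+1 x -> B (ev j) x != 0 -> exists2 g, S g & exists c, x *v g = ev j + c *: fv j.
Proof.
move=> Vx b0; have [Z SZZ [Ze Zf]] := SZ; have [OZ _] := SO SZZ.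
have [|g Sg [c E]] := step1 (act_V SZZ Vx); first by rewrite -Ze (isomB _ _ OZ).
by exists (Z * g)%g; [exact: (SM SZZ Sg)|exists c; rewrite actM].
Qed.

(** A group S that contains the E(f_j,u), the exchange of e_j and f_j and the
    torus of the plane j moves every nonzero vector of the first j+1 planes and W
    into e_j + <f_j>: if x has a nonzero coordinate on e_j or f_j, scale it to 1
    and clear the rest by an E(f_j,u); otherwise some E(f_j,u) creates such a
    coordinate, by non-degeneracy. *)
Lemma transitive_V x : inV j.+1 x -> x != 0 -> exists2 g, S g & exists c, x *v g = ev j + c *: fv j.
Proof.
move=> Vx x0; have [a0|a0] := eqVneq (B (fv j) x) 0; last exact: step1.
have [b0|b0] := eqVneq (B (ev j) x) 0; last exact: step2.
have [r Vr E] := inV_dec hj Vx; move: E; rewrite a0 b0 !scale0r !addr0 => E.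
have [|u Vu bu] := inV_nondeg (ltnW hj) _ x0; first by rewrite E.
have SEu := SE Vu; have eu := eichV hj Vu.
have Bx : B (ev j) (x *v eichler J (fv j) u) != 0.
  rewrite (eichlerE sJ tF eu) (BC x) a0 mulr0 !scale0r addr0 subr0 (bformDr sJ) (bformNr sJ) (bformZr sJ) b0 bE // eqxx mulr1 add0r oppr_eq0.
  exact: bu.
have [g Sg [c Eg]] := step2 (act_V SEu Vx) Bx.
by exists (eichler J (fv j) u * g)%g; [exact: (SM SEu Sg)|exists c; rewrite actM].
Qed.
End Transitive.
End Coordinates.

Local Close Scope ring_scope.
Local Open Scope group_scope.

(** * Subgroups given by predicates *)

Lemma GL_torsion (F : finFieldType) n (g : {'GL_n[F]}) : exists2 k, (0 < k)%N & g ^+ k = 1.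
Proof. by exists #[g]; [exact: order_gt0|exact: expg_order]. Qed.

Section Subgroups.
Variable G : groupType.
Implicit Types (A S : G -> Prop) (g h x y : G).

Definition subgrp A := [/\ A 1, forall x y, A x -> A y -> A (x * y) & forall x, A x -> A x^-1].
Inductive gen S : G -> Prop :=
| gen_in x of S x : gen S x
| gen_1 : gen S 1
| gen_M x y of gen S x & gen S y : gen S (x * y)
| gen_V x of gen S x : gen S x^-1.

Lemma gen_subgrp S : subgrp (gen S).
Proof. by split; [exact: gen_1|exact: gen_M|exact: gen_V]. Qed.
Lemma gen_sub S A : subgrp A -> (forall x, S x -> A x) -> forall g, gen S g -> A g.
Proof.
case=> A1 AM AV SA g; elim=> [|//|x y _ Ax _ Ay|x _ Ax]; [exact: SA|exact: AM|exact: AV].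
Qed.

Lemma subgrpX A x k : subgrp A -> A x -> A (x ^+ k).
Proof. by case=> A1 AM _ Ax; elim: k => [|k IH]; rewrite ?expg0 ?expgS //; apply: AM. Qed.
Lemma subgrpJ A x y : subgrp A -> A x -> A y -> A (x ^ y).
Proof. by case=> A1 AM AV Ax Ay; rewrite conjgE; apply: (AM _ _ (AV _ Ay)); exact: AM. Qed.

Lemma commuteJ x y g : commute x y -> commute (x ^ g) (y ^ g).
Proof. by rewrite /commute -!conjMg => ->. Qed.
Lemma conj_fix x y : commute x y -> x ^ y = x.
Proof. by move=> c; rewrite conjgE c mulKg. Qed.
Lemma fix_conj x y : x ^ y = x -> commute x y.
Proof. by move=> c; rewrite /commute conjgC c. Qed.

Lemma cent_subgrp x : subgrp (commute x).
Proof.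
split=> [|y y'|y]; [exact: commute1|exact: commuteM|exact: commuteV].
Qed.

Definition nrm A y := forall x, A x -> A (x ^ y).
Lemma nrmM A y y' : nrm A y -> nrm A y' -> nrm A (y * y').
Proof. by move=> Ay Ay' x Ax; rewrite conjgM; apply/Ay'/Ay. Qed.
Lemma nrm1 A : nrm A 1. Proof. by move=> x; rewrite conjg1. Qed.
Lemma nrmX A y k : nrm A y -> nrm A (y ^+ k).
Proof. by move=> Ay; elim: k => [|k IH]; rewrite ?expg0 ?expgS; [exact: nrm1|exact: nrmM]. Qed.

(** If y has finite order, its inverse is one of its powers, so that a set
    normalised by y is normalised by y^-1. This is how finiteness is used in the
    presented group. *)
Definition torsion y := exists2 k, (0 < k)%N & y ^+ k = 1.
Lemma torsionV y : torsion y -> exists k, y^-1 = y ^+ k.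
Proof.
by case=> [[|k]] // _ yk; exists k; apply: mulg1_eq; rewrite -expgS.
Qed.
Lemma torsionJ y g : torsion y -> torsion (y ^ g).
Proof. by case=> k k0 yk; exists k; rewrite // -conjXg yk conj1g. Qed.
Lemma nrmV A y : torsion y -> nrm A y -> nrm A y^-1.
Proof. by case/torsionV=> k ->; apply: nrmX. Qed.

Lemma gen_nrm S A : subgrp A -> (forall y, S y -> nrm A y /\ torsion y) ->
  forall g, gen S g -> nrm A g.
Proof.
move=> sA SA g Sg; suff [] : nrm A g /\ nrm A g^-1 by [].
pose N y := nrm A y /\ nrm A y^-1; move: g Sg; apply: (@gen_sub _ N); last first.
  by move=> y /SA[Ay ty]; split=> //; apply: nrmV.
split=> [|x y [nx nx'] [ny ny']|x [nx nx']]; rewrite /N ?invg1 ?invgM ?invgK.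
- by split; apply: nrm1.
- by split; apply: nrmM.
by split.
Qed.

Lemma gen_nrm_gen S y : (forall x, S x -> gen S (x ^ y)) -> nrm (gen S) y.
Proof.
move=> Sy; apply: (@gen_sub _ (fun x => gen S (x ^ y))) => //; case: (gen_subgrp S) => G1 GM GV.
by split=> [|a b Ga Gb|a Ga]; rewrite ?conj1g ?conjMg ?conjVg //; [apply: GM|apply: GV].
Qed.
End Subgroups.

Local Ltac gsolve := rewrite /conjg ?gnorm; by [].

(** * A decomposition into three double cosets *)

Section BruhatCosets.
Variables (G : groupType) (H Q : G -> Prop) (z d u zj dj y0 q0 q0' : G).
Hypotheses (sH : subgrp H) (sQ : subgrp Q).
Hypothesis QH : forall h, H h -> nrm Q h.
Hypotheses (zz : z * z = 1) (dz : d ^ z = d^-1) (dtor : torsion d).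
Hypotheses (zH : nrm H z) (dH : nrm H d) (dQ : nrm Q d).
Hypotheses (uz : u * z = zj * u) (ud : u * d = dj * u) (du : d * u = u * dj).
Hypotheses (Hzj : H zj) (Hdj : H dj).
Let P g := exists a h, [/\ Q a, H h & g = a * h].
Let D g := exists i : nat, g = d ^+ i.
Hypotheses (Qy0 : Q y0) (Qq0 : Q q0) (Qq0' : Q q0').
Hypothesis y0z : y0 ^ z = q0 * (zj * u * zj) * q0'.
Hypothesis uq0 : P (u * q0 * u^-1).
Hypothesis uzuz : exists h1 e h2, [/\ H h1, D e, H h2 & u * zj * u * zj = h1 * z * e * h2].
Hypothesis dec : forall a, Q a -> exists a0 a1,
  [/\ Q a0, a = a0 * a1, P (u * a0 * u^-1) & a1 = 1 \/ exists2 e, D e & a1 = y0 ^ e].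
Hypothesis tr : forall a, Q a -> a = 1 \/ exists h b, [/\ H h, Q b, a = b ^ h &
  b = y0 \/ exists q1 e h1 q2, [/\ Q q1, D e, H h1, Q q2 & b ^ z = q1 * z * e * h1 * q2]].

Let H1 : H 1. Proof. by case: sH. Qed.
Let HM x y : H x -> H y -> H (x * y). Proof. by case: sH => _ HM _; apply: HM. Qed.
Let HV x : H x -> H x^-1. Proof. by case: sH => _ _; apply. Qed.
Let Q1 : Q 1. Proof. by case: sQ. Qed.
Let QM x y : Q x -> Q y -> Q (x * y). Proof. by case: sQ => _ QM _; apply: QM. Qed.
Let QV x : Q x -> Q x^-1. Proof. by case: sQ => _ _; apply. Qed.
Let zV : z^-1 = z. Proof. exact: mulg1_eq. Qed.

Let D1 : D 1. Proof. by exists 0. Qed.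
Let DM x y : D x -> D y -> D (x * y).
Proof. by case=> i -> [j ->]; exists (i + j)%N; rewrite expgnDr. Qed.
Let DV x : D x -> D x^-1.
Proof. by case=> i ->; have [k dk] := torsionV dtor; exists (k * i)%N; rewrite -expVgn dk expgnA. Qed.
Let Dz x : D x -> D (x ^ z).
Proof. by case=> i ->; rewrite conjXg dz expVgn; apply: DV; exists i. Qed.
Let DH x : D x -> nrm H x. Proof. by case=> i ->; apply: nrmX. Qed.
Let DQ x : D x -> nrm Q x. Proof. by case=> i ->; apply: nrmX. Qed.
Let uD x : D x -> exists2 h, H h & u * x = h * u.
Proof.
case=> i ->; exists (dj ^+ i); first exact: subgrpX.
by elim: i => [|i IH]; rewrite ?mulg1 ?mul1g // !expgS mulgA ud -mulgA IH mulgA.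
Qed.
Let Du x : D x -> exists2 h, H h & x * u = u * h.
Proof.
case=> i ->; exists (dj ^+ i); first exact: subgrpX.
by elim: i => [|i IH]; rewrite ?mulg1 ?mul1g // !expgSr -mulgA du mulgA IH mulgA.
Qed.

Let PM x y : P x -> P y -> P (x * y).
Proof.
case=> a [h [Qa Hh ->]] [b [k [Qb Hk ->]]]; exists (a * b ^ h^-1), (h * k).
split; [by apply/QM/QH=> //; apply: HV|exact: HM|].
gsolve.
Qed.
Let PQ a : Q a -> P a. Proof. by move=> Qa; exists a, 1; rewrite mulg1. Qed.
Let PH h : H h -> P h. Proof. by move=> Hh; exists 1, h; rewrite mul1g. Qed.
Let DP x p : D x -> P p -> exists2 p', P p' & x * p = p' * x.
Proof.
move=> Dx [a [h [Qa Hh ->]]]; have Dv := DV Dx; exists (a ^ x^-1 * h ^ x^-1).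
  by exists (a ^ x^-1), (h ^ x^-1); split=> //; [apply: DQ|apply: DH].
gsolve.
Qed.

Let Good g := [\/ exists p e a, [/\ P p, D e, Q a & g = p * z * e * a],
  exists p a h, [/\ P p, Q a, H h & g = p * u * a * h] | exists p e, [/\ P p, D e & g = p * e]].

Let lP p g : P p -> Good g -> Good (p * g).
Proof.
move=> Pp [[p' [e [a [Pp' De Qa ->]]]]|[p' [a [h [Pp' Qa Hh ->]]]]|[p' [e [Pp' De ->]]]].
- by apply: Or31; exists (p * p'), e, a; rewrite !mulgA; split=> //; apply: PM.
- by apply: Or32; exists (p * p'), a, h; rewrite !mulgA; split=> //; apply: PM.
by apply: Or33; exists (p * p'), e; rewrite !mulgA; split=> //; apply: PM.
Qed.
Let lD x g : D x -> Good g -> Good (x * g).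
Proof.
move=> Dx [[p' [e [a [Pp' De Qa ->]]]]|[p' [a [h [Pp' Qa Hh ->]]]]|[p' [e [Pp' De ->]]]].
- have [p Pp E] := DP Dx Pp'; apply: Or31; exists p, (x ^ z * e), a.
  by split=> //; [apply: DM => //; apply: Dz|rewrite !mulgA E; gsolve].
- have [p Pp E] := DP Dx Pp'; have [k Hk E'] := Du Dx.
  apply: Or32; exists p, (a ^ k^-1), (k * h); split=> //; [by apply/QH/Qa/HV|exact: HM|].
  rewrite !mulgA E -(mulgA p x u) E'; gsolve.
have [p Pp E] := DP Dx Pp'; apply: Or33; exists p, (x * e).
by split=> //; [apply: DM|rewrite !mulgA E].
Qed.
Let rQ g b : Q b -> Good g -> Good (g * b).
Proof.
move=> Qb [[p' [e [a [Pp' De Qa ->]]]]|[p' [a [h [Pp' Qa Hh ->]]]]|[p' [e [Pp' De ->]]]].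
- by apply: Or31; exists p', e, (a * b); rewrite !mulgA; split=> //; apply: QM.
- apply: Or32; exists p', (a * b ^ h^-1), h; split=> //; last first.
    gsolve.
  by apply/QM/QH=> //; apply: HV.
apply: Or33; exists (p' * b ^ e^-1), e; split=> //; last gsolve.
by apply/PM/PQ/DQ=> //; apply: DV.
Qed.
Let rH g k : H k -> Good g -> Good (g * k).
Proof.
move=> Hk [[p' [e [a [Pp' De Qa ->]]]]|[p' [a [h [Pp' Qa Hh ->]]]]|[p' [e [Pp' De ->]]]].
- apply: Or31; exists (p' * (k ^ e^-1) ^ z^-1), e, (a ^ k); split=> //; last first.
  + gsolve.
  + exact: QH.
  by rewrite zV; apply/PM/PH/zH/DH=> //; apply: DV.
- by apply: Or32; exists p', a, (h * k); rewrite !mulgA; split=> //; apply: HM.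
apply: Or33; exists (p' * k ^ e^-1), e; split=> //; last gsolve.
by apply/PM/PH/DH=> //; apply: DV.
Qed.
Let rD g x : D x -> Good g -> Good (g * x).
Proof.
move=> Dx [[p' [e [a [Pp' De Qa ->]]]]|[p' [a [h [Pp' Qa Hh ->]]]]|[p' [e [Pp' De ->]]]].
- apply: Or31; exists p', (e * x), (a ^ x); split=> //; [exact: DM|exact: DQ|].
  gsolve.
- have [k Hk E] := uD Dx; apply: Or32; exists (p' * k), (a ^ x), (h ^ x).
  split; [by apply/PM/PH|exact: DQ|exact: DH|].
  rewrite -(mulgA p' k u) -E; gsolve.
by apply: Or33; exists p', (e * x); rewrite !mulgA; split=> //; apply: DM.
Qed.
Let Good1 : Good 1.
Proof. by apply: Or33; exists 1, 1; rewrite mulg1; split=> //; apply: PH. Qed.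
Let Goodz : Good z.
Proof. by apply: Or31; exists 1, 1, 1; rewrite !mulg1 mul1g; split=> //; apply: PH. Qed.
Let Goodu : Good u.
Proof. by apply: Or32; exists 1, 1, 1; rewrite !mulg1 mul1g; split=> //; apply: PH. Qed.

Let Good_y0z : Good (y0 ^ z).
Proof.
rewrite y0z; apply: rQ => //; apply: (lP (PQ Qq0)); apply: rH => //.
exact: (lP (PH Hzj)).
Qed.

Let Good_uy0z : Good (u * y0 ^ z).
Proof.
rewrite y0z !mulgA; apply: rQ => //.
have [h1 [e [h2 [Hh1 De Hh2 E]]]] := uzuz.
have -> : u * q0 * zj * u * zj = (u * q0 * u^-1) * (h1 * z * e * h2).
  by rewrite -E !mulgA mulgVK.
apply: (lP uq0); apply: rH => //; apply: rD => //; exact: (lP (PH Hh1)).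
Qed.

Let Good_uaz a : Q a -> Good (u * a * z).
Proof.
move=> /dec[a0 [a1 [Qa0 -> Pu a1E]]].
have -> : u * (a0 * a1) * z = (u * a0 * u^-1) * (u * a1 * z) by rewrite !mulgA mulgVK.
apply: (lP Pu); case: a1E => [->|[e De ->]].
  by rewrite mulg1 uz; apply: (lP (PH Hzj)).
have -> : u * y0 ^ e * z = u * z * (y0 ^ z) ^ (e ^ z).
  gsolve.
rewrite uz conjgE; have Dez := Dz De; have [k Hk E] := uD (DV Dez).
have -> : zj * u * ((e ^ z)^-1 * (y0 ^ z * e ^ z)) = (zj * k) * (u * y0 ^ z) * e ^ z.
  by rewrite !mulgA -(mulgA zj u) E !mulgA.
by apply: rD => //; apply: lP => //; apply/PH/HM.
Qed.

Let rz g : Good g -> Good (g * z).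
Proof.
move=> [[p' [e [a [Pp' De Qa ->]]]]|[p' [a [h [Pp' Qa Hh ->]]]]|[p' [e [Pp' De ->]]]]; last first.
- have -> : p' * e * z = p' * (z * e ^ z) by gsolve.
  by apply: lP => //; apply: rD => //; apply: Dz.
- have -> : p' * u * a * h * z = p' * (u * a * z) * h ^ z by gsolve.
  by apply: rH; [exact: zH|apply: lP => //; apply: Good_uaz].
rewrite -3!mulgA; apply: lP => //; have Dez := Dz De.
case: (tr Qa) => [->|[h [b [Hh Qb -> bE]]]].
  have -> : z * (e * (1 * z)) = e ^ z * 1 by rewrite -{1}zV; gsolve.
  by apply: lD => //.
have -> : z * (e * (b ^ h * z)) = e ^ z * ((h^-1) ^ z * b ^ z * h ^ z).
  rewrite -{1}zV; gsolve.
apply: lD => //; apply: rH; first exact: zH.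
apply: lP; first by apply/PH/zH/HV.
case: bE => [-> //|[q1 [x [h1 [q2 [Qq1 Dx Hh1 Qq2 ->]]]]]].
apply: rQ => //; apply: rH => //; apply: rD => //; exact: (lP (PQ Qq1)).
Qed.

(** The union of P z D Q, P u Q H and P D, where D is generated by d and P = Q H,
    is stable under right multiplication by H and Q because H normalises Q, and
    d normalises both. Right multiplication by z is the only serious case. After
    p z e a, the hypothesis tr brings a, by conjugation in H, either to y0, whose
    conjugate by z is known, or to an element b with b^z in Q z D H Q. After
    p u a, the hypothesis dec splits off a part of a that u carries into P and
    leaves a conjugate of y0 under D; y0z and uzuz then apply. *)
Lemma bruhat_cosets g : gen (fun x => [\/ H x, Q x | x = z]) g ->
  [\/ exists p e a, [/\ P p, D e, Q a & g = p * z * e * a],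
      exists p a h, [/\ P p, Q a, H h & g = p * u * a * h] |
      exists p e, [/\ P p, D e & g = p * e]].
Proof.
move=> Sg; rewrite -[g]mul1g; move: (1) Good1 => x Gx; rewrite -/(Good (x * g)).
pose A y := (forall x, Good x -> Good (x * y)) /\ (forall x, Good x -> Good (x * y^-1)).
suff [] : A g by move=> /(_ x Gx).
move: g Sg; apply: gen_sub.
  split=> [|a b [a1 a2] [b1 b2]|a [a1 a2]]; rewrite /A ?invg1 ?invgK //.
    by split=> y; rewrite mulg1.
  by split=> y Gy; rewrite ?invgM mulgA; [apply/b1/a1|apply/a2/b2].
move=> y [Hy|Qy|->]; split=> w Gw; rewrite ?zV; do ?[exact: rz].
- exact: rH.
- by apply: rH => //; apply: HV.
- exact: rQ.
by apply: rQ => //; apply: QV.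
Qed.
End BruhatCosets.

Lemma commute_conj (G : groupType) (x y g : G) : commute x y -> commute x g -> commute x (y ^ g).
Proof. by move=> cy cg; rewrite -(conj_fix cg); apply: commuteJ. Qed.
Lemma commuteJI (G : groupType) (x y g : G) : commute (x ^ g) (y ^ g) -> commute x y.
Proof. by move/(commuteJ g^-1); rewrite !conjgK. Qed.

(** * Consequences of the relations: the subgroups Gam k *)

Section Lifting.
Variables (G : groupType) (s t d z u v : G).

(** The exchange of the planes i and i+1 (uw), and the group of the first k
    planes and W with its generators (Gset, Gam). *)
Definition uw i := u ^ (v ^+ i).
Definition Gset k g := [\/ g = t, g = d, g = z | (1 < k)%N /\ g = s \/ exists2 i, (i.+1 < k)%N & g = uw i].
Definition Gam k := gen (Gset k).
End Lifting.

Section LiftingFacts.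
Variables (p e n : nat) (F L : finFieldType) (emb : {rmorphism F -> L}) (omega : L).
Local Notation GL := {'GL_n.*2[F]}.
Variables (G : groupType) (pi : UMagmaMorphism.type G GL) (s t d z u v : G).

(** A group G over the matrix group in which the relations hold and on whose
    two subgroups with a given presentation the projection is faithful. The
    matrix group itself is an example, with pi the identity, and so statements
    about G below also yield statements about matrices. *)
Record lifting : Prop := Lifting {
  lift_set : setting p e n emb omega;
  pi_s : pi s = sigma_gen F n; pi_t : pi t = tau_gen F n;
  pi_d : pi d = delta_gen emb omega n; pi_z : pi z = z_gen F n;
  pi_u : pi u = U_gen F n; pi_v : pi v = V_gen F n;
  faithful_K : forall g, Gam s t d z u v 2 g -> pi g = 1 -> g = 1;
  faithful_W : forall g, gen (fun x => x = u \/ x = v) g -> pi g = 1 -> g = 1;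
  rel_zu : commute z (u ^ v); rel_zc : (4 < n)%N -> commute z (v * u^-1);
  rel_du : commute d (u ^ v); rel_dc : (4 < n)%N -> commute d (v * u^-1);
  rel_tu : commute t (u ^ v); rel_tc : (4 < n)%N -> commute t (v * u^-1);
  rel_su : (4 < n)%N -> commute s (u ^ (v ^+ 2));
  rel_sc : (5 < n)%N -> commute s (v * u^-1 * u^-1 ^ v);
  rel_sz : commute s (z ^ (v ^+ 2)); rel_sd : commute s (d ^ (v ^+ 2));
  rel_A : [~ s, s ^ v] = s ^ (v * u^-1);
  rel_B1 : commute s (s ^ (v * u^-1));
  rel_B2 : commute s (s ^ (u ^ (v * u^-1)));
  rel_C : (4 < n)%N -> commute s (s ^ (v ^+ 2));
  rel_D : commute (s ^ v) t }.

Hypothesis LH : lifting.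
Local Notation H := (lift_set LH).
Local Notation m := n.-1.
Local Notation uw := (uw u v).
Local Notation Gam := (Gam s t d z u v).
Local Notation Gset := (Gset s t d z u v).
Set Default Proof Using "All".
Local Hint Extern 0 (is_true (0 < _.-1)%N) => exact: (m_gt0 H) : core.
Local Hint Extern 0 (is_true (1 < _.-1)%N) => exact: (m_gt1 H) : core.
Local Hint Extern 0 (is_true (2 < _.-1)%N) => exact: (m_ge3 H) : core.

Lemma piM x y : pi (x * y) = pi x * pi y. Proof. exact: gmulfM. Qed.
Lemma piV x : pi x^-1 = (pi x)^-1. Proof. exact: gmulfV. Qed.
Lemma piX x i : pi (x ^+ i) = pi x ^+ i. Proof. exact: gmulfXn. Qed.
Lemma piJ x y : pi (x ^ y) = pi x ^ pi y. Proof. exact: gmulfJ. Qed.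
Definition piE := (piJ, piV, piX, piM, pi_s LH, pi_t LH, pi_d LH, pi_z LH, pi_u LH, pi_v LH).

Lemma gen_eq S x y : (forall g, gen S g -> pi g = 1 -> g = 1) ->
  gen S x -> gen S y -> pi x = pi y -> x = y.
Proof.
move=> fS Sx Sy E; apply: divg1_eq; apply: fS; last by rewrite gmulfM gmulfV E mulgV.
by have [_ SM SV] := gen_subgrp S; apply: SM => //; apply: SV.
Qed.

Lemma GamM k x y : Gam k x -> Gam k y -> Gam k (x * y).
Proof. by have [_ SM _] := gen_subgrp (Gset k); apply: SM. Qed.
Lemma GamV k x : Gam k x -> Gam k x^-1.
Proof. by have [_ _ SV] := gen_subgrp (Gset k); apply: SV. Qed.
Lemma Gam1 k : Gam k 1.
Proof. by have [] := gen_subgrp (Gset k). Qed.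
Lemma GamX k x i : Gam k x -> Gam k (x ^+ i).
Proof. exact: subgrpX (gen_subgrp _). Qed.
Lemma GamJ k x y : Gam k x -> Gam k y -> Gam k (x ^ y).
Proof. exact: subgrpJ (gen_subgrp _). Qed.
Lemma Gam_t k : Gam k t. Proof. by apply: gen_in; apply: Or41. Qed.
Lemma Gam_d k : Gam k d. Proof. by apply: gen_in; apply: Or42. Qed.
Lemma Gam_z k : Gam k z. Proof. by apply: gen_in; apply: Or43. Qed.
Lemma Gam_s k : (1 < k)%N -> Gam k s. Proof. by move=> k1; apply: gen_in; apply: Or44; left. Qed.
Lemma Gam_uw k i : (i.+1 < k)%N -> Gam k (uw i).
Proof. by move=> k1; apply: gen_in; apply: Or44; right; exists i. Qed.
Lemma uw0 : uw 0 = u. Proof. by rewrite /uw expg0 conjg1. Qed.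
Lemma Gam_u k : (1 < k)%N -> Gam k u. Proof. by move/(@Gam_uw k 0); rewrite uw0. Qed.
Lemma Gam_sub k l x : (k <= l)%N -> Gam k x -> Gam l x.
Proof.
move=> kl; move: x; apply: (@gen_sub _ (Gset k) (Gam l)); first exact: gen_subgrp.
move=> y [->|->|->|[[k1 ->]|[i ik ->]]].
- exact: Gam_t.
- exact: Gam_d.
- exact: Gam_z.
- exact: Gam_s (leq_trans k1 kl).
exact: Gam_uw (leq_trans ik kl).
Qed.
Lemma Gam_eq x y : Gam 2 x -> Gam 2 y -> pi x = pi y -> x = y.
Proof. exact: gen_eq (faithful_K LH). Qed.
Lemma Gam_torsion x : Gam 2 x -> torsion x.
Proof.
move=> Kx; have [k k0 pk] := GL_torsion (pi x); exists k => //.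
by apply: (faithful_K LH); [exact: GamX|rewrite gmulfXn].
Qed.
Lemma uw_torsion i : torsion (uw i).
Proof. by rewrite /uw; apply/torsionJ/Gam_torsion; apply: Gam_u. Qed.

Lemma uwD i j : uw (i + j) = uw i ^ (v ^+ j).
Proof. by rewrite /uw -conjgM expgnDr. Qed.
Lemma uwS i : uw i.+1 = uw i ^ v.
Proof. by rewrite -addn1 uwD expg1. Qed.
Lemma pi_uw i : (i.+1 < m)%N -> pi (uw i) = Um n emb omega i.
Proof. by move=> hi; rewrite /uw !piE (UmVX H). Qed.

Local Notation W := (gen (fun x => x = u \/ x = v)).
Lemma W_v : W v. Proof. by apply: gen_in; right. Qed.
Lemma W_uw i : W (uw i).
Proof.
apply: subgrpJ (gen_subgrp _) _ _; first by apply: gen_in; left.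
exact: subgrpX (gen_subgrp _) W_v.
Qed.
Lemma WM x y : W x -> W y -> W (x * y).
Proof. by case: (gen_subgrp (fun x => x = u \/ x = v)) => _ SM _; apply: SM. Qed.
Lemma WV x : W x -> W x^-1.
Proof. by case: (gen_subgrp (fun x => x = u \/ x = v)) => _ _; apply. Qed.
Lemma WJ x y : W x -> W y -> W (x ^ y).
Proof. exact: subgrpJ (gen_subgrp _). Qed.
Lemma WX x i : W x -> W (x ^+ i).
Proof. exact: subgrpX (gen_subgrp _). Qed.
Lemma W_eq x y : W x -> W y -> pi x = pi y -> x = y.
Proof. exact: gen_eq (faithful_W LH). Qed.

(** Relations among the uw i hold because pi is faithful on <u, v>. *)
Lemma uw_far i j : (i.+1 < j)%N -> (j.+1 < m)%N -> commute (uw i) (uw j).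
Proof.
move=> ij hj; have hij : (i <= j)%N := ltnW (ltnW ij).
rewrite -(subnK hij) -{1}[i]add0n !uwD; apply/commuteJ/commute_sym/fix_conj.
apply: W_eq; [by apply: WJ; apply: W_uw|exact: W_uw|].
have hji : ((j - i).+1 < m)%N by apply: leq_ltn_trans hj; rewrite ltnS leq_subr.
by rewrite piJ !pi_uw // (Um_far H) // ltn_subRL addn1.
Qed.

Lemma uw_braid i : uw i ^ (uw i.+1 * uw i) = uw i.+1.
Proof.
have b0 : uw 0 ^ (uw 1 * uw 0) = uw 1.
  apply: W_eq; [by apply: WJ; [|apply: WM]; apply: W_uw|exact: W_uw|].
  by rewrite piJ (piM (uw 1) (uw 0)) !pi_uw // (Um_braid H).
by rewrite -[i]add0n -addSn !uwD -conjMg -conjJg b0.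
Qed.
Lemma uw_braidM i : uw i * uw i.+1 * uw i = uw i.+1 * uw i * uw i.+1.
Proof.
have := uw_braid i; move: (uw i) (uw i.+1) => x y E.
by rewrite -mulgA (conjgC x) E.
Qed.

Lemma uw_sign1 i : uw i.+1 ^ (uw i ^+ 2) = (uw i.+1)^-1.
Proof.
have b0 : uw 1 ^ (uw 0 ^+ 2) = (uw 1)^-1.
  apply: W_eq; [by apply: WJ; [|apply: WX]; apply: W_uw|by apply: WV; apply: W_uw|].
  by rewrite piJ (piV (uw 1)) (piX (uw 0) 2) !pi_uw // (Um_sign1 H).
by rewrite -[i]add0n -addSn !uwD -conjXg -conjJg b0 conjVg.
Qed.
Lemma uw_sign0 i : uw i ^ (uw i.+1 ^+ 2) = (uw i)^-1.
Proof.
have b0 : uw 0 ^ (uw 1 ^+ 2) = (uw 0)^-1.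
  apply: W_eq; [by apply: WJ; [|apply: WX]; apply: W_uw|by apply: WV; apply: W_uw|].
  by rewrite piJ (piV (uw 0)) (piX (uw 1) 2) !pi_uw // (Um_sign0 H).
by rewrite -[i]add0n -addSn !uwD -conjXg -conjJg b0 conjVg.
Qed.
Lemma uw_period : uw m = u.
Proof.
apply: W_eq; [exact: W_uw|by have := W_uw 0; rewrite uw0|].
by rewrite /uw !piE (U_Vperiod H).
Qed.

(** The word uw (k-1) ... uw 0 for the signed cycle on the planes 0 to k. *)
Fixpoint pw k := if k is k'.+1 then uw k' * pw k' else 1.
Lemma pwS k : pw k.+1 = uw k * pw k. Proof. by []. Qed.
Lemma W_pw k : W (pw k).
Proof.
elim: k => [|k IH]; first by case: (gen_subgrp (fun x => x = u \/ x = v)).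
by rewrite pwS; apply: WM => //; apply: W_uw.
Qed.
Lemma v_prod : v = pw m.-1.
Proof.
apply: W_eq; [exact: W_v|exact: W_pw|rewrite (pi_v LH) (V_prod H)].
have : (m.-1 < m)%N by rewrite prednK.
elim: (m.-1) => [|k IH] hk; first by rewrite gmulf1.
by rewrite pwS (piM (uw k)) pi_uw // -(IH (ltnW hk)).
Qed.

Definition torus_part x := [\/ x = t, x = d | x = z].

Lemma n_gt4 i : (1 < i)%N -> (i.+1 < m)%N -> (4 < n)%N.
Proof. by move=> i1 hi; rewrite (n_pred H) ltnS; apply: leq_ltn_trans hi. Qed.

(** The relations give this for i = 1, and conjugation by v u^-1, which commutes
    with x and shifts uw i, gives the rest. *)
Lemma torus_uw i x : torus_part x -> (0 < i)%N -> (i.+1 < m)%N -> commute x (uw i).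
Proof.
move=> Tx; elim: i => [//|[|i] IH] _ hi.
  rewrite /uw expg1; case: Tx => ->; [exact: (rel_tu LH)|exact: (rel_du LH)|exact: (rel_zu LH)].
have n4 : (4 < n)%N by apply: n_gt4 hi.
have cx : commute x (v * u^-1).
  by case: Tx => ->; [exact: (rel_tc LH)|exact: (rel_dc LH)|exact: (rel_zc LH)].
have -> : uw i.+2 = uw i.+1 ^ (v * u^-1).
  rewrite conjgM -uwS; symmetry; apply: conj_fix.
  by have := @uw_far 0 i.+2 isT hi; rewrite uw0 => c; apply/commuteV/commute_sym.
by apply: commute_conj => //; apply: IH => //; apply: ltnW.
Qed.

Lemma s_uw i : (1 < i)%N -> (i.+1 < m)%N -> commute s (uw i).
Proof.
elim: i => [//|[//|[|i]] IH] _ hi.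
  by rewrite /uw; apply: (rel_su LH); apply: n_gt4 hi.
have n5 : (5 < n)%N by rewrite (n_pred H) ltnS; apply: leq_ltn_trans hi.
have -> : uw i.+3 = uw i.+2 ^ (v * u^-1 * u^-1 ^ v).
  rewrite (conjgM _ (v * u^-1)) (conjgM _ v) -uwS; symmetry.
  rewrite (conj_fix (_ : commute (uw i.+3) u^-1)); last first.
    by have := @uw_far 0 i.+3 isT hi; rewrite uw0 => c; apply/commuteV/commute_sym.
  rewrite conjVg; apply: conj_fix; apply: commuteV.
  by have := @uw_far 1 i.+3 isT hi; rewrite {1}/uw expg1 => /commute_sym.
by apply: commute_conj; [apply: IH => //; apply: ltnW|exact: (rel_sc LH)].
Qed.

(** The elements of Gam k commute with the uw i that involve no plane below k:
    this is where the centralising relations for sigma and tau are used. *)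
Lemma Gam_uw_comm k i g : (0 < k <= i)%N -> (i.+1 < m)%N -> Gam k g -> commute (uw i) g.
Proof.
case/andP=> k0 ki hi; move: g; apply: (@gen_sub _ (Gset k) (commute (uw i))); first exact: cent_subgrp.
move=> x.
have i0 : (0 < i)%N by apply: leq_trans ki.
case=> [->|->|->|[[k1 ->]|[j jk ->]]]; apply: commute_sym.
- by apply: torus_uw => //; apply: Or31.
- by apply: torus_uw => //; apply: Or32.
- by apply: torus_uw => //; apply: Or33.
- by apply: s_uw => //; apply: leq_trans ki.
by apply: uw_far => //; apply: leq_trans ki.
Qed.

(** V is a product of uw 1 * u and of uw i with i >= 2, and the latter commute
    with Gam 2. *)
Lemma conj_v x : Gam 2 x -> x ^ v = x ^ (uw 1 * u).
Proof.
move=> Kx; have vp k : (k.+2 < m)%N -> exists2 c, (forall y, Gam 2 y -> commute c y) & pw k.+2 = c * (uw 1 * u).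
  elim: k => [|k IH] hk.
    by exists 1 => [y _|]; [exact/commute_sym/commute1|rewrite !pwS mulg1 mul1g uw0].
  have [c cK E] := IH (ltnW hk); exists (uw k.+2 * c); last by rewrite pwS E mulgA.
  move=> y Ky; apply/commute_sym/commuteM; last exact/commute_sym/cK.
  exact/commute_sym/(Gam_uw_comm _ hk Ky).
have h2 : (m - 3).+2 = m.-1 by rewrite -(subnK (m_ge3 H)) addnK addn3.
have [|c cK E] := vp (m - 3)%N; first by rewrite h2 prednK.
transitivity (x ^ pw (m - 3).+2); first by rewrite h2 -v_prod.
by rewrite E conjgM (conj_fix (commute_sym (cK _ Kx))).
Qed.

Lemma conj_vX j x : Gam 2 x -> x ^ (v ^+ j.+1) = (x ^ (v ^+ j)) ^ (uw j.+1 * uw j).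
Proof.
move=> Kx; by rewrite expgS conjgM (conj_v Kx) [LHS]conjJg (conjMg (uw 1) u) -uwD add1n.
Qed.
Lemma conj_vX1 j x : Gam 1 x -> x ^ (v ^+ j.+1) = (x ^ (v ^+ j)) ^ uw j.
Proof.
move=> Kx; rewrite expgS conjgM conj_v; last exact: Gam_sub Kx.
rewrite conjgM (conj_fix (_ : commute x (uw 1))); last exact/commute_sym/(Gam_uw_comm _ _ Kx).
by rewrite [LHS]conjJg.
Qed.
Lemma conj_v1 x : Gam 1 x -> x ^ v = x ^ u.
Proof. by move/(conj_vX1 0); rewrite expg0 expg1 conjg1 uw0. Qed.

Lemma Gam_vX j x : Gam 1 x -> Gam j.+1 (x ^ (v ^+ j)).
Proof.
move=> Kx; elim: j => [|j IH]; first by rewrite expg0 conjg1.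
by rewrite conj_vX1 //; apply: GamJ; [apply: Gam_sub IH|apply: Gam_uw].
Qed.

(** For y in the group of the plane 0, normalising Gam 1 after transport to the
    plane 1, its transports to plane k normalise Gam k; y will be z and delta. *)
Section NormY.
Variable y : G.
Hypotheses (y1 : Gam 1 y) (sy : commute s (y ^ (v ^+ 2))) (ny : nrm (Gam 1) (y ^ u)).
Local Notation yk k := (y ^ (v ^+ k)).

Lemma nrm_next k : (0 < k)%N -> (k.+1 < m)%N -> nrm (Gam k) (yk k) -> nrm (Gam k) (yk k.+1).
Proof.
move=> k0 hk nk g Kg; rewrite conj_vX1 //.
have c h : Gam k h -> commute h (uw k).
  by move=> Kh; apply/commute_sym/(Gam_uw_comm _ hk Kh); rewrite k0 leqnn.
rewrite -(conj_fix (c g Kg)) -conjJg (conj_fix (c _ _)); exact: nk.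
Qed.

Lemma nrm_Gam k : (0 < k)%N -> (k < m)%N -> nrm (Gam k) (yk k).
Proof.
elim: k => [//|[|k] IH] _ hk; first by rewrite expg1 conj_v1.
have nk := IH isT (ltnW hk); have nk1 := nrm_next (ltn0Sn k) hk nk.
have old x : Gam k.+1 x -> Gam k.+2 (x ^ yk k.+2).
  by move/nk1; apply: Gam_sub.
apply: gen_nrm_gen => x [->|->|->|[[_ ->]|[i ik ->]]].
- by apply: old; apply: Gam_t.
- by apply: old; apply: Gam_d.
- by apply: old; apply: Gam_z.
- case: k {IH hk nk nk1} old => [|k] old; last by apply: old; apply: Gam_s.
  by rewrite (conj_fix sy); apply: Gam_s.
move: ik; rewrite ltnS leq_eqVlt => /orP[/eqP[ik]|ik]; last by apply: old; apply: Gam_uw.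
rewrite {}ik; have hi := ltnW hk.
have cy : commute (yk k) (uw k.+1).
  by apply/commute_sym/(Gam_uw_comm _ hk (Gam_vX k y1)); rewrite leqnn.
rewrite (conj_fix (_ : commute _ (yk k.+2))); first exact: Gam_uw.
have E : yk k.+2 = yk k ^ (uw k * uw k.+1) by rewrite (conj_vX1 k.+1 y1) (conj_vX1 k y1) -(conjgM (yk k)).
apply/commute_sym/fix_conj; rewrite E -(conjgM (yk k)) uw_braidM -(mulgA (uw k.+1) (uw k)).
by rewrite (conjgM (yk k)) (conj_fix cy).
Qed.
End NormY.

Local Notation q := #|F|.
Local Notation om0 := (omega0 emb omega).
Local Notation J := (gram emb omega n).
Local Notation ev := (ev n F).
Local Notation fv := (fv n F).
Local Notation wv := (wv n emb omega).
Local Notation inV := (inV emb omega).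
Local Notation B := (bform J).
Local Notation Q := (qform J).
Local Notation E := (eichler J).
Local Notation O := (Defs.isometries J).
Local Notation bE := (bvecE H).
Local Notation sJ := (gram_sym H).
Local Notation tF := (two_F H).
Local Notation mgt0 := (m_gt0 H).
Local Notation mgt1 := (m_gt1 H).
Local Notation mgt2 := (m_ge3 H).

(** * The first two planes in the presented group *)

Lemma gen_isom k g : Gam k g -> pi g \in O.
Proof.
apply: (@gen_sub _ _ (fun g => pi g \in O)) g.
  split=> [|x y Ox Oy|x Ox]; rewrite ?gmulf1 ?piM ?piV ?isom1 ?isomM ?isomV //.
move=> x [->|->|->|[[_ ->]|[i _ ->]]].
- by rewrite (pi_t LH) (t_isom H).
- by rewrite (pi_d LH) (d_isom H).
- by rewrite (pi_z LH) (z_isom H).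
- by rewrite (pi_s LH) (s_isom H).
by rewrite piJ piX (pi_u LH) (pi_v LH) isomJ ?isomX ?(U_isom H) ?(V_isom H).
Qed.

Definition x0 := s ^ u.
Lemma Gam_x0 : Gam 2 x0.
Proof. by apply: GamJ; [apply: Gam_s|apply: Gam_u]. Qed.
Local Notation z1 := (z ^ u).
Local Notation d1 := (d ^ u).
Lemma Gam_d1 : Gam 2 d1.
Proof. by apply: GamJ; [apply: Gam_d|apply: Gam_u]. Qed.
Lemma Gam_u2 : Gam 2 u. Proof. exact: Gam_u. Qed.
Lemma Gam_s2 : Gam 2 s. Proof. exact: Gam_s. Qed.

Lemma pi_z1 : pi z1 = zU n F.
Proof. by rewrite piJ (pi_z LH) (pi_u LH) (z1E H). Qed.
Lemma pi_d1 : pi d1 = dU n emb omega.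
Proof. by rewrite piJ (pi_d LH) (pi_u LH) (d1E H). Qed.

Local Ltac gam := repeat first [ assumption | apply: GamM | apply: GamV | apply: GamX
  | apply: GamJ | exact: Gam_x0 | exact: Gam_u2 | exact: Gam_s2 | exact: Gam_t | exact: Gam_d | exact: Gam_z ].

Local Open Scope ring_scope.

Lemma eich1 a b : eich J (fv 1) (a *: ev 0 + b *: fv 0).
Proof. by split; rewrite ?(bformE sJ) !bE // !mulr0 addr0. Qed.
Lemma eich1e a : eich J (fv 1) (a *: ev 0).
Proof. by split; rewrite ?(bformE sJ) !bE // !mulr0. Qed.
Lemma eich1f a : eich J (fv 1) (a *: fv 0).
Proof. by split; rewrite ?(bformE sJ) !bE // !mulr0. Qed.
Lemma eich0e : eich J (fv 0) (ev 1).
Proof. exact: (eich_fe H mgt0 mgt1 isT). Qed.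

Lemma pi_x0 : pi x0 = E (fv 1) (-1 *: ev 0).
Proof.
rewrite piJ (pi_s LH) (pi_u LH) (s_eichler H) (eichlerJ sJ tF (U_isom H) eich0e).
by rewrite !(UA H) scaleN1r.
Qed.
Lemma pi_x0z : pi (x0 ^ z)%g = E (fv 1) (-1 *: fv 0).
Proof.
rewrite piJ pi_x0 (pi_z LH) (eichlerJ sJ tF (z_isom H) (eich1e _)).
by rewrite actZ !(zA H).
Qed.
Lemma pi_conj_d g a i : pi g = E (fv 1) (a *: ev 0) -> pi (g ^ (d ^+ i))%g = E (fv 1) ((a * om0 ^- i) *: ev 0).
Proof.
move=> pg; rewrite piJ pg piX (pi_d LH) (eichlerJ sJ tF _ (eich1e _)) ?isomX ?(d_isom H) //.
by rewrite actZ !(dA H) scalerA.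
Qed.
Lemma pi_conj_df g a i : pi g = E (fv 1) (a *: fv 0) -> pi (g ^ (d ^+ i))%g = E (fv 1) ((a * om0 ^+ i) *: fv 0).
Proof.
move=> pg; rewrite piJ pg piX (pi_d LH) (eichlerJ sJ tF _ (eich1f _)) ?isomX ?(d_isom H) //.
by rewrite actZ !(dA H) scalerA.
Qed.
Lemma pi_conj_d1 g a i : pi g = E (fv 1) (a *: ev 0) -> pi (g ^ (d1 ^+ i))%g = E (fv 1) ((a * om0 ^+ i) *: ev 0).
Proof.
move=> pg; rewrite piJ pg piX pi_d1 (eichlerJ sJ tF _ (eich1e _)) ?isomX ?(d1_isom H) //.
by rewrite actZ !(d1A H) (eichlerZ sJ tF _ (eich1e _)) scalerA mulrC.
Qed.
Lemma pi_conj_d1f g a i : pi g = E (fv 1) (a *: fv 0) -> pi (g ^ (d1 ^+ i))%g = E (fv 1) ((a * om0 ^+ i) *: fv 0).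
Proof.
move=> pg; rewrite piJ pg piX pi_d1 (eichlerJ sJ tF _ (eich1f _)) ?isomX ?(d1_isom H) //.
by rewrite actZ !(d1A H) (eichlerZ sJ tF _ (eich1f _)) scalerA mulrC.
Qed.

(** The root group of the E(f_1, a e_0 + b f_0) in G; x0 = sigma^U lifts
    E(f_1, - e_0) and its conjugates under the torus, with those of x0^z, fill
    X1. *)
Definition X1 g := Gam 2 g /\ exists a b, pi g = E (fv 1) (a *: ev 0 + b *: fv 0).

Lemma X1e y a : y = d \/ y = d1 -> a != 0 -> exists i, pi (x0 ^ (y ^+ i))%g = E (fv 1) (a *: ev 0).
Proof.
have inj (c : F) : c != 0 -> -c != 0 by rewrite oppr_eq0.
case=> -> a0.
  have [|i ai] := om0_log H (_ : - a^-1 != 0); first by rewrite inj ?invr_eq0.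
  by exists i; rewrite (pi_conj_d _ pi_x0) -ai invrN invrK mulN1r opprK.
have [i ai] := om0_log H (inj a a0).
by exists i; rewrite (pi_conj_d1 _ pi_x0) -ai mulN1r opprK.
Qed.
Lemma X1f y a : y = d \/ y = d1 -> a != 0 -> exists i, pi ((x0 ^ z) ^ (y ^+ i))%g = E (fv 1) (a *: fv 0).
Proof.
move=> yd a0; have [|i ai] := om0_log H (_ : - a != 0); first by rewrite oppr_eq0.
exists i; case: yd => ->; first by rewrite (pi_conj_df _ pi_x0z) -ai mulN1r opprK.
by rewrite (pi_conj_d1f _ pi_x0z) -ai mulN1r opprK.
Qed.

Lemma E_split a b : E (fv 1) (a *: ev 0 + b *: fv 0) = (E (fv 1) (b *: fv 0) * E (fv 1) (a *: ev 0))%g.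
Proof. by rewrite (eichlerD sJ tF (eich1f b) (eich1e a)) addrC. Qed.

Lemma E1_0 : E (fv 1) (0 *: fv 0) = 1%g.
Proof. by rewrite scale0r (eichler0 sJ tF) // bE. Qed.
Lemma E1_0e : E (fv 1) (0 *: ev 0) = 1%g.
Proof. by rewrite scale0r (eichler0 sJ tF) // bE. Qed.

Local Open Scope group_scope.

Lemma X1_split y g : y = d \/ y = d1 -> X1 g -> exists g1 g2,
  [/\ g = g1 * g2, Gam 2 g1 /\ (exists b, pi g1 = E (fv 1) (b *: fv 0)%R),
      (g1 = 1 \/ exists i, g1 = (x0 ^ z) ^ (y ^+ i)) & (g2 = 1 \/ exists i, g2 = x0 ^ (y ^+ i))].
Proof.
move=> yd [Kg [a [b pg]]].
have Ky : Gam 2 y by case: yd => ->; gam.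
have [g2 [K2 p2 c2]] : exists g2, [/\ Gam 2 g2, pi g2 = E (fv 1) (a *: ev 0)%R & g2 = 1 \/ exists i, g2 = x0 ^ (y ^+ i)].
  have [->|a0] := eqVneq a 0%R.
    by exists 1; rewrite gmulf1 E1_0e; split; [exact: Gam1| |left].
  have [i pi2] := X1e yd a0; exists (x0 ^ (y ^+ i)); split=> //; first by gam.
  by right; exists i.
have [g1 [K1 p1 c1]] : exists g1, [/\ Gam 2 g1, pi g1 = E (fv 1) (b *: fv 0)%R & g1 = 1 \/ exists i, g1 = (x0 ^ z) ^ (y ^+ i)].
  have [->|b0] := eqVneq b 0%R.
    by exists 1; rewrite gmulf1 E1_0; split; [exact: Gam1| |left].
  have [i pi2] := X1f yd b0; exists ((x0 ^ z) ^ (y ^+ i)); split=> //; first by gam.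
  by right; exists i.
exists g1, g2; split=> //; last by split=> //; exists b.
by apply: Gam_eq => //; [gam|rewrite piM p1 p2 -E_split].
Qed.

(** A subgroup that contains x0 and x0^z and is normalised by one of the tori
    delta and delta^U contains X1. *)
Lemma X1_ind y (A : G -> Prop) : y = d \/ y = d1 -> subgrp A -> A x0 -> A (x0 ^ z) -> nrm A y ->
  forall g, X1 g -> A g.
Proof.
move=> yd [A1 AM AV] Ax Axz Ay g /(X1_split yd)[g1 [g2 [-> _ c1 c2]]].
apply: AM; [case: c1 => [->|[i ->]] //; exact: nrmX|case: c2 => [->|[i ->]] //; exact: nrmX].
Qed.

Lemma X1_lift a b : exists2 g, X1 g & pi g = E (fv 1) (a *: ev 0 + b *: fv 0)%R.
Proof.
have yd : d = d \/ d = d1 by left.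
have [g2 K2 p2] : exists2 g2, Gam 2 g2 & pi g2 = E (fv 1) (a *: ev 0)%R.
  have [->|a0] := eqVneq a 0%R; first by exists 1; [exact: Gam1|rewrite gmulf1 E1_0e].
  by have [i pi2] := X1e yd a0; exists (x0 ^ (d ^+ i)); [gam|].
have [g1 K1 p1] : exists2 g1, Gam 2 g1 & pi g1 = E (fv 1) (b *: fv 0)%R.
  have [->|b0] := eqVneq b 0%R; first by exists 1; [exact: Gam1|rewrite gmulf1 E1_0].
  by have [i pi2] := X1f yd b0; exists ((x0 ^ z) ^ (d ^+ i)); [gam|].
have E12 : pi (g1 * g2) = E (fv 1) (a *: ev 0 + b *: fv 0)%R by rewrite piM p1 p2 -E_split.
by exists (g1 * g2) => //; split; [gam|exists a, b].
Qed.

Lemma X1_subgrp : subgrp X1.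
Proof.
split.
- split; first exact: Gam1.
  by exists 0%R, 0%R; rewrite gmulf1 E_split E1_0 E1_0e mulg1.
- move=> x y [Kx [a [b px]]] [Ky [a' [b' py]]]; split; first by gam.
  exists (a + a')%R, (b + b')%R; rewrite piM px py (eichlerD sJ tF (eich1 a b) (eich1 a' b')).
  by rewrite !scalerDl addrACA.
move=> x [Kx [a [b px]]]; split; first by gam.
by exists (- a)%R, (- b)%R; rewrite piV px (eichlerN sJ tF (eich1 a b)) !scaleNr opprD.
Qed.
Lemma X1_x0 : X1 x0.
Proof. by split; [exact: Gam_x0|exists (-1)%R, 0%R; rewrite pi_x0 scale0r addr0]. Qed.
Lemma X1_x0z : X1 (x0 ^ z).
Proof. by split; [gam|exists 0%R, (-1)%R; rewrite pi_x0z scale0r add0r]. Qed.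

Lemma nrm_X1 y c a1 b1 a2 b2 : Gam 2 y ->
  [/\ fv 1 *v pi y = c *: fv 1, ev 0 *v pi y = a1 *: ev 0 + b1 *: fv 0 &
      fv 0 *v pi y = a2 *: ev 0 + b2 *: fv 0]%R -> nrm X1 y.
Proof.
move=> Ky [f1y e0y f0y] x [Kx [a [b px]]]; split; first by gam.
rewrite piJ px (eichlerJ sJ tF (gen_isom Ky) (eich1 a b)) !actL f1y e0y f0y.
exists (c * (a * a1 + b * a2))%R, (c * (a * b1 + b * b2))%R.
set w := (X in E (_ *: _)%R X).
have -> : w = ((a * a1 + b * a2) *: ev 0 + (a * b1 + b * b2) *: fv 0)%R.
  by rewrite /w !scalerDr !scalerA !scalerDl addrACA.
by rewrite (eichlerZ sJ tF _ (eich1 _ _)) scalerDr !scalerA.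
Qed.
Lemma nrm_X1_d : nrm X1 d.
Proof.
apply: (@nrm_X1 _ 1 om0^-1 0 0 om0)%R; first exact: Gam_d.
by rewrite (pi_d LH) -[delta_gen _ _ _]expg1 !(dA H) !expr1 !scale1r !scale0r addr0 add0r.
Qed.
Lemma nrm_X1_d1 : nrm X1 d1.
Proof.
apply: (@nrm_X1 _ om0 1 0 0 1)%R; first exact: Gam_d1.
by rewrite pi_d1 -[dU _ _ _]expg1 !(d1A H) !expr1 !scale1r !scale0r addr0 add0r.
Qed.
Lemma nrm_X1_u2 : nrm X1 (u ^+ 2).
Proof.
apply: (@nrm_X1 _ (-1) (-1) 0 0 (-1))%R; first by gam.
by rewrite expg2 piM (pi_u LH) !actM !(UA H) !actN !(UA H) !scaleN1r !scale0r addr0 add0r.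
Qed.

(** The following identities hold in Gam 2 because they hold for matrices; they
    are the ones that will be transported to other planes by powers of V. *)
Lemma K_zz : z * z = 1.
Proof. by apply: Gam_eq; [gam|exact: Gam1|rewrite piM (pi_z LH) (z_sqr H) gmulf1]. Qed.
Lemma K_dz : d ^ z = d^-1.
Proof. by apply: Gam_eq; [gam|gam|rewrite piJ piV (pi_z LH) (pi_d LH) (d_conj_z H)]. Qed.
Lemma K_zz1 : z ^ z1 = z.
Proof. by apply: Gam_eq; [gam|gam|rewrite piJ pi_z1 (pi_z LH) (z_conj_z1 H)]. Qed.
Lemma K_dz1 : d ^ z1 = d ^+ q.
Proof. by apply: Gam_eq; [gam|gam|rewrite piJ pi_z1 (pi_d LH) piX (pi_d LH) (d_conj_z1 H)]. Qed.
Lemma K_dd1 : d ^ d1 = d.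
Proof. by apply: Gam_eq; [gam|gam|rewrite piJ pi_d1 (pi_d LH) (d_conj_d1 H)]. Qed.
Lemma K_zd1 : z ^ d1 = z * d ^+ (q * q.-1).
Proof. by apply: Gam_eq; [gam|gam|rewrite piJ pi_d1 (pi_z LH) piM (pi_z LH) piX (pi_d LH) (z_conj_d1 H)]. Qed.
Lemma K_tz1 : t ^ z1 = t^-1.
Proof.
apply: Gam_eq; [gam|gam|rewrite piJ pi_z1 piV (pi_t LH) (t_eichler H)].
rewrite (eichlerJ sJ tF (z1_isom H) (eich_fw H _ mgt0)) (eichlerN sJ tF (eich_fw H _ mgt0)).
by rewrite !(z1A H) (z1w H) /frob expr1n (wvN H).
Qed.
Lemma K_u2torus k : (om0 ^+ k = -1)%R -> u ^+ 2 = d1 ^+ k * d ^- k.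
Proof.
move=> ok; apply: Gam_eq; [gam|gam|].
by rewrite piX (piM (d1 ^+ k)) (piX d1) piV (piX d) pi_d1 (pi_u LH) (pi_d LH) (U2_torus H ok).
Qed.
Lemma K_torus k : (om0 ^+ k = 1)%R -> d1 ^+ k = d ^+ k.
Proof.
by move=> ok; apply: Gam_eq; [gam|gam|rewrite !piX pi_d1 (pi_d LH) (torus_eq H ok)].
Qed.
Lemma ex_m1 : exists k, (om0 ^+ k = -1)%R.
Proof. by have [|k ->] := om0_log H (_ : -1 != 0)%R; [rewrite oppr_eq0 oner_eq0|exists k]. Qed.
Lemma K_du2 : d1 ^ u = d.
Proof.
have [k ok] := ex_m1; rewrite -conjgM -[u * u]/(u ^+ 2) (K_u2torus ok) conjgM.
have c1 : commute d d1 := fix_conj K_dd1.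
by rewrite (conj_fix (commuteX _ c1)) (conj_fix (commuteV (commuteX _ (commute_refl _)))).
Qed.
Lemma K_zu2 : z1 ^ u = z.
Proof.
apply: Gam_eq; [gam|gam|rewrite -conjgM piJ piM (pi_z LH) (pi_u LH)].
rewrite (z_weyl H) (weylJ sJ tF (eich_ew H _ mgt0) (eichN sJ (eich_fw H _ mgt0))) ?isomM ?(U_isom H) //.
rewrite !actM !(UA H) ?actN ?(UA H) !(U_actw H).
rewrite (weyl_opp H) ?opprK; last 2 first.
- by apply: (eichN sJ); exact: (eich_fw H).
- exact: (eich_ew H).
have := weyl_inv H (eichN sJ (eich_fw H 1%R mgt0)) (eich_ew H 1%R mgt0); rewrite opprK => <-.
by rewrite -(z_weyl H); apply: mulg1_eq; exact: z_sqr H.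
Qed.
Lemma K_su2 : s ^ (u ^+ 2) = s.
Proof.
apply: Gam_eq; [gam|gam|rewrite piJ piX (pi_s LH) (pi_u LH)].
rewrite (s_eichler H) (eichlerJ sJ tF _ eich0e) ?isomX ?(U_isom H) // expg2 !actM.
rewrite !(UA H) ?actN ?(UA H) -!scaleN1r (eichlerZ sJ tF _ (eichZ sJ _ eich0e)) scalerA.
by rewrite mulrNN mulr1 scale1r.
Qed.
Lemma eich1E0 : E (fv 1) (-1 *: fv 0)%R = E (fv 0) (fv 1).
Proof.
rewrite (eichler_swap sJ tF (eich1f _)); last by rewrite !(bformE sJ) bE // !mulr0.
rewrite (eichlerZ sJ tF); last by apply: (eichN sJ); exact: (eich_ff H).
by rewrite scaleN1r opprK.
Qed.
Lemma K_sz1 : s ^ z1 = x0 ^ z.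
Proof.
apply: Gam_eq; [gam|gam|rewrite pi_x0z piJ pi_z1 (pi_s LH) (s_eichler H)].
by rewrite (eichlerJ sJ tF (z1_isom H) eich0e) !(z1A H) eich1E0.
Qed.
Lemma K_s : s = (x0 ^ z) ^ z1.
Proof.
have z1z1 : z1 * z1 = 1 by rewrite -conjMg K_zz conj1g.
by rewrite -K_sz1 -conjgM z1z1 conjg1.
Qed.
Lemma K_u : u = s * x0 * s.
Proof.
apply: Gam_eq; [gam|gam|rewrite (piM (s * x0)) (piM s) pi_x0 (pi_s LH) (pi_u LH)].
have E1 : E (ev 0) (fv 1) = E (fv 1) (-1 *: ev 0)%R.
  by rewrite (eichler_swap sJ tF (eich_ef H mgt0 mgt1 isT)) ?bE // scaleN1r.
by rewrite (Um0 H) (UmE H) /weyl (s_eichler H) E1.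
Qed.
Lemma K_x0z1 : x0 ^ z1 = (x0 ^ z)^-1 * (z * u * z) * (x0 ^ z)^-1.
Proof.
apply: Gam_eq; [gam|gam|].
rewrite piJ pi_z1 pi_x0 (piM (_ * (z * u * z))) (piM _ (z * u * z)) piV pi_x0z (piM (z * u)) (piM z) (pi_z LH) (pi_u LH).
rewrite -(weyl_U_z H) (eichlerJ sJ tF (z1_isom H) (eich1e _)) actZ !(z1A H) /weyl.
rewrite (eichlerN sJ tF (eich1f _)) scaleN1r scaleN1r opprK.
have Ef : E (fv 1) (- fv 0)%R = (E (fv 1) (fv 0))^-1 by rewrite (eichlerN sJ tF) //; exact: (eich_ff H).
by rewrite Ef !mulgA mulgV mul1g mulgVK.
Qed.
Lemma K_fu g b : Gam 2 g -> pi g = E (fv 1) (b *: fv 0)%R -> commute g u.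
Proof.
move=> Kg pg; apply: fix_conj; apply: Gam_eq; [gam|gam|rewrite piJ pg (pi_u LH)].
rewrite (eichlerJ sJ tF (U_isom H) (eich1f _)) actZ !(UA H).
rewrite [RHS](eichler_swap sJ tF (eich1f _)); last by rewrite !(bformE sJ) bE // !mulr0.
rewrite (eichlerZ sJ tF); last by apply: (eichN sJ); exact: (eich_ff H).
rewrite -[(- fv 0)%R]scaleN1r (eichlerZ sJ tF); last by apply: (eichZ sJ); exact: (eich_ff H).
by rewrite scalerN scaleN1r.
Qed.
Lemma K_sd1 k : (om0 ^+ k = -1)%R -> s ^ (d1 ^- k) = s^-1.
Proof.
move=> ok; have E1 : s^-1 ^ (d1 ^+ k) = s; last by rewrite -{1}E1 conjgK.
apply: Gam_eq; [gam|gam|].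
rewrite piJ piV (piX d1) pi_d1 (pi_s LH) (s_eichler H).
rewrite (eichlerN sJ tF eich0e) (eichlerJ sJ tF _ (eichN sJ eich0e)) ?isomX ?(d1_isom H) //.
by rewrite actN !(d1A H) ok invrN invr1 scaleN1r opprK.
Qed.
Lemma K_weyl_torus c k g : (c != 0)%R -> (- c = om0 ^- k)%R -> Gam 2 g ->
  pi g = E (fv 1) (ev 0 + c *: fv 0)%R -> exists g0, X1 g0 /\
  g ^ z1 = g0 * z1 * d1 ^+ k * (z * d ^- (q * k)) * g0.
Proof.
move=> c0 ck Kg pg; have [g0 Xg0 pg0] := X1_lift (- c^-1)%R (-1)%R.
have Kg0 : Gam 2 g0 by case: Xg0.
exists g0; split=> //; apply: Gam_eq; [gam|gam|].
have -> : g0 * z1 * d1 ^+ k * (z * d ^- (q * k)) * g0 = g0 * (z1 * d1 ^+ k * z * d ^- (q * k)) * g0.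
  by rewrite !mulgA.
rewrite piJ pg pi_z1 (piM (_ * _) g0) (piM g0) pg0.
have -> : pi (z1 * d1 ^+ k * z * d ^- (q * k)) = zU n F * dU n emb omega ^+ k * z_gen F n * delta_gen emb omega n ^- (q * k).
  by rewrite (piM (z1 * d1 ^+ k * z)) (piM (z1 * d1 ^+ k)) (piM z1) pi_z1 (piX d1) pi_d1 (pi_z LH) piV (piX d) (pi_d LH).
rewrite -(weyl_torus H c0 ck) /weyl.
have e1 : eich J (fv 1) (ev 0 + c *: fv 0)%R by have := eich1 1%R c; rewrite scale1r.
rewrite (eichlerJ sJ tF (z1_isom H) e1) actD actZ !(z1A H).
have -> : (- c^-1 *: ev 0 + -1 *: fv 0)%R = (- (c^-1 *: (ev 0 + c *: fv 0)))%R.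
  by rewrite scalerDr scalerA mulVf // scale1r opprD scaleNr scaleN1r.
by rewrite -(eichlerN sJ tF (eichZ sJ _ e1)) !mulgA mulVg mul1g mulgK.
Qed.

Local Notation u1 := (uw 1).

(** * Commutation of root groups *)

Lemma pi_td i : pi (t ^ (d ^+ i)) = E (fv 0) (wv (omega ^+ (2 * q * i)))%R.
Proof.
rewrite piJ piX (pi_t LH) (pi_d LH) (t_eichler H).
rewrite (eichlerJ sJ tF _ (eich_fw H _ mgt0)) ?isomX ?(d_isom H) // !(dA H) (dw H).
rewrite (eichlerZ sJ tF _ (eich_fw H _ mgt0)) -(wvZ H) mulr1 rmorphXn (omega0_val H) -!exprM -exprD.
congr (E _ (wv (_ ^+ _))%R); rewrite -mulnDl; congr (_ * _)%N.
by rewrite mul2n -addnn addSnnS prednK ?(q_gt0 H).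
Qed.

(** The conjugates of tau under powers of delta are the E(f_0, wv (y^2)); as
    x = ((x+1)/2)^2 - ((x-1)/2)^2, they generate all E(f_0, wv x). *)
Lemma lift0_in (A : G -> Prop) x : subgrp A -> A t -> nrm A d ->
  exists2 g, A g & pi g = E (fv 0) (wv x).
Proof.
move=> [A1 AM AV] At Ad.
have sq y : exists2 g, A g & pi g = E (fv 0) (wv (y ^+ 2)%R).
  have [->|y0] := eqVneq y 0%R.
    exists 1; first exact: A1.
    by rewrite gmulf1 expr0n /= (wv0 H) (eichler0 sJ tF) // bE.
  have [i yi] := omega_log H y0; exists (t ^ (d ^+ (q * i))); first exact: nrmX.
  rewrite pi_td; congr (E _ (wv _)); rewrite yi.
  have -> : (2 * q * (q * i) = (i * 2) * #|L|)%N by rewrite (set_card_L H); ring.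
  by rewrite exprM expf_card -!exprM.
have T := two_L H.
have [a Aa pa] := sq ((x + 1) / 2)%R; have [b Ab pb] := sq ((x - 1) / 2)%R.
exists (a * b^-1); first exact: AM _ _ Aa (AV _ Ab).
rewrite piM piV pa pb (eichlerN sJ tF (eich_fw H _ mgt0)).
rewrite (eichlerD sJ tF (eich_fw H _ mgt0) (eichN sJ (eich_fw H _ mgt0))) -(wvN H) -(wvD H).
by congr (E _ (wv _)); field.
Qed.
Lemma lift0 x : exists2 g, Gam 1 g & pi g = E (fv 0) (wv x).
Proof. by apply: lift0_in; [exact: gen_subgrp|gam|move=> y Ky; gam]. Qed.

Lemma nrm1_z1 : nrm (Gam 1) z1.
Proof.
apply: gen_nrm_gen => x [->|->|->|[[//]|[//]]].
- by rewrite K_tz1; gam.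
- by rewrite K_dz1; gam.
by rewrite K_zz1; gam.
Qed.
Lemma nrm1_d1 : nrm (Gam 1) d1.
Proof.
apply: gen_nrm_gen => x [->|->|->|[[//]|[//]]].
- have [g Kg pg] := lift0 (omega ^+ q.-1)%R.
  rewrite (_ : t ^ d1 = g) //; apply: Gam_eq; [gam|exact: (Gam_sub (leqnSn 1) Kg)|].
  rewrite pg piJ pi_d1 (pi_t LH) (t_eichler H) (eichlerJ sJ tF (d1_isom H) (eich_fw H _ mgt0)).
  by rewrite -[dU _ _ _]expg1 !(d1A H) (d1w H) expr1 mulr1.
- by rewrite K_dd1; gam.
by rewrite K_zd1; gam.
Qed.

Lemma nrmZ k : (0 < k)%N -> (k < m)%N -> nrm (Gam k) (z ^ (v ^+ k)).
Proof. apply: nrm_Gam; [gam|exact: (rel_sz LH)|exact: nrm1_z1]. Qed.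
Lemma nrmD k : (0 < k)%N -> (k < m)%N -> nrm (Gam k) (d ^ (v ^+ k)).
Proof. apply: nrm_Gam; [gam|exact: (rel_sd LH)|exact: nrm1_d1]. Qed.

Lemma flip_mul (x y : G) : x ^ y = x^-1 -> x * (y * x) = y.
Proof. by move=> Exy; rewrite mulgA (conjgC x y) Exy mulgVK. Qed.

Lemma u1u2u1 : u1 * (u ^+ 2 * u1) = u ^+ 2.
Proof. by apply: flip_mul; have := uw_sign1 0; rewrite uw0. Qed.

Lemma conj_v2 x : Gam 1 x -> x ^ (v ^+ 2) = x ^ (u * u1).
Proof. by move=> Kx; rewrite (conj_vX1 1 Kx) expg1 (conj_v1 Kx) -(conjgM x). Qed.

(** sigma^V and sigma are conjugate, which turns the relations that say that
    sigma is centralised by conjugates of z and delta, and the relation between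
    tau and sigma^V, into commutation with the plane 0. *)
Lemma S1_conj : (s ^ v) ^ (u * u1) = s.
Proof.
rewrite (conj_v Gam_s2) -(conjgM s) -mulgA (mulgA u u) -[u * u]/(u ^+ 2) u1u2u1.
exact: K_su2.
Qed.

Lemma torus_S1 x : torus_part x -> commute x (s ^ v).
Proof.
case=> ->; first exact/commute_sym/(rel_D LH).
  apply: (@commuteJI _ _ _ (u * u1)); rewrite S1_conj -conj_v2; last by gam.
  exact/commute_sym/(rel_sd LH).
apply: (@commuteJI _ _ _ (u * u1)); rewrite S1_conj -conj_v2; last by gam.
exact/commute_sym/(rel_sz LH).
Qed.

Lemma torus_Sj j x : torus_part x -> (0 < j)%N -> (j.+1 < m)%N -> commute x (s ^ (v ^+ j)).
Proof.
move=> Tx; elim: j => [//|[|j] IH] _ hj; first by rewrite expg1; apply: torus_S1.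
rewrite (conj_vX _ Gam_s2); apply: commute_conj; first by apply: IH => //; apply: ltnW.
by apply: commuteM; apply: torus_uw => //; apply: ltnW.
Qed.

Lemma s_Sj j : (1 < j)%N -> (j.+1 < m)%N -> commute s (s ^ (v ^+ j)).
Proof.
elim: j => [//|[//|[|j]] IH] _ hj; first by apply: (rel_C LH); apply: n_gt4 hj.
rewrite (conj_vX _ Gam_s2); apply: commute_conj; first by apply: IH => //; apply: ltnW.
by apply: commuteM; apply: s_uw => //; apply: ltnW.
Qed.

(** For j = 2 this is the commutation of sigma with uw (m-2), conjugated by v^2,
    because uw m = u. *)
Lemma u_Sj j : (1 < j)%N -> (j.+1 < m)%N -> commute u (s ^ (v ^+ j)).
Proof.
elim: j => [//|[//|[|j]] IH] _ hj.
  have m2 : (m - 2 + 2 = m)%N by rewrite subnK // ltnW.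
  have h2 : ((m - 2).+1 < m)%N by rewrite -{2}m2 addn2.
  rewrite -{1}uw_period -{1}m2 uwD; apply/commuteJ/commute_sym/s_uw => //.
  by rewrite ltn_subRL.
rewrite (conj_vX _ Gam_s2); apply: commute_conj; first by apply: IH => //; apply: ltnW.
have c i : (1 < i)%N -> (i.+1 < m)%N -> commute u (uw i) by move=> i1; have := @uw_far 0 i i1; rewrite uw0.
by apply: commuteM; apply: c => //; apply: ltnW.
Qed.

Lemma Gam_Sj j g : (0 < j)%N -> (j.+1 < m)%N -> Gam j g -> commute g (s ^ (v ^+ j)).
Proof.
move=> j0 hj Kg; apply: commute_sym; move: g Kg.
apply: (@gen_sub _ (Gset j) (commute (s ^ (v ^+ j)))); first exact: cent_subgrp.
move=> x; case=> [->|->|->|[[k1 ->]|[i ik ->]]]; apply: commute_sym.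
- by apply: torus_Sj => //; apply: Or31.
- by apply: torus_Sj => //; apply: Or32.
- by apply: torus_Sj => //; apply: Or33.
- exact: s_Sj.
have ij : (i <= j)%N by apply: ltnW (ltnW ik).
rewrite -(subnK ij) expgnDr (conjgM s); apply: commuteJ; apply: u_Sj; first by rewrite ltn_subRL addn1.
by apply: leq_ltn_trans hj; rewrite ltnS leq_subr.
Qed.

(** The transport of X1 to the planes j and j+1. *)
Definition Xs j g := X1 (g ^ (v ^- j)).

Lemma XsI j c : X1 c -> Xs j (c ^ (v ^+ j)).
Proof. by move=> Xc; rewrite /Xs conjgK. Qed.
Lemma XsE j g : Xs j g -> exists2 c, X1 c & g = c ^ (v ^+ j).
Proof. by move=> Xg; exists (g ^ (v ^- j)); rewrite // conjgKV. Qed.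
Lemma Xs0 g : Xs 0 g <-> X1 g.
Proof. by rewrite /Xs expg0 invg1 conjg1. Qed.
Lemma Xs_subgrp j : subgrp (Xs j).
Proof.
have [X1_1 X1M X1V] := X1_subgrp; rewrite /Xs; split=> [|x y Xx Xy|x Xx].
- by rewrite conj1g.
- by rewrite (conjMg x y); apply: X1M.
by rewrite conjVg; apply: X1V.
Qed.
Lemma Xs_ind j (A : G -> Prop) : subgrp A -> A (x0 ^ (v ^+ j)) -> nrm A (z ^ (v ^+ j)) ->
  nrm A (d ^ (v ^+ j)) -> forall g, Xs j g -> A g.
Proof.
case=> A1 AM AV Ax Az Ad g /XsE[c Xc ->]; move: c Xc.
apply: (@X1_ind d (fun h => A (h ^ (v ^+ j)))) => //; first by left.
- split=> [|x y Ax' Ay|x Ax']; first by rewrite conj1g.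
    by rewrite (conjMg x y); apply: AM.
  by rewrite (conjVg x); apply: AV.
- by rewrite (conjJg x0); apply: Az.
by move=> x Ax'; rewrite (conjJg x); apply: Ad.
Qed.

(** Generate Xs j from x0^(v^j), which commutes with Gam j since sigma^(v^j) and
    uw j do, by conjugation with z_j and d_j, which normalise Gam j. *)
Lemma Gam_Xs j g x : (0 < j)%N -> (j.+1 < m)%N -> Gam j g -> Xs j x -> commute g x.
Proof.
move=> j0 hj Kg Xx; move: x Xx g Kg; have hj' := ltnW hj.
pose A x := forall g, Gam j g -> commute g x.
have nA y : torsion y -> nrm (Gam j) y -> nrm A y.
  move=> ty ny x Ax g Kg; rewrite -[g](conjgKV y); apply: commuteJ; apply: Ax.
  exact: nrmV.
apply: (@Xs_ind j A).
- split=> [g _|x y Ax Ay g Kg|x Ax g Kg]; [exact: commute1| |].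
    by apply: commuteM; [exact: Ax|exact: Ay].
  by apply: commuteV; apply: Ax.
- move=> g Kg; rewrite (conjJg s); apply: commute_conj; first exact: Gam_Sj.
  by apply/commute_sym/(Gam_uw_comm _ hj Kg); rewrite j0 leqnn.
- by apply: nA; [apply/torsionJ/Gam_torsion; gam|exact: nrmZ].
by apply: nA; [apply/torsionJ/Gam_torsion; gam|exact: nrmD].
Qed.

Lemma s_su1 : commute s (s ^ u1).
Proof.
have := rel_B1 LH; rewrite (conjgM s v) (conj_v Gam_s2) -(conjgM s) mulgK.
by [].
Qed.
Lemma x0_u1u : x0 ^ (u1 * u) = x0 ^ v.
Proof. by rewrite (conj_v Gam_x0). Qed.
Lemma braid0 : u * u1 * u = u1 * u * u1.
Proof. by have := uw_braidM 0; rewrite uw0. Qed.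
Lemma s_cyc : (s ^ u1) ^ (u * u1) = x0 ^ v.
Proof. by rewrite -(conjgM s) mulgA -braid0 -mulgA (conjgM s) x0_u1u. Qed.
Lemma x0_y : commute (x0 ^ u1) (x0 ^ v).
Proof. by have := commuteJ (u * u1) s_su1; rewrite s_cyc (conjgM s). Qed.

Lemma torus_X1u1 y c : y = z \/ y = d -> X1 c -> commute (y ^ v) (c ^ u1).
Proof.
move=> yzd Xc; have Ky : Gam 1 y by case: yzd => ->; gam.
have yu2 : (y ^ u) ^ u = y by case: yzd => ->; [exact: K_zu2|exact: K_du2].
have := Gam_Xs (ltn0Sn 0) (m_ge3 H) Ky (XsI 1 Xc).
have Kc : Gam 2 c by case: Xc.
rewrite expg1 (conj_v Kc) (conjgM c) => /(commuteJ u^-1); rewrite conjgK.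
by rewrite -{1}yu2 conjgK (conj_v1 Ky).
Qed.

(** Both X1^(uw 1) and Xs 1 lift E(f_2,_). The commutation of x0^(uw 1) with x0^v
    is a conjugate of the relation [sigma, sigma^(V U^-1)] = 1; conjugation by
    z and delta and by their copies on the plane 1 gives the rest. *)
Lemma X1_shift_comm c b : X1 c -> Xs 1 b -> commute (c ^ u1) b.
Proof.
move=> Xc /XsE[b' Xb ->]; rewrite expg1.
have zy : commute z (x0 ^ v) by rewrite -[v]expg1; apply: (Gam_Xs (ltn0Sn 0) (m_ge3 H)); [gam|apply/XsI/X1_x0].
have dy : commute d (x0 ^ v) by rewrite -[v]expg1; apply: (Gam_Xs (ltn0Sn 0) (m_ge3 H)); [gam|apply/XsI/X1_x0].
have zu1 : commute z u1 by apply: torus_uw => //; apply: Or33.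
have du1 : commute d u1 by apply: torus_uw => //; apply: Or32.
have c1 : forall a, X1 a -> commute (a ^ u1) (x0 ^ v).
  apply: (@X1_ind d (fun a => commute (a ^ u1) (x0 ^ v))) => //; first by left.
  - split=> [|x y Ax Ay|x Ax]; first by rewrite conj1g; apply/commute_sym/commute1.
      by rewrite (conjMg x y); apply/commute_sym/commuteM; apply: commute_sym.
    by rewrite (conjVg x); apply/commute_sym/commuteV/commute_sym.
  - exact: x0_y.
  - by rewrite (conjJg x0) (conj_fix zu1); apply/commute_sym/commute_conj; apply: commute_sym => //; exact: x0_y.
  by move=> x Ax; rewrite (conjJg x) (conj_fix du1); apply/commute_sym/commute_conj; apply: commute_sym.
move: b' Xb; apply: (@X1_ind d (fun b => commute (c ^ u1) (b ^ v))) => //; first by left.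
- split=> [|x y Ax Ay|x Ax]; first by rewrite conj1g; apply: commute1.
    by rewrite (conjMg x y); apply: commuteM.
  by rewrite (conjVg x); apply: commuteV.
- exact: c1.
- rewrite (conjJg x0); apply: commute_conj; first exact: c1.
  by apply/commute_sym/torus_X1u1 => //; left.
move=> x Ax; rewrite (conjJg x); apply: commute_conj => //.
by apply/commute_sym/torus_X1u1 => //; right.
Qed.

(** u^2 is a quotient of torus elements with entry -1 on the planes 0 and 1, so
    that u1^2 is one for the planes 1 and 2. The torus element of the plane 2
    centralises sigma, and that of the plane 1 inverts it. *)
Lemma s_u1sq : s ^ (u1 ^+ 2) = s^-1.
Proof.
have [k ok] := ex_m1.
have -> : u1 ^+ 2 = (d ^ (v ^+ 2)) ^+ k * d1 ^- k.
  have Kd : Gam 1 d by gam.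
  rewrite /uw expg1 -conjXg (K_u2torus ok) (conjMg (d1 ^+ k)) (conjVg (d ^+ k)) !conjXg.
  by rewrite -(conj_v1 Kd) -(conjgM d).
rewrite (conjgM s) (conj_fix (commuteX _ (rel_sd LH))); exact: (K_sd1 ok).
Qed.
Lemma x0_u1sq : x0 ^ (u1 ^+ 2) = x0^-1.
Proof.
have E0 : u ^ (u1 ^+ 2) = u^-1 by have := uw_sign0 0; rewrite uw0.
rewrite (conjJg s) s_u1sq E0 (conjVg s); congr (_^-1).
by rewrite -{1}K_su2 -(conjgM s) expg2 mulgK.
Qed.
Lemma nrm_X1_u1sq : nrm X1 (u1 ^+ 2).
Proof.
have [X1_1 X1M X1V] := X1_subgrp.
have c y : commute y u1 -> commute y (u1 ^+ 2) by exact: commuteX.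
have zu1 : commute z (u1 ^+ 2) by apply: c; apply: torus_uw => //; apply: Or33.
have du1 : commute d (u1 ^+ 2) by apply: c; apply: torus_uw => //; apply: Or32.
apply: (@X1_ind d (fun a => X1 (a ^ (u1 ^+ 2)))) => //; first by left.
- split=> [|x y Ax Ay|x Ax]; first by rewrite conj1g.
    by rewrite (conjMg x y); apply: X1M.
  by rewrite (conjVg x); apply: X1V.
- by rewrite x0_u1sq; apply/X1V/X1_x0.
- by rewrite (conjJg x0) (conj_fix zu1) x0_u1sq (conjVg x0); apply/X1V/X1_x0z.
by move=> x Ax; rewrite (conjJg x) (conj_fix du1); apply: nrm_X1_d.
Qed.

(** Exchanging the planes 0 and 1 turns E(f_2, e_1) into E(f_2, e_0). In G, an
    element of Xs 1 is a^(u1 u) with a in X1, and u1 u^2 = u^2 u1^-1, where u^2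
    and u1^2 normalise X1. *)
Lemma X1_u b : Xs 1 b -> exists2 c, X1 c & b ^ u = c ^ u1.
Proof.
case/XsE=> a Xa ->; rewrite expg1; have Ka : Gam 2 a by case: Xa.
exists ((a ^ (u ^+ 2)) ^ ((u1 ^+ 2)^-1)).
  apply: nrmV; [|exact: nrm_X1_u1sq|exact: nrm_X1_u2].
  have [k k0 uk] := uw_torsion 1; exists k => //.
  by rewrite -expgnA mulnC expgnA uk expg1n.
have sg : u1 ^ (u ^+ 2) = u1^-1 by have := uw_sign1 0; rewrite uw0.
rewrite (conj_v Ka) -!(conjgM a); congr (a ^ _).
have e2 : (u1 ^+ 2)^-1 * u1 = u1^-1 by rewrite expg2 invgM mulgVK.
by rewrite -(mulgA u1 u u) -[u * u]/(u ^+ 2) (conjgC u1) sg -e2 mulgA.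
Qed.

Lemma Xs_shift_comm j c b : Xs j c -> Xs j.+1 b -> commute (c ^ uw j.+1) b.
Proof.
move=> /XsE[a Xa ->] Xb; have -> : b = (b ^ v ^- j) ^ (v ^+ j) by rewrite conjgKV.
rewrite -[j.+1]add1n uwD -(conjJg a); apply: commuteJ; apply: X1_shift_comm => //.
by move: Xb; rewrite /Xs -(conjgM b) expgS invgM.
Qed.
Lemma Xs_uw j b : Xs j.+1 b -> exists2 c, Xs j c & b ^ uw j = c ^ uw j.+1.
Proof.
move=> Xb; have [|c Xc Ec] := @X1_u (b ^ v ^- j).
  by move: Xb; rewrite /Xs -(conjgM b) expgS invgM.
exists (c ^ (v ^+ j)); first exact: XsI.
have E1 : uw j.+1 = u1 ^ (v ^+ j) by rewrite -add1n uwD.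
by rewrite E1 -(conjJg c) -Ec (conjJg (b ^ v ^- j)) conjgKV.
Qed.
Lemma Xs_next j a : Xs j a -> Xs j.+1 (a ^ (uw j.+1 * uw j)).
Proof.
move=> /XsE[c Xc ->]; have Kc : Gam 2 c by case: Xc.
by rewrite -(conj_vX _ Kc); apply: XsI.
Qed.
Lemma Xs_next_inv j b : Xs j.+1 b -> exists2 a, Xs j a & b = a ^ (uw j.+1 * uw j).
Proof.
move=> /XsE[c Xc ->]; have Kc : Gam 2 c by case: Xc.
by exists (c ^ (v ^+ j)); [exact: XsI|exact: conj_vX].
Qed.

(** * The abelian normal subgroups Q_k *)

Lemma Gam_fix k g i : (0 < k)%N -> Gam k g -> (k <= i)%N -> (i < m)%N ->
  (ev i *v pi g = ev i /\ fv i *v pi g = fv i)%R.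
Proof.
move=> k0 Kg ki hi; move: g Kg.
apply: (@gen_sub _ _ (fun g => (ev i *v pi g = ev i /\ fv i *v pi g = fv i)%R)).
  split=> [|x y [ex fx] [ey fy]|x [ex fx]]; first by rewrite gmulf1 !act1.
    by rewrite piM !actM ex fx.
  by rewrite piV; split; apply: act_inv.
have i0 : i == 0%N = false by rewrite gtn_eqF // (leq_trans k0).
move=> x [->|->|->|[[k1 ->]|[j jk ->]]].
- by rewrite (pi_t LH); have [-> ->] := tau_act H hi; rewrite i0.
- by rewrite (pi_d LH); have [-> ->] := delta_act H hi; rewrite i0.
- by rewrite (pi_z LH); have [-> ->] := z_act H hi; rewrite i0.
- rewrite (pi_s LH); have [-> ->] := sigma_act H hi.
  by rewrite i0 gtn_eqF // (leq_trans k1).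
have hj : (j.+1 < m)%N by apply: ltn_trans hi; apply: leq_trans ki.
have ji : (j.+1 < i)%N by apply: leq_trans ki.
rewrite pi_uw //; have [-> ->] := Um_act H hj hi.
by rewrite !gtn_eqF // ltnW.
Qed.

Lemma Gam_v2X j c : Gam 2 c -> Gam j.+2 (c ^ (v ^+ j)).
Proof.
move=> Kc; elim: j => [|j IH]; first by rewrite expg0 conjg1.
rewrite (conj_vX _ Kc); apply: GamJ; first exact: (Gam_sub _ IH).
by apply: GamM; apply: Gam_uw.
Qed.
Lemma Gam_of_Xs j b : Xs j b -> Gam j.+2 b.
Proof. by case/XsE=> c [Kc _] ->; apply: Gam_v2X. Qed.

Lemma pi_X1J j c x y : (j.+1 < m)%N -> pi c = E (fv 1) (x *: ev 0 + y *: fv 0)%R ->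
  pi (c ^ (v ^+ j)) = E (fv j.+1) (x *: ev j + y *: fv j)%R.
Proof.
move=> hj pc; have [e0 f0] := VX_act H (ltnW hj); have [_ f1] := VX_act H hj.
have f1' : (fv 1 *v (V_gen F n ^+ j)%g = fv j.+1)%R.
  by rewrite -f1 expgS actM (V_step H mgt1).
rewrite piJ pc piX (pi_v LH).
apply: etrans (eichlerJ sJ tF (isomX _ (V_isom H)) (eich1 x y)) _.
by rewrite !actL e0 f0 f1'.
Qed.
Lemma pi_Xs j b : (j.+1 < m)%N -> Xs j b ->
  exists x y, pi b = E (fv j.+1) (x *: ev j + y *: fv j)%R.
Proof. by move=> hj /XsE[c [Kc [x [y pc]]] ->]; exists x, y; apply: pi_X1J. Qed.
Lemma Xs_lift j x y : (j.+1 < m)%N -> exists2 b, Xs j b & pi b = E (fv j.+1) (x *: ev j + y *: fv j)%R.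
Proof.
move=> hj; have [c Xc pc] := X1_lift x y.
by exists (c ^ (v ^+ j)); [exact: XsI|exact: pi_X1J].
Qed.

(** The lifts of E(f_k, v), v in the span of W and the first k planes: those of
    E(f_(k-1),_) moved one plane up by uw (k-1), times the root group of the
    plane k-1. *)
Fixpoint Qs k g := if k is k'.+1 then exists a b, [/\ Qs k' a, Xs k' b & g = a ^ uw k' * b]
  else Gam 1 g /\ exists x, pi g = E (fv 0) (wv x).

Lemma Qs_Gam k g : Qs k g -> Gam k.+1 g.
Proof.
elim: k g => [|k IH] g; first by case.
case=> a [b [Qa Xb ->]]; apply: GamM; last exact: Gam_of_Xs.
by apply: GamJ; [apply: (Gam_sub _ (IH _ Qa))|apply: Gam_uw].
Qed.

(** The two factors of Q_(k+1) commute. For k = 0 this takes place in Gam 2; the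
    step is the braid relation between uw k and uw (k+1), which reduces a
    conjugate of Q_k against Xs (k+1) to the previous case, together with the
    commutation of neighbouring root groups. *)
Lemma Qs_Xs k a b : (k.+1 < m)%N -> Qs k a -> Xs k b -> commute (a ^ uw k) b.
Proof.
elim: k a b => [|k IH] a b hk.
  move=> [Ka [x pa]] /Xs0[Kb [y [y' pb]]]; rewrite uw0.
  have K2 := Gam_sub (leqnSn 1) Ka.
  have [Kau pau] : Gam 2 (a ^ u) /\ pi (a ^ u) = E (fv 1) (wv x).
    split; first by gam.
    rewrite piJ pa (pi_u LH); apply: etrans (eichlerJ sJ tF (U_isom H) (eich_fw H x mgt0)) _.
    have [[[_ f0] _] _] := UA H; rewrite f0; congr (E _ _); exact: (U_actw H).
  move: (a ^ u) Kau pau => a' Ka' pa'.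
  apply: Gam_eq; [gam|gam|rewrite !piM pa' pb].
  have e1 := eich1 y y'; have e2 := eich_fw H x mgt1.
  apply: etrans (eichlerD sJ tF e2 e1) _; rewrite addrC.
  exact: esym (eichlerD sJ tF e1 e2).
case=> a' [b' [Qa' Xb' ->]] Xb; rewrite (conjMg (a' ^ uw k)).
apply/commute_sym/commuteM; apply: commute_sym; last exact: Xs_shift_comm.
have [b0 Xb0 ->] := Xs_next_inv Xb.
have ca : commute (uw k.+1) a' by apply: (Gam_uw_comm _ hk (Qs_Gam Qa')); rewrite leqnn.
have braid := uw_braidM k.
move: (uw k.+1) (uw k) ca braid (IH _ _ (ltnW hk) Qa' Xb0) => y x ca braid c.
have -> : (a' ^ x) ^ y = ((a' ^ x) ^ y) ^ x.
  rewrite -(conjgM a') -(conjgM a' (x * y)) braid (conjgM a' (y * x)) (conjgM a' y).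
  by rewrite (conj_fix (commute_sym ca)) -(conjgM a').
by rewrite (conjgM b0); apply: commuteJ; apply: commuteJ.
Qed.

Lemma Qs_1 k : Qs k 1.
Proof.
elim: k => [|k IH] /=.
  split; first exact: Gam1.
  by exists 0%R; rewrite gmulf1 (wv0 H) (eichler0 sJ tF) // bE.
by exists 1, 1; rewrite conj1g mulg1; split=> //; case: (Xs_subgrp k).
Qed.
Lemma Qs_subgrp k : (k < m)%N -> subgrp (Qs k).
Proof.
elim: k => [|k IH] hk; split; try exact: Qs_1.
- move=> x y [Kx [a px]] [Ky [b py]]; split; first by gam.
  exists (a + b)%R; rewrite piM px py (eichlerD sJ tF) ?(wvD H) //; exact: (eich_fw H).
- move=> x [Kx [a px]]; split; first by gam.
  exists (- a)%R; rewrite piV px (eichlerN sJ tF) ?(wvN H) //; exact: (eich_fw H).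
- have [_ QM _] := IH (ltnW hk); have [_ XM _] := Xs_subgrp k.
  move=> _ _ [a [b [Qa Xb ->]]] [a' [b' [Qa' Xb' ->]]]; exists (a * a'), (b * b').
  split; [exact: QM _ _ Qa Qa'|exact: XM _ _ Xb Xb'|]; have c := Qs_Xs hk Qa' Xb.
  rewrite (conjMg a); move: (a ^ uw k) (a' ^ uw k) c => x y c.
  by rewrite -(mulgA x) (mulgA b) -c -!mulgA.
have [_ _ QV] := IH (ltnW hk); have [_ _ XV'] := Xs_subgrp k.
move=> _ [a [b [Qa Xb ->]]]; exists a^-1, b^-1; split; [exact: QV|exact: XV'|].
have c := Qs_Xs hk Qa Xb; rewrite (conjVg a) invgM.
exact: commuteV (commute_sym (commuteV c)).
Qed.
Lemma Xs_Qs k b : Xs k b -> Qs k.+1 b.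
Proof. by move=> Xb; exists 1, b; rewrite conj1g mul1g; split=> //; apply: Qs_1. Qed.
Lemma QsJ k a : Qs k a -> Qs k.+1 (a ^ uw k).
Proof. by move=> Qa; exists a, 1; rewrite mulg1; split=> //; case: (Xs_subgrp k). Qed.


Lemma pi_uwJ k a x : (k.+1 < m)%N -> inV k x -> pi a = E (fv k) x ->
  pi (a ^ uw k) = E (fv k.+1) x.
Proof.
move=> hk Vx pa; rewrite piJ pa pi_uw //.
apply: etrans (eichlerJ sJ tF (Um_isom H hk) (eichV H (ltnW hk) Vx)) _.
by rewrite (Um_fix H hk Vx); have [_ ->] := Um_act H hk (ltnW hk); rewrite eqxx.
Qed.

Lemma pi_Qs k g : (k < m)%N -> Qs k g -> exists2 x, inV k x & pi g = E (fv k) x.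
Proof.
elim: k g => [|k IH] g hk.
  by case=> _ [x ->]; exists (wv x) => //; apply: (inV_wv H).
case=> a [b [Qa Xb ->]]; have [x Vx pa] := IH _ (ltnW hk) Qa.
have [y [y' pb]] := pi_Xs hk Xb; have [Ve Vf] := inV_e H (ltnSn k) (ltnW hk).
have Vy : inV k.+1 (y *: ev k + y' *: fv k)%R by apply: (inVD H); apply: (inVZ H).
have Vx' := inV_sub H (leqnSn k) Vx.
exists (x + (y *: ev k + y' *: fv k))%R; first exact: (inVD H).
rewrite piM pb (pi_uwJ hk Vx pa).
exact: (eichlerD sJ tF (eichV H hk Vx') (eichV H hk Vy)).
Qed.

Lemma E_V_inj k x : (k < m)%N -> inV k x -> E (fv k) x = 1 -> x = 0%R.
Proof.
move=> hk Vx E1; have [e0 f0] := Vx k (leqnn k) hk.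
have ef : B (ev k) (fv k) = 1%R by rewrite bE // eqxx.
have xE := eichler_eq1 sJ tF ef (eichV H hk Vx) e0 E1.
by move: e0; rewrite xE (bformZr sJ) ef mulr1 => ->; rewrite scale0r.
Qed.

(** pi is faithful on Q_k, since E(f_k, v) determines v and the factors of an
    element of Q_k are determined by the components of v. *)
Lemma Qs_inj k g : (k < m)%N -> Qs k g -> pi g = 1 -> g = 1.
Proof.
elim: k g => [|k IH] g hk.
  by case=> Kg _; apply: (faithful_K LH); apply: (Gam_sub _ Kg).
case=> a [b [Qa Xb ->]] p1; have [x Vx pa] := pi_Qs (ltnW hk) Qa.
have [y [y' pb]] := pi_Xs hk Xb; have [Ve Vf] := inV_e H (ltnSn k) (ltnW hk).
have Vy : inV k.+1 (y *: ev k + y' *: fv k)%R by apply: (inVD H); apply: (inVZ H).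
have Vx' := inV_sub H (leqnSn k) Vx.
move: p1; rewrite piM (pi_uwJ hk Vx pa) pb (eichlerD sJ tF (eichV H hk Vx') (eichV H hk Vy)).
move/(E_V_inj hk (inVD H Vx' Vy)) => x0'.
have [ex fx] := Vx k (leqnn k) (ltnW hk).
have y0 : y = 0%R.
  have := congr1 (B (fv k)) x0'; rewrite !(bformDr sJ) !(bformZr sJ) fx !bE ?(ltnW hk) // eqxx.
  by rewrite (bform0r sJ) mulr1 mulr0 add0r addr0.
have y'0 : y' = 0%R.
  have := congr1 (B (ev k)) x0'; rewrite !(bformDr sJ) !(bformZr sJ) ex !bE ?(ltnW hk) // eqxx.
  by rewrite (bform0r sJ) mulr1 mulr0 !add0r.
have xz : x = 0%R by move: x0'; rewrite y0 y'0 !scale0r !addr0.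
have a1 : a = 1.
  by apply: IH (ltnW hk) Qa _; rewrite pa xz (eichler0 sJ tF) // bE ?(ltnW hk).
have b1 : b = 1.
  have [c [Kc _] bc] := XsE Xb; rewrite bc; suff -> : c = 1 by rewrite conj1g.
  have pb1 : pi b = 1 by rewrite pb y0 y'0 !scale0r addr0 (eichler0 sJ tF) // bE.
  apply: (faithful_K LH) => //; move: pb1; rewrite bc (piJ c) => /(canRL (conjgK _)).
  by rewrite conj1g.
by rewrite a1 b1 conj1g mulg1.
Qed.

Lemma Qs_eq k x y : (k < m)%N -> Qs k x -> Qs k y -> pi x = pi y -> x = y.
Proof.
move=> hk Qx Qy pxy; have [_ QM QV] := Qs_subgrp hk; apply: divg1_eq; apply: Qs_inj hk _ _.
  exact: (QM _ _ Qx (QV _ Qy)).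
by rewrite piM piV pxy mulgV.
Qed.

Lemma Qs_lift k x : (k < m)%N -> inV k x -> exists2 g, Qs k g & pi g = E (fv k) x.
Proof.
elim: k x => [|k IH] x hk Vx.
  have [y xy] := inV0 H Vx; have [g Kg pg] := lift0 y; exists g; last by rewrite xy.
  by split=> //; exists y.
have [r Vr xE] := inV_dec H (ltnW hk) Vx; move: (B (fv k) x) (B (ev k) x) xE => y y' xE.
have [a Qa pa] := IH _ (ltnW hk) Vr; have [b Xb pb] := Xs_lift y y' hk.
exists (a ^ uw k * b); first by exists a, b.
have [Ve Vf] := inV_e H (ltnSn k) (ltnW hk).
have Vy : inV k.+1 (y *: ev k + y' *: fv k)%R by apply: (inVD H); apply: (inVZ H).
have Vr' := inV_sub H (leqnSn k) Vr.
rewrite piM pb (pi_uwJ hk Vr pa) xE.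
exact: (eichlerD sJ tF (eichV H hk Vr') (eichV H hk Vy)).
Qed.

Lemma conj_dv y : Gam 1 y -> (y ^ u) ^ v = y ^ (v ^+ 2).
Proof. by move=> Ky; rewrite -(conj_v1 Ky) -(conjgM y). Qed.

(** * The group Gam k normalises Q_k *)

Lemma nrmQ_d k : (k < m)%N -> nrm (Qs k) (d ^ (v ^+ k)).
Proof.
elim: k => [|k IH] hk.
  rewrite expg0 conjg1 => g [Kg [x pg]]; split; first by gam.
  exists (emb om0 * (omega ^+ q.-1 * x))%R; rewrite piJ pg (pi_d LH) -[delta_gen _ _ _]expg1.
  apply: etrans (eichlerJ sJ tF (isomX _ (d_isom H)) (eich_fw H x mgt0)) _.
  have [[[_ f0] _] _] := dA H 1; rewrite f0 expr1 (dw H) expr1 (wvZ H).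
  exact: (eichlerZ sJ tF _ (eich_fw H _ mgt0)).
move=> _ [a [b [Qa /XsE[c Xc ->] ->]]]; have Kd : Gam 1 d by gam.
exists (a ^ (d ^ (v ^+ k))), ((c ^ d1) ^ (v ^+ k)); split; [exact: (IH (ltnW hk))|by apply/XsI/nrm_X1_d1|].
rewrite (conjMg (a ^ uw k)) {1}(conj_vX1 _ Kd) -(conjJg a); congr (_ * _).
by rewrite expgS (conjgM d v) (conj_v1 Kd) -(conjJg c).
Qed.

Lemma nrm_Q1 g : Gam 1 g -> nrm (Qs 1) g.
Proof.
move=> Kg a Qa; have [x Vx pa] := pi_Qs mgt1 Qa.
have Og := gen_isom Kg.
have fix_g i : (1 <= i)%N -> (i < m)%N -> (ev i *v pi g = ev i /\ fv i *v pi g = fv i)%R.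
  by apply: (Gam_fix (ltn0Sn 0) Kg).
have [b Qb pb] := Qs_lift mgt1 (inV_act H Og fix_g Vx).
rewrite (_ : a ^ g = b) //; apply: Gam_eq.
- by apply: GamJ; [exact: (Qs_Gam Qa)|exact: (Gam_sub (leqnSn 1) Kg)].
- exact: (Qs_Gam Qb).
rewrite pb piJ pa; apply: etrans (eichlerJ sJ tF Og (eichV H mgt1 Vx)) _.
by have [_ ->] := fix_g 1%N isT mgt1.
Qed.

Lemma D2E y : Gam 1 y -> (y ^ u) ^ u1 = y ^ (v ^+ 2).
Proof. by move=> Ky; rewrite (conj_v2 Ky) -(conjgM y). Qed.

(** This lemma and the next three give the action of sigma on generators of Q_2.
    Two of them are the relation [sigma, sigma^V] = sigma^(V U^-1) and its
    conjugate by z_2, and two come from relations that make sigma commute with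
    conjugates of itself. *)
Lemma x0u1_s : (x0 ^ u1) ^ s = x0 ^ u1 * x0 ^ v.
Proof.
have := congr1 (fun x => x ^ (u * u1)) (rel_A LH).
rewrite conjRg S1_conj {1}(conjgM s) => A.
have E1 : (s ^ (v * u^-1)) ^ (u * u1) = x0 ^ v.
  rewrite (conjgM s v) (conj_v Gam_s2) -(conjgM s) mulgK -s_cyc.
  by [].
by move: A; rewrite E1 => <-; rewrite commgEl mulKVg.
Qed.
Lemma x0zu1_s : commute s ((x0 ^ z) ^ u1).
Proof.
have := commuteJ (z ^ (v ^+ 2)) s_su1; rewrite (conj_fix (rel_sz LH)).
have Kz : Gam 1 z by gam.
by rewrite -(D2E Kz) -(conjJg s) K_sz1.
Qed.
Lemma x0v_s : commute s (x0 ^ v).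
Proof.
have := commuteJ (u ^+ 2) (rel_B2 LH); rewrite K_su2 (conjgM u v) (_ : u ^ v = u1); last by rewrite /uw expg1.
have -> : (s ^ (u1 ^ u^-1)) ^ (u ^+ 2) = x0 ^ v.
  rewrite -(conjgM s) (_ : u1 ^ u^-1 * u ^+ 2 = u * u1 * u); last first.
    by rewrite conjgE invgK expg2 !mulgA mulgVK.
  by rewrite -(mulgA u u1) (conjgM s u) x0_u1u.
by [].
Qed.
Lemma x0zv_s : ((x0 ^ z) ^ v) ^ s = (x0 ^ z) ^ v * ((x0 ^ z) ^ u1)^-1.
Proof.
have Kz : Gam 1 z by gam.
have := congr1 (fun x => x ^ (z ^ (v ^+ 2))) (rel_A LH).
rewrite conjRg (conj_fix (rel_sz LH)) -{1}(conj_dv Kz) -(conjJg s) K_sz1.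
rewrite (conjgM s v) (conj_v Gam_s2) -(conjgM s) mulgK.
rewrite -(D2E Kz) -(conjJg s) K_sz1.
by move: ((x0 ^ z) ^ v) ((x0 ^ z) ^ u1) => x y <-; rewrite commgEr invgM (conjVg x) invgK mulKVg.
Qed.

Lemma nrm_Q2_s : nrm (Qs 2) s.
Proof.
have [Q1 QM QV] := Qs_subgrp mgt2.
have D2s : commute s (d ^ (v ^+ 2)) := rel_sd LH.
have nd := nrmQ_d mgt2; have Kd : Gam 1 d by gam.
have yd : d1 = d \/ d1 = d1 by right.
have QX1 c : X1 c -> Qs 2 (c ^ u1).
  by move=> Xc; apply: QsJ; apply: Xs_Qs; apply/Xs0.
have QX2 c : X1 c -> Qs 2 (c ^ v).
  by move=> Xc; apply: Xs_Qs; rewrite -[v]expg1; apply: XsI.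
have c1 c : X1 c -> Qs 2 ((c ^ u1) ^ s).
  move: c; apply: (X1_ind yd (A := fun c => Qs 2 ((c ^ u1) ^ s))).
  - split=> [|x y Ax Ay|x Ax]; first by rewrite !conj1g.
      by rewrite !(conjMg x y) conjMg; apply: QM.
    by rewrite (conjVg x) conjVg; apply: QV.
  - by rewrite x0u1_s; apply: QM; [apply/QX1/X1_x0|apply/QX2/X1_x0].
  - by rewrite (conj_fix (commute_sym x0zu1_s)); apply/QX1/X1_x0z.
  by move=> x Ax; rewrite (conjJg x) (D2E Kd) (conjJg (x ^ u1)) (conj_fix (commute_sym D2s)); apply: nd.
have c2 c : X1 c -> Qs 2 ((c ^ v) ^ s).
  move: c; apply: (X1_ind yd (A := fun c => Qs 2 ((c ^ v) ^ s))).
  - split=> [|x y Ax Ay|x Ax]; first by rewrite !conj1g.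
      by rewrite !(conjMg x y) conjMg; apply: QM.
    by rewrite (conjVg x) conjVg; apply: QV.
  - by rewrite (conj_fix (commute_sym x0v_s)); apply/QX2/X1_x0.
  - by rewrite x0zv_s; apply: QM; [apply/QX2/X1_x0z|apply/QV/QX1/X1_x0z].
  by move=> x Ax; rewrite (conjJg x) (conj_dv Kd) (conjJg (x ^ v)) (conj_fix (commute_sym D2s)); apply: nd.
move=> _ [a [b [[a0 [b' [[Ka0 pa0] Xb' ->]]] /XsE[c Xc ->] ->]]].
rewrite (conjMg (_ ^ u1)) (conjMg (a0 ^ _)) (conjMg ((a0 ^ _) ^ _)) expg1.
apply: (QM); last exact: c2.
apply: QM; last by apply/c1/Xs0.
have cs : commute a0 (s ^ v).
  apply/commute_sym; move: a0 Ka0 {pa0}; apply: (@gen_sub _ _ (commute (s ^ v))); first exact: cent_subgrp.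
  move=> x [->|->|->|[[//]|[//]]]; apply/commute_sym/torus_S1.
  - exact: Or31.
  - exact: Or32.
  exact: Or33.
rewrite uw0 -(conjgM a0).
have cs2 := commuteJ (u * u1) cs; rewrite S1_conj in cs2.
rewrite (conj_fix cs2) (conjgM a0); apply: (QsJ (k := 1)).
have Q0 : Qs 0 a0 by [].
by have := QsJ Q0; rewrite uw0.
Qed.

(** Induct on k. The old generators, those of Gam (k-1), commute with uw (k-1)
    and with Xs (k-1), and so act on the first factor only. The new generator
    exchanges the planes k-2 and k-1: it permutes the three root groups
    involved. When k = 2 there is one more new generator, sigma. *)
Lemma Gam_nrm_Qs k g : (0 < k)%N -> (k < m)%N -> Gam k g -> nrm (Qs k) g.
Proof.
move=> k0; elim: k k0 g => [//|[|k] IH] _ g hk Kg; first exact: nrm_Q1.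
have hk' := ltnW hk; have [Q1 QM QV] := Qs_subgrp hk.
have tor x : Gset k.+2 x -> torsion x.
  case=> [->|->|->|[[_ ->]|[i _ ->]]]; last exact: uw_torsion.
  - by apply: Gam_torsion; gam.
  - by apply: Gam_torsion; gam.
  - by apply: Gam_torsion; gam.
  by apply: Gam_torsion; gam.
have old x : Gam k.+1 x -> nrm (Qs k.+2) x.
  move=> Kx _ [a [b [Qa Xb ->]]]; have cu : commute (uw k.+1) x.
    by apply: (Gam_uw_comm _ hk Kx); rewrite leqnn.
  exists (a ^ x), b; split=> //; first exact: (IH isT x hk' Kx).
  rewrite (conjMg (a ^ uw k.+1)) (conjJg a) (conj_fix cu) (conj_fix (_ : commute b x)) //.
  exact/commute_sym/(Gam_Xs _ hk Kx).
have new : nrm (Qs k.+2) (uw k).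
  move=> _ [a [b [[a' [b' [Qa' Xb' ->]]] Xb ->]]].
  have [c Xc Ec] := Xs_uw Xb.
  rewrite (conjMg (_ ^ uw k.+1)) (conjMg (a' ^ uw k)) (conjMg ((a' ^ uw k) ^ _)) Ec.
  have ca : commute a' (uw k.+1).
    by apply/commute_sym/(Gam_uw_comm _ hk (Qs_Gam Qa')); rewrite leqnn.
  have -> : ((a' ^ uw k) ^ uw k.+1) ^ uw k = (a' ^ uw k) ^ uw k.+1.
    rewrite -(conjgM a') -(conjgM a' (_ * _)) uw_braidM (conjgM a' (_ * _)) (conjgM a').
    by rewrite (conj_fix ca) -(conjgM a').
  have Xb'' := Xs_next Xb'; rewrite -(conjgM b').
  exists (a' ^ uw k * c), (b' ^ (uw k.+1 * uw k)); split=> //; first by exists a', c.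
  have cc := Xs_shift_comm Xc Xb''; rewrite (conjMg (a' ^ uw k)).
  move: (c ^ uw k.+1) (b' ^ _) ((a' ^ _) ^ _) cc => x y w cc.
  by rewrite -(mulgA w y) -(mulgA w x) cc.
move: g Kg; apply: gen_nrm; first exact: (Qs_subgrp hk).
move=> y Sy; split; last exact: tor.
case: Sy => [->|->|->|[[_ ->]|[i]]].
- by apply: old; apply: Gam_t.
- by apply: old; apply: Gam_d.
- by apply: old; apply: Gam_z.
- case: k {IH tor new hk hk' Q1 QM QV} old => [|k] old; last by apply: old; apply: Gam_s.
  exact: nrm_Q2_s.
rewrite ltnS leq_eqVlt => /orP[/eqP[->] -> //|ik ->].
by apply: old; apply: Gam_uw.
Qed.

(** * The step from Gam k to Gam (k+1) *)

Local Notation zk k := (z ^ (v ^+ k)).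
Local Notation dk k := (d ^ (v ^+ k)).

Lemma Gam_zk i : Gam i.+1 (zk i). Proof. by apply: Gam_vX; gam. Qed.
Lemma Gam_dk i : Gam i.+1 (dk i). Proof. by apply: Gam_vX; gam. Qed.
Lemma zkS i : zk i.+1 = zk i ^ uw i. Proof. by apply: conj_vX1; gam. Qed.
Lemma dkS i : dk i.+1 = dk i ^ uw i. Proof. by apply: conj_vX1; gam. Qed.
Lemma z1S i : z1 ^ (v ^+ i) = zk i.+1. Proof. by rewrite zkS (conjJg z). Qed.
Lemma d1S i : d1 ^ (v ^+ i) = dk i.+1. Proof. by rewrite dkS (conjJg d). Qed.

Lemma pi_zk i : (i < m)%N -> (ev i *v pi (zk i) = fv i /\ fv i *v pi (zk i) = ev i)%R.
Proof.
move=> hi; have [e0 f0] := VX_act H hi; rewrite piJ piX (pi_v LH) (pi_z LH).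
move: (V_gen F n ^+ i) e0 f0 => W e0 f0; rewrite conjgE !actM.
have [ze zf] := z_act H mgt0; split.
  by rewrite (act_inv e0) ze f0.
by rewrite (act_inv f0) zf e0.
Qed.
Lemma pi_dk i l : (i < m)%N ->
  (ev i *v pi (dk i ^+ l)%g = om0 ^- l *: ev i /\ fv i *v pi (dk i ^+ l)%g = om0 ^+ l *: fv i)%R.
Proof.
move=> hi; have [e0 f0] := VX_act H hi; rewrite piX piJ piX (pi_v LH) (pi_d LH).
move: (V_gen F n ^+ i) e0 f0 => W e0 f0; rewrite -conjXg conjgE !actM.
have [[[de df] _] _] := dA H l; split.
  by rewrite (act_inv e0) de actZ e0.
by rewrite (act_inv f0) df actZ f0.
Qed.

(** The image of Gam (j+1) satisfies the hypotheses of transitive_V. *)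
Lemma Gam_transitive j x : (j < m)%N -> inV j.+1 x -> x != 0%R ->
  exists2 h, Gam j.+1 h & exists c, (x *v pi h = ev j + c *: fv j)%R.
Proof.
move=> hj Vx x0'; pose T g := exists2 h, Gam j.+1 h & pi h = g.
have TM g h : T g -> T h -> T (g * h).
  by move=> [a1 K1 <-] [a2 K2 <-]; exists (a1 * a2); [exact: GamM|rewrite piM].
have TO g : T g -> g \in O /\ forall i, (j < i)%N -> (i < m)%N -> (ev i *v g = ev i /\ fv i *v g = fv i)%R.
  move=> [h Kh <-]; split; first exact: (gen_isom Kh).
  by move=> i ji hi; apply: (Gam_fix (ltn0Sn j) Kh).
have TE y : inV j y -> T (E (fv j) y).
  by move=> Vy; have [g Qg pg] := Qs_lift hj Vy; exists g; first exact: (Qs_Gam Qg).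
have TZ : exists2 g, T g & (ev j *v g = fv j /\ fv j *v g = ev j)%R.
  by exists (pi (zk j)); [exists (zk j) => //; exact: Gam_zk|exact: pi_zk].
have TD c : c != 0%R -> exists2 g, T g & (ev j *v g = c *: ev j /\ fv j *v g = c^-1 *: fv j)%R.
  move=> c0; have [|i ci] := om0_log H (_ : c^-1 != 0)%R; first by rewrite invr_eq0.
  exists (pi (dk j ^+ i)); first by exists (dk j ^+ i) => //; apply: GamX; exact: Gam_dk.
  by have [-> ->] := pi_dk i hj; rewrite -ci invrK.
by have [g [h Kh <-] [c xh]] := transitive_V H hj TM TO TE TZ TD Vx x0'; exists h => //; exists c.
Qed.

Section CosetStep.
Variable j : nat.
Hypotheses (j0 : (0 < j)%N) (hj : (j.+1 < m)%N).
Hypothesis faith : forall g, Gam j.+1 g -> pi g = 1 -> g = 1.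
Local Notation k := j.+1.
Local Notation S := (v ^+ j).

Let hj' : (j < m)%N := ltnW hj.
Let P g := exists a h, [/\ Qs k a, Gam k h & g = a * h].

Lemma Qs_tr a : Qs k a -> a = 1 \/ exists h c, [/\ Gam k h, Qs k (a ^ h) &
  pi (a ^ h) = E (fv k) (ev j + c *: fv j)%R].
Proof.
move=> Qa; have [x Vx pa] := pi_Qs hj Qa.
have [x0'|x0'] := eqVneq x 0%R.
  by left; apply: (Qs_inj hj Qa); rewrite pa x0' (eichler0 sJ tF) // bE.
right; have [h Kh [c xh]] := Gam_transitive hj' Vx x0'.
exists h, c; split=> //; first exact: (Gam_nrm_Qs (ltn0Sn j) hj Kh Qa).
rewrite piJ pa; apply: etrans (eichlerJ sJ tF (gen_isom Kh) (eichV H hj Vx)) _.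
by have [_ ->] := Gam_fix (ltn0Sn j) Kh (leqnn k) hj; rewrite xh.
Qed.

(** Write a as a'^(uw j) b; uw j carries the first factor back to a', in Gam k,
    and commutes with the part of b over f_j, so that only the part over e_j,
    a conjugate of x0^(v^j), remains. *)
Lemma Qs_dec a : Qs k a -> exists a0 a1, [/\ Qs k a0, a = a0 * a1, P (uw j * a0 * (uw j)^-1) &
  a1 = 1 \/ exists2 x, (exists i, x = dk k ^+ i) & a1 = (x0 ^ S) ^ x].
Proof.
case=> a' [b [Qa' /XsE[c Xc ->] ->]].
have yd : d1 = d \/ d1 = d1 by right.
have [g1 [g2 [-> [K1 [y p1]] _ c2]]] := X1_split yd Xc.
have X1g : X1 g1 by split=> //; exists 0%R, y; rewrite p1 scale0r add0r.
exists (a' ^ uw j * g1 ^ S), (g2 ^ S); split.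
- by exists a', (g1 ^ S); split=> //; apply: XsI.
- by rewrite (conjMg g1) mulgA.
- have cu : commute (g1 ^ S) (uw j) by apply/commuteJ/(K_fu K1 p1).
  have -> : uw j * (a' ^ uw j * g1 ^ S) * (uw j)^-1 = a' * g1 ^ S.
    rewrite (mulgA (uw j)) -(conjgC a') -(mulgA _ (g1 ^ S)) -(mulgA a') (mulgA (uw j)) -cu.
    by rewrite -(mulgA (g1 ^ S)) mulgV mulg1.
  have Ka' := Qs_Gam Qa'; exists ((g1 ^ S) ^ a'^-1), a'; split=> //.
    by apply: (Gam_nrm_Qs (ltn0Sn j) hj (GamV Ka')); apply/Xs_Qs/XsI.
  exact: conjgCV.
case: c2 => [->|[i ->]]; [by left; rewrite conj1g|right].
exists (dk k ^+ i); first by exists i.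
by rewrite -d1S -conjXg (conjJg x0).
Qed.

(** The hypotheses of bruhat_cosets: identities of Gam 2 conjugated by v^j, and
    transitivity of Gam k on the vectors v of E(f_k, v). If v is moved to e_j, the
    element becomes y0 = x0^(v^j) after changing a sign; if it is moved to
    e_j + c f_j with c nonzero, the rank one identity K_weyl_torus applies. *)
Lemma coset_types g : gen (fun x => [\/ Gam k x, Qs k x | x = zk k]) g ->
  [\/ exists p e a, [/\ P p, (exists i, e = dk k ^+ i), Qs k a & g = p * zk k * e * a],
      exists p a h, [/\ P p, Qs k a, Gam k h & g = p * uw j * a * h] |
      exists p e, [/\ P p, (exists i, e = dk k ^+ i) & g = p * e]].
Proof.
have Kz : Gam 1 z by gam. have Kd : Gam 1 d by gam.
have [Q1 QM QV] := Qs_subgrp hj.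
have k0 := ltn0Sn j.
have Xx := X1_x0; have Xxz := X1_x0z; have [_ _ X1V] := X1_subgrp.
have Qy : Qs k (x0 ^ S) by apply/Xs_Qs/XsI.
have Qq : Qs k ((x0 ^ z)^-1 ^ S) by apply/Xs_Qs/XsI/X1V.
have dtor : torsion (dk k) by apply/torsionJ/Gam_torsion; gam.
apply: (@bruhat_cosets _ (Gam k) (Qs k) (zk k) (dk k) (uw j) (zk j) (dk j) (x0 ^ S)
  ((x0 ^ z)^-1 ^ S) ((x0 ^ z)^-1 ^ S)) => //.
- exact: gen_subgrp.
- by move=> h Kh; apply: (Gam_nrm_Qs k0 hj Kh).
- by rewrite -(conjMg z) K_zz conj1g.
- by rewrite -(conjJg d) K_dz (conjVg d).
- exact: nrmZ.
- exact: nrmD.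
- exact: nrmQ_d.
- by rewrite zkS -conjgC.
- by rewrite dkS -conjgC.
- rewrite conjgC -d1S -(conjJg d1); congr (_ * _).
  by rewrite K_du2.
- exact: Gam_zk.
- exact: Gam_dk.
- rewrite -z1S -(conjJg x0) K_x0z1 (conjMg (_ * _)) (conjMg _ (z * u * z)) (conjMg (z * u)) (conjMg z).
  by [].
- have cu : commute ((x0 ^ z)^-1 ^ S) (uw j).
    apply: commuteJ; apply: (K_fu (b := 1%R)); first by case: (X1V _ Xxz).
    by rewrite piV pi_x0z (eichlerN sJ tF (eich1f _)) scaleN1r opprK scale1r.
  exists ((x0 ^ z)^-1 ^ S), 1; split=> //; first exact: Gam1.
  by rewrite -cu -mulgA mulgV.
- have [l ol] := ex_m1.
  have Dt : torsion (dk k ^+ l).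
    have [i i0 di] := dtor; exists i => //; by rewrite -expgnA mulnC expgnA di expg1n.
  have [i Di] := torsionV Dt.
  exists (dk j ^- l), (dk k ^- l), (zk j); split.
  + by apply/GamV/GamX; exact: Gam_dk.
  + by exists (l * i)%N; rewrite Di -expgnA.
  + exact: Gam_zk.
  have uu : uw j * uw j = dk j ^- l * dk k ^+ l.
    rewrite -[uw j * _]/(uw j ^+ 2) /uw -conjXg (K_u2torus ol) (conjMg (d1 ^+ l)) (conjXg d1) d1S (conjVg (d ^+ l)) conjXg.
    have c : commute d d1 := fix_conj K_dd1.
    have := commuteJ S c; rewrite d1S => /(commuteX l) /commute_sym /(commuteX l) /commuteV.
    by [].
  have zz : zk k * (dk k ^+ l) ^ zk k = dk k ^+ l * zk k by rewrite -conjgC.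
  have dz : (dk k ^+ l) ^ zk k = dk k ^- l.
    by rewrite conjXg -(conjJg d) K_dz (conjVg d) expVgn.
  have zu : zk j * uw j = uw j * zk k by rewrite zkS -conjgC.
  move: uu zz; rewrite dz; move: (dk k ^- l) (dk j ^- l) (dk k ^+ l) (zk k) (zk j) (uw j) zu => D1 D2 D3 Z1 Z2 w zu uu zz.
  by rewrite -(mulgA w) zu (mulgA w) uu -(mulgA D2) -zz !mulgA.
- exact: Qs_dec.
move=> a /Qs_tr[->|[h [c [Kh Qah pah]]]]; [by left|right].
have KhV := GamV Kh.
have [c0|c0] := eqVneq c 0%R.
  have [l ol] := ex_m1; have Kd' : Gam k (dk j ^+ l) by apply: GamX; exact: Gam_dk.
  exists (h * dk j ^+ l)^-1, (x0 ^ S); split=> //; last by left.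
  - by apply: GamV; apply: GamM.
  suff -> : x0 ^ S = a ^ (h * dk j ^+ l) by rewrite conjgK.
  apply: (Qs_eq hj Qy).
    by apply: (Gam_nrm_Qs k0 hj (GamM Kh Kd')); rewrite -[a](conjgK h); exact: (Gam_nrm_Qs k0 hj KhV).
  rewrite (pi_X1J hj (_ : pi x0 = E (fv 1) ((-1) *: ev 0 + 0 *: fv 0)%R)); last first.
    by rewrite pi_x0 scale0r addr0.
  rewrite (conjgM a) (piJ (a ^ h)) pah c0 !scale0r !addr0.
  apply/esym; apply: etrans (eichlerJ sJ tF (gen_isom Kd') (eich_fe H hj hj' _)) _; first by rewrite gtn_eqF.
  have [-> _] := pi_dk l hj'; have [_ ->] := Gam_fix k0 Kd' (leqnn k) hj.
  by rewrite ol invrN invr1.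
have [|l cl] := om0_log H (_ : - c^-1 != 0)%R; first by rewrite oppr_eq0 invr_eq0.
have cl' : (- c = om0 ^- l)%R by rewrite -cl invrN invrK.
have [y Xy py] := X1_lift 1%R c; have Ky : Gam 2 y by case: Xy.
have ag : a ^ h = y ^ S.
  apply: (Qs_eq hj Qah); first by apply/Xs_Qs/XsI.
  by rewrite pah (pi_X1J hj py) scale1r.
rewrite scale1r in py; have [g0 [Xg0 Eg]] := K_weyl_torus c0 cl' Ky py.
have Qg0 : Qs k (g0 ^ S) by apply/Xs_Qs/XsI.
exists h^-1, (a ^ h); split=> //; first by rewrite conjgK.
right; exists (g0 ^ S), (dk k ^+ l), (zk j * dk j ^- (q * l)), (g0 ^ S); split=> //.
- by exists l.
- by apply: GamM; [exact: Gam_zk|apply/GamV/GamX/Gam_dk].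
rewrite ag -z1S -(conjJg y) Eg (conjMg _ g0) (conjMg _ (z * _)) (conjMg _ (d1 ^+ l)) (conjMg g0) (conjMg z).
by rewrite (conjXg d1) d1S (conjVg (d ^+ _)) conjXg.
Qed.

(** uw j is a product of conjugates of x0^(v^j) and (x0^z)^(v^j), by K_u and K_s. *)
Lemma Gam_gen_cosets g : Gam k.+1 g -> gen (fun x => [\/ Gam k x, Qs k x | x = zk k]) g.
Proof.
have sG := gen_subgrp (fun x => [\/ Gam k x, Qs k x | x = zk k]).
have [_ GM _] := sG; have inH x : Gam k x -> gen (fun x => [\/ Gam k x, Qs k x | x = zk k]) x.
  by move=> Kx; apply: gen_in; apply: Or31.
move: g; apply: (gen_sub sG) => x [->|->|->|[[_ ->]|[i]]].
- by apply/inH/Gam_t.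
- by apply/inH/Gam_d.
- by apply/inH/Gam_z.
- by apply/inH/Gam_s.
rewrite ltnS leq_eqVlt => /orP[/eqP[->] ->|ik ->]; last by apply/inH/Gam_uw.
have Eu : uw j = ((x0 ^ z) ^ S) ^ zk k * x0 ^ S * ((x0 ^ z) ^ S) ^ zk k.
  by rewrite -z1S -(conjJg (x0 ^ z)) -K_s -(conjMg s) -(conjMg (s * x0)) -K_u.
have Qx : gen (fun x => [\/ Gam k x, Qs k x | x = zk k]) (x0 ^ S).
  by apply/gen_in/Or32/Xs_Qs/XsI/X1_x0.
have Qz : gen (fun x => [\/ Gam k x, Qs k x | x = zk k]) (((x0 ^ z) ^ S) ^ zk k).
  apply: (subgrpJ sG); last by apply/gen_in/Or33.
  by apply/gen_in/Or32/Xs_Qs/XsI/X1_x0z.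
by rewrite Eu; apply: (GM) => //; apply: GM.
Qed.

Lemma P_fix g : P g -> (fv k *v pi g = fv k)%R.
Proof.
case=> a [h [Qa Kh ->]]; have [x Vx pa] := pi_Qs hj Qa.
have ex := eichV H hj Vx; have [_ fk] := Gam_fix (ltn0Sn j) Kh (leqnn k) hj.
rewrite piM actM pa (eichlerE sJ tF ex); case: ex => -> ->.
by rewrite mulr0 !scale0r addr0 !subr0 fk.
Qed.

(** Let pi g = 1. Since P fixes f_k, the first type sends f_k to a vector that is
    not orthogonal to it and the second to a multiple of f_j, which is
    impossible. In the third type the power of d_k has trivial action on f_k, so
    that it equals a power of d_j and lies in Gam k; then the part in Q_k fixes
    e_k and is trivial, and g lies in Gam k. *)
Lemma faithful_next g : Gam k.+1 g -> pi g = 1 -> g = 1.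
Proof.
have Pa a : Qs k a -> P a by move=> Qa; exists a, 1; rewrite mulg1; split=> //; exact: Gam1.
have Ph h : Gam k h -> P h by move=> Kh; exists 1, h; rewrite mul1g; split=> //; exact: Qs_1.
have bkk : B (ev k) (fv k) = 1%R by rewrite bE // eqxx.
have bff : B (fv k) (fv k) = 0%R by rewrite bE.
have fk0 : fv k != 0%R.
  by apply/eqP=> f0; move: bkk; rewrite f0 (bform0r sJ) => /esym/eqP; rewrite oner_eq0.
move/Gam_gen_cosets/coset_types=> [[y0 [_ [a [Pp [i ->] Qa ->]]]]|[y0 [a [h [Pp Qa Kh ->]]]]|[y0 [_ [Pp [i ->] ->]]]] p1.
- have := congr1 (fun g => B (fv k *v g) (fv k))%R p1.
  rewrite piM (piM (y0 * _)) (piM y0) !actM act1 (P_fix Pp) bff.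
  have Oa : pi a \in O by apply: (gen_isom (Qs_Gam Qa)).
  rewrite -{2}(P_fix (Pa _ Qa)) (isomB _ _ Oa).
  have [_ ->] := pi_zk hj; have [-> _] := pi_dk i hj.
  rewrite (bformZl J) bkk mulr1 => /eqP; rewrite invr_eq0 expf_eq0 (negbTE (om0_neq0 H)) andbF.
  by [].
- have : (fv k *v pi (y0 * uw j)%g = fv k)%R.
    have E1 : pi (y0 * uw j) * pi (a * h) = 1 by rewrite -piM mulgA.
    have := P_fix (ex_intro _ a (ex_intro _ h (And3 Qa Kh erefl))) => E2.
    by rewrite -[pi (y0 * uw j)]invgK (mulg1_eq E1); exact: act_inv E2.
  rewrite piM actM (P_fix Pp) pi_uw //; have [_ ->] := Um_act H hj hj.
  rewrite eqxx gtn_eqF // => /(congr1 (B (ev k))).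
  by rewrite bkk (bformNr sJ) bE // gtn_eqF // oppr0 => /esym/eqP; rewrite oner_eq0.
have [a [h [Qa Kh Ep]]] := Pp.
have oi : (om0 ^+ i = 1)%R.
  have := congr1 (fun g => B (ev k) (fv k *v g))%R p1.
  rewrite piM !actM act1 (P_fix Pp) bkk; have [_ ->] := pi_dk i hj.
  by rewrite (bformZr sJ) bkk mulr1.
have Ed : dk k ^+ i = dk j ^+ i.
  by have := congr1 (fun x => x ^ S) (K_torus oi); rewrite !conjXg d1S.
have Kd : Gam k (dk j ^+ i) by apply: GamX; exact: Gam_dk.
move: p1; rewrite Ep Ed -mulgA; move: (GamM Kh Kd) => {Ep Kh Kd}.
move: (h * _) => {}h Kh; rewrite piM => p1.
have [x Vx pa] := pi_Qs hj Qa.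
have [ek _] := Gam_fix (ltn0Sn j) Kh (leqnn k) hj.
have ea : (ev k *v pi a = ev k)%R.
  by rewrite -[pi a]invgK (mulg1_eq p1); exact: act_inv ek.
have x0' : x = 0%R.
  have [e0 f0] := Vx k (leqnn k) hj.
  have Ex : (x = qform J x *: fv k)%R.
    apply/eqP; rewrite -subr_eq0; apply/eqP.
    have := eichlerE sJ tF (eichV H hj Vx) (ev k); rewrite -pa ea bkk e0 scale1r mulr1 scale0r subr0.
    by rewrite -addrA => /esym/(canRL (addKr _)); rewrite addNr.
  by move: e0; rewrite Ex (bformZr sJ) bkk mulr1 => ->; rewrite scale0r.
have a1 : a = 1 by apply: (Qs_inj hj Qa); rewrite pa x0' (eichler0 sJ tF).
by move: p1; rewrite a1 gmulf1 !mul1g => /(faith Kh).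
Qed.
End CosetStep.

Lemma Gam_faithful k g : (1 < k <= m)%N -> Gam k g -> pi g = 1 -> g = 1.
Proof.
elim: k g => [//|[//|[|k]] IH] g /andP[_ hk]; first exact: (faithful_K LH).
by apply: (@faithful_next k.+1) => // h; apply: IH; rewrite /= ltnW.
Qed.

(** Gam m is everything, as V = uw (m-2) ... uw 0. *)
Lemma pi_faithful g : gen (fun x => [\/ x = s, x = t, x = d | x = z \/ x = u \/ x = v]) g -> pi g = 1 -> g = 1.
Proof.
move=> Gg; apply: (@Gam_faithful m); first by rewrite mgt1 leqnn.
have [_ GM _] := gen_subgrp (Gset m).
move: g Gg; apply: (gen_sub (gen_subgrp _)) => x [->|->|->|[->|[->|->]]].
- exact: Gam_s.
- exact: Gam_t.
- exact: Gam_d.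
- exact: Gam_z.
- exact: Gam_u.
have Kp i : (i < m)%N -> Gam m (pw i).
  elim: i => [|i IH] hi; first exact: Gam1.
  by rewrite pwS; apply: GM; [apply: Gam_uw|apply/IH/ltnW].
by have := Kp m.-1; rewrite -v_prod; apply; rewrite prednK.
Qed.
End LiftingFacts.


(** * Free groups and presented groups *)

Lemma normal_closure_ker (A B : groupType) (S : A -> Prop) (phi : UMagmaMorphism.type A B) :
  (forall x, S x -> phi x = 1) -> forall x, normal_closure S x -> phi x = 1.
Proof.
move=> S1 x; elim=> [y /S1 //||y y' _ Hy _ Hy'|y _ Hy|y g _ Hy].
- exact: gmulf1.
- by rewrite gmulfM Hy Hy' mulg1.
- by rewrite gmulfV Hy invg1.
by rewrite gmulfJ Hy conj1g.
Qed.
Section FreeGroupFacts.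
Variable k : nat.

(** Parametricity of words: a relation between two groups that is compatible with
    the operations holds between the values of a word if it holds between the
    generators. *)
Lemma free_lift_rel (A B : groupType) (a : k.-tuple A) (b : k.-tuple B) (R : A -> B -> Prop) :
  R 1 1 -> (forall x y x' y', R x y -> R x' y' -> R (x * x') (y * y')) ->
  (forall x y, R x y -> R x^-1 y^-1) -> (forall i, R (tnth a i) (tnth b i)) ->
  forall w, R (free_lift a w) (free_lift b w).
Proof.
move=> R1 RM RV Rg [u ru]; rewrite /free_lift /=; elim: u {ru} => [|[i c] u IH].
  by rewrite !big_nil.
rewrite !big_cons; apply: RM => //; rewrite /letter_val /=.
by case: c; [exact: RV|exact: Rg].
Qed.

Lemma free_lift_nat (A B : groupType) (phi : UMagmaMorphism.type A B) (a : k.-tuple A)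
    (b : k.-tuple B) : (forall i, phi (tnth a i) = tnth b i) ->
  forall w, phi (free_lift a w) = free_lift b w.
Proof.
move=> ab; apply: (free_lift_rel (R := fun x y => phi x = y)) => //.
- exact: gmulf1.
- by move=> x y x' y' <- <-; rewrite gmulfM.
by move=> x y <-; rewrite gmulfV.
Qed.

Lemma free_group_gen (w : free_group k) : gen (fun x => exists i, x = free_gen i) w.
Proof.
case: w => u ru; elim: u ru => [|[i c] u IH] ru.
  by rewrite (_ : FreeGroup ru = 1); [exact: gen_1|exact: val_inj].
have ru' : reduced u by apply: path_sorted ru.
pose x : free_group k := if c then (free_gen i)^-1 else free_gen i.
have -> : FreeGroup ru = x * FreeGroup ru'.
  apply: val_inj; rewrite /= -[LHS](push_neq ru) /x.
  by case: (c).
apply: gen_M => //; rewrite /x; case: (c); last by apply: gen_in; exists i.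
by apply: gen_V; apply: gen_in; exists i.
Qed.

Lemma gen_free_lift (A : groupType) (a : k.-tuple A) x :
  gen (fun y => exists i, y = tnth a i) x -> exists w, x = free_lift a w.
Proof.
elim=> [_ [i ->]||_ _ _ [w1 ->] _ [w2 ->]|_ _ [w ->]].
- by exists (free_gen i); rewrite free_lift_gen.
- by exists 1; rewrite gmulf1.
- by exists (w1 * w2); rewrite gmulfM.
by exists w^-1; rewrite gmulfV.
Qed.

End FreeGroupFacts.

Section Presented.
Variables (k : nat) (R : free_group k -> Prop).
Local Notation PG := (presented_group R).

Definition pres_proj (w : free_group k) : PG := (\pi_PG w)%qT.
Lemma pres_proj_monoid : monoid.monoid_morphism pres_proj.
Proof. by split=> [|x y]; [exact: erefl|exact: esym (presented_mulE R x y)]. Qed.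
HB.instance Definition _ :=
  isUMagmaMorphism.Build (free_group k) PG pres_proj pres_proj_monoid.

Lemma pres_proj_rel w : R w -> pres_proj w = 1.
Proof.
move=> Rw; rewrite -[1]/(pres_proj 1); apply/pi_eq; rewrite invg1 mulg1.
exact: normal_closure_base.
Qed.
Lemma pres_proj_surj (x : PG) : exists w, x = pres_proj w.
Proof. by exists (generic_quotient.repr x); rewrite /pres_proj reprK. Qed.

Section Universal.
Variables (A : groupType) (a : k.-tuple A).
Hypothesis kill : forall w, R w -> free_lift a w = 1.

Definition pres_map (x : PG) : A := free_lift a (generic_quotient.repr x).
Lemma pres_mapE w : pres_map (pres_proj w) = free_lift a w.
Proof.
apply: divg1_eq; rewrite -gmulfV -gmulfM.
exact: (normal_closure_ker (phi := free_lift a) kill (repr_pi R w)).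
Qed.
Lemma pres_map_monoid : monoid.monoid_morphism pres_map.
Proof.
split=> [|x y]; first by rewrite -[1 : PG]/(pres_proj 1) pres_mapE gmulf1.
have [[w ->] [w' ->]] := (pres_proj_surj x, pres_proj_surj y).
by rewrite -gmulfM !pres_mapE gmulfM.
Qed.
(** The universal property of the presented group. *)
Definition pres_hom : UMagmaMorphism.type PG A :=
  HB.pack_for (UMagmaMorphism.type PG A) pres_map
    (isUMagmaMorphism.Build PG A pres_map pres_map_monoid).
Lemma pres_homE w : pres_hom (pres_proj w) = free_lift a w.
Proof. exact: pres_mapE. Qed.
End Universal.
End Presented.

Local Open Scope ring_scope.

Section DerivedSubgroup.
Local Open Scope group_scope.
Variables (gT : finGroupType) (A : {group gT}).
Definition der (x : gT) : Prop := x \in [~: A, A].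
Lemma der_char : [/\ subgrp der, forall y, y \in A -> nrm der y,
  forall x y, x \in A -> y \in A -> der [~ x, y] &
  forall P : gT -> Prop, subgrp P -> (forall x y, x \in A -> y \in A -> P [~ x, y]) ->
    forall g, der g -> P g].
Proof.
split; last first.
- move=> P [P1 PM _] Pc g Dg; pose S := [set x : gT | `[< P x >]].
  have gS : group_set S.
    apply/group_setP; split=> [|x y]; rewrite !inE; first exact/asboolP.
    by move=> /asboolP Px /asboolP Py; apply/asboolP/PM.
  have DS : [~: A, A] \subset Group gS.
    rewrite gen_subG; apply/subsetP=> _ /imset2P[x y Ax Ay ->].
    by rewrite inE; apply/asboolP/Pc.
  by have := subsetP DS g Dg; rewrite inE => /asboolP.
- exact: mem_commg.
- by move=> y Ay x; rewrite /der memJ_norm // (subsetP (commg_norml A A)).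
by split=> [|x y Dx Dy|x Dx]; [exact: group1|exact: groupM|rewrite /der groupV].
Qed.
End DerivedSubgroup.

Section MatrixGroup.
Variables (p d n : nat) (F L : finFieldType) (emb : {rmorphism F -> L}) (omega : L).
Hypothesis H : setting p d n emb omega.
Local Notation q := #|F|.
Local Notation N := (n.*2.-1.+1).
Local Notation m := n.-1.
Local Notation vec := 'rV[F]_N.
Local Notation GL := {'GL_n.*2[F]}.
Local Notation om0 := (omega0 emb omega).
Local Notation J := (gram emb omega n).
Local Notation ev := (ev n F).
Local Notation fv := (fv n F).
Local Notation w1 := (w1 n F).
Local Notation wv := (wv n emb omega).
Local Notation B := (bform J).
Local Notation Q := (qform J).
Local Notation E := (eichler J).
Local Notation O := (Defs.isometries J).
Local Notation s := (sigma_gen F n).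
Local Notation t := (tau_gen F n).
Local Notation dl := (delta_gen emb omega n).
Local Notation z := (z_gen F n).
Local Notation U := (U_gen F n).
Local Notation V := (V_gen F n).
Local Notation bE := (bvecE H).
Local Notation bfE := (bformE (gram_sym H)).
Local Notation sJ := (gram_sym H).
Local Notation tF := (two_F H).

Set Default Proof Using "All".
Local Hint Extern 0 (is_true (0 < _.-1)%N) => exact: (m_gt0 H) : core.
Local Hint Extern 0 (is_true (1 < _.-1)%N) => exact: (m_gt1 H) : core.
Local Hint Extern 0 (is_true (2 < _.-1)%N) => exact: (m_ge3 H) : core.


Local Notation Um := (Um n emb omega).
Local Notation mgt0 := (m_gt0 H).
Local Notation mgt1 := (m_gt1 H).
Local Notation mgt2 := (m_ge3 H).


(** * The matrices satisfy the relations *)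

Lemma s_fix g : g \in O -> fv 0 *v g = fv 0 -> ev 1 *v g = ev 1 -> commute s g.
Proof.
move=> Og f0 e1; apply: fix_conj; rewrite (s_eichler H).
by apply: etrans (eichlerJ sJ tF Og (eich_fe H mgt0 mgt1 isT)) _; rewrite f0 e1.
Qed.

(** tau, z and z delta are products of Eichler transformations built from e_0, f_0
    and W, and so they commute with isometries that fix these. *)
Lemma torus_fix g : g \in O -> ev 0 *v g = ev 0 -> fv 0 *v g = fv 0 ->
  (forall x, wv x *v g = wv x) -> [/\ commute t g, commute dl g & commute z g].
Proof.
move=> Og e0 f0 w.
have cz : commute z g.
  apply: fix_conj; rewrite (z_weyl H).
  apply: etrans (weylJ sJ tF (eich_ew H _ mgt0) (eichN sJ (eich_fw H _ mgt0)) Og) _.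
  by rewrite e0 f0 actN !w.
split=> //.
  apply: fix_conj; rewrite (t_eichler H).
  by apply: etrans (eichlerJ sJ tF Og (eich_fw H _ mgt0)) _; rewrite f0 w.
have czd : commute (z * dl)%g g.
  apply: fix_conj; rewrite (zd_weyl H).
  apply: etrans (weylJ sJ tF (eich_ew H _ mgt0) (eichZ sJ _ (eich_fw H _ mgt0)) Og) _.
  by rewrite e0 f0 actZ !w.
rewrite -[dl](mulKg z); apply: commute_sym; apply: commuteM; last exact: commute_sym.
exact: commuteV (commute_sym cz).
Qed.

Lemma V2E : (ev 0 *v (V ^+ 2)%g = ev 2) * (fv 0 *v (V ^+ 2)%g = fv 2).
Proof. exact: (VX_act H mgt2). Qed.
Lemma VXw i x : wv x *v (V ^+ i)%g = wv x.
Proof. by elim: i => [|i IH]; rewrite ?expg0 ?act1 // expgSr actM IH (V_actw H). Qed.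
Lemma VX_isom i : (V ^+ i)%g \in O. Proof. exact/isomX/(V_isom H). Qed.

(** On the plane 2 and W the conjugates of z and z delta are products of Eichler
    transformations with vectors in that plane and W. *)
Lemma far2 r : B (ev 2) r = 0 -> B (fv 2) r = 0 -> (forall x, B r (wv x) = 0) ->
  r *v (z ^ (V ^+ 2))%g = r /\ r *v (dl ^ (V ^+ 2))%g = r.
Proof.
move=> e0 f0 w0; have ww x c := etrans (actZ c (wv x) (V ^+ 2)%g) (congr1 _ (VXw 2 x)).
have fix_weyl x c : x != 0 -> c = (Q (wv x))^-1 -> r *v (weyl J (ev 0) (fv 0) (wv x) (c *: wv x) ^ (V ^+ 2))%g = r.
  move=> x0 ->.
  rewrite (weylJ sJ tF (eich_ew H x mgt0) (eichZ sJ _ (eich_fw H x mgt0)) (VX_isom 2)).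
  rewrite !V2E ww VXw (weyl_r sJ tF (hyp_ef H mgt2)) ?bE ?(Q_w_eq0 H) //.
  by rewrite w0 mul0r scale0r subr0.
have rz : r *v (z ^ (V ^+ 2))%g = r.
  rewrite (z_weyl H) -[X in weyl _ _ _ _ X]scaleN1r; apply: fix_weyl; first exact: oner_neq0.
  by rewrite (Q_w1 H) invrN invr1.
have rzd : r *v ((z * dl) ^ (V ^+ 2))%g = r.
  by rewrite (zd_weyl H); apply: fix_weyl => //; rewrite invr_eq0 (omega_neq0 H).
by split=> //; move: rzd; rewrite (conjMg z) actM rz.
Qed.

Lemma V1E : (ev 0 *v V = ev 1) * (fv 0 *v V = fv 1) * (ev 1 *v V = ev 2) * (fv 1 *v V = fv 2).
Proof. by rewrite !(V_step H). Qed.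
Lemma U_V1 : (U ^ V = Um 1)%g.
Proof. by have := UmVX H mgt2; rewrite expg1. Qed.

Lemma s_conj_V : (s ^ V = E (fv 1) (ev 2))%g.
Proof. by rewrite (s_eichler H) (eichlerJ sJ tF (V_isom H) (eich_fe H mgt0 mgt1 isT)) !V1E. Qed.
Lemma e2UV : ev 2 *v U^-1%g = ev 2.
Proof. by apply: act_inv; rewrite (UF H). Qed.
Lemma VU_isom : (V * U^-1)%g \in O.
Proof. by rewrite isomM ?isomV ?(V_isom H) ?(U_isom H). Qed.
Lemma s_conj_VU : (s ^ (V * U^-1) = E (fv 0) (ev 2))%g.
Proof.
rewrite (conjgM s) s_conj_V (eichlerJ sJ tF (isomV (U_isom H)) (eich_fe H mgt1 mgt2 isT)).
by rewrite e2UV !(UVA H).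
Qed.
Lemma eichler_ee : eich J (fv 0) (ev 1) /\ eich J (fv 0) (ev 2).
Proof. by split; apply: (eich_fe H). Qed.

Lemma rel_A_GL : ([~ s, s ^ V] = s ^ (V * U^-1))%g.
Proof.
have [e1 e2] := eichler_ee; have e12 := eich_fe H mgt1 mgt2 isT.
rewrite s_conj_VU s_conj_V commgEl (s_eichler H) (eichlerN sJ tF e1).
rewrite (eichlerJ sJ tF (eichler_isom sJ tF e12) e1) !(eichlerE sJ tF e12).
rewrite !bE //= !scale0r !mulr0 !scale0r !subr0 addr0 (Q_e H mgt2) mul0r scale0r subr0 scale1r.
by rewrite (eichlerD sJ tF (eichN sJ e1) (eichD sJ e1 e2)) addKr.
Qed.

Lemma eich_fix g r i j : i != j -> (i < m)%N -> (j < m)%N -> B r (fv i) = 0 -> B r (ev j) = 0 ->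
  g = E (fv i) (ev j) -> r *v g = r.
Proof.
move=> ij hi hj b1 b2 ->; rewrite (eichlerE sJ tF (eich_fe H hi hj ij)) b1 b2.
by rewrite mulr0 !scale0r addr0 !subr0.
Qed.

Lemma eich_s_comm g i j : i != j -> (0 < i)%N -> j != 0%N -> i != 1%N -> (i < m)%N -> (j < m)%N ->
  g = E (fv i) (ev j) -> commute s g.
Proof.
move=> ij i0 j0 i1 hi hj gE; apply: s_fix; last 2 first.
- by apply: (eich_fix ij hi hj _ _ gE); rewrite bE // eq_sym (negbTE j0).
- by apply: (eich_fix ij hi hj _ _ gE); rewrite bE // eq_sym (negbTE i1).
by rewrite gE (eichler_isom sJ tF) //; apply: (eich_fe H).
Qed.

Lemma lifting_GL : lifting p d emb omega (idfun : UMagmaMorphism.type GL GL) s t dl z U V.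
Proof.
have OU := U_isom H; have OV := V_isom H; have OVU := VU_isom.
have U1a j (hj : (j < m)%N) := Um_act H mgt2 hj.
have U1w x := Um_actw H x mgt2.
have [tU dU zU] : [/\ commute t (U ^ V)%g, commute dl (U ^ V)%g & commute z (U ^ V)%g].
  rewrite U_V1; have [e0 f0] := U1a 0%N mgt0; apply: torus_fix => //; exact: (Um_isom H mgt2).
have [tc dc zc] : [/\ commute t (V * U^-1)%g, commute dl (V * U^-1)%g & commute z (V * U^-1)%g].
  apply: torus_fix; rewrite ?actM ?V1E ?(UVA H) //.
  by move=> x; rewrite actM (V_actw H) (UVw H).
have ef01 i : (1 < i)%N -> (i.+1 < m)%N -> fv 0 *v Um i = fv 0 /\ ev 1 *v Um i = ev 1.
  move=> i1 hi; have [_ ->] := Um_act H hi mgt0; have [-> _] := Um_act H hi mgt1.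
  by case: i i1 {hi} => [|[|i]].
have Oz2 : (z ^ (V ^+ 2))%g \in O by rewrite isomJ ?(z_isom H) ?VX_isom.
have Od2 : (dl ^ (V ^+ 2))%g \in O by rewrite isomJ ?(d_isom H) ?VX_isom.
have [f0z f0d] : fv 0 *v (z ^ (V ^+ 2))%g = fv 0 /\ fv 0 *v (dl ^ (V ^+ 2))%g = fv 0.
  by apply: far2 => [||x]; rewrite bE.
have [e1z e1d] : ev 1 *v (z ^ (V ^+ 2))%g = ev 1 /\ ev 1 *v (dl ^ (V ^+ 2))%g = ev 1.
  by apply: far2 => [||x]; rewrite bE.
have [e1 e2] := eichler_ee.
have m3 : (4 < n)%N -> (3 < m)%N by rewrite {1}(n_pred H) ltnS.
have m4 : (5 < n)%N -> (4 < m)%N by rewrite {1}(n_pred H) ltnS.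
split=> //.
- move=> /m3 h3; have [f0 e1'] := ef01 2 isT h3.
  by rewrite (UmVX H h3); apply: s_fix => //; exact: (Um_isom H h3).
- move=> /m4 h4; have h3 := ltnW h4.
  have UV1 : (U^-1 ^ V = (Um 1)^-1)%g by rewrite (conjVg U) U_V1.
  rewrite UV1; apply: s_fix.
  + by rewrite isomM ?isomV ?(Um_isom H mgt2).
  + rewrite !actM !V1E !(UVA H); apply: act_inv; by have [_ ->] := U1a 0%N mgt0.
  rewrite !actM !V1E e2UV; apply: act_inv; by have [-> _] := U1a 1%N mgt1.
- exact: s_fix.
- exact: s_fix.
- exact: rel_A_GL.
- rewrite s_conj_VU (s_eichler H) /commute; apply: etrans (eichlerD sJ tF e1 e2) _.
  by rewrite addrC; exact: esym (eichlerD sJ tF e2 e1).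
- have WE : (U ^ (V * U^-1) = Um 1 ^ U^-1)%g by rewrite (conjgM U) U_V1.
  have OW : (Um 1 ^ U^-1)%g \in O by rewrite isomJ ?isomV ?(Um_isom H mgt2).
  apply: (@eich_s_comm _ 2%N 1%N) => //.
  rewrite WE (s_eichler H); apply: etrans (eichlerJ sJ tF OW e1) _.
  have WA (r : vec) : r *v (Um 1 ^ U^-1)%g = r *v U *v Um 1 *v U^-1%g.
    by rewrite conjgE invgK !actM.
  rewrite (WA (fv 0)) (WA (ev 1)).
  have [[[_ f0] e1'] _] := UA H; rewrite f0 e1' !actN.
  have u1f : fv 1 *v Um 1 = fv 2 by have [_ ->] := U1a 1%N mgt1.
  have u1e : ev 0 *v Um 1 = ev 0 by have [-> _] := U1a 0%N mgt0.
  have f2U : fv 2 *v U^-1%g = fv 2 by apply: act_inv; rewrite (UF H).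
  have [[[_ _] e0V] _] := UVA H; rewrite u1f u1e f2U e0V opprK.
  by [].
- move=> /m3 h3; apply: (@eich_s_comm _ 2%N 3%N) => //.
  rewrite (s_eichler H) (eichlerJ sJ tF (VX_isom 2) e1) V2E expg2 actM !V1E.
  by congr (E _ _); have [-> _] := V_step H h3.
rewrite s_conj_V; apply: fix_conj; have e12 := eich_fe H mgt1 mgt2 isT.
rewrite (eichlerJ sJ tF (t_isom H) e12); have [_ ->] := tau_act H mgt1.
by have [-> _] := tau_act H mgt2.
Qed.

Local Open Scope group_scope.
(** * The matrices generate the derived subgroup *)

Definition D : GL -> Prop := der (isometries_group J).
Local Notation LG := lifting_GL.
Local Notation Gens := (fun x : GL => [\/ x = s, x = t, x = dl | x = z \/ x = U \/ x = V]).
Local Notation X := (gen Gens).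

Lemma D_char : [/\ subgrp D, forall y, y \in O -> nrm D y,
  forall x y, x \in O -> y \in O -> D [~ x, y] &
  forall P : GL -> Prop, subgrp P -> (forall x y, x \in O -> y \in O -> P [~ x, y]) ->
    forall g, D g -> P g].
Proof. exact: der_char. Qed.
Lemma D_subgrp : subgrp D. Proof. by case: D_char. Qed.
Lemma D_nrm y : y \in O -> nrm D y. Proof. by case: D_char => _ + _ _; apply. Qed.
Lemma D_comm x y : x \in O -> y \in O -> D [~ x, y]. Proof. by case: D_char => _ _ + _; apply. Qed.
Lemma D_min P : subgrp P -> (forall x y, x \in O -> y \in O -> P [~ x, y]) -> forall g, D g -> P g.
Proof. by case: D_char => _ _ _; apply. Qed.

Lemma E_half_w x : (E (fv 0) (wv x))^-1 * E (fv 0) (wv x) ^ zU n F = E (fv 0) (wv (- frob F x - x))%R.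
Proof.
have ex := eich_fw H x mgt0; rewrite (eichlerN sJ tF ex) -(wvN H).
rewrite (eichlerJ sJ tF (z1_isom H) ex) (z1w H); have [[[_ f0] _] _] := z1A H; rewrite f0.
apply: etrans (eichlerD sJ tF (eich_fw H _ mgt0) (eich_fw H _ mgt0)) _.
by rewrite -(wvD H) addrC.
Qed.

(** The copy of z on the plane 1 fixes f_0 and sends wv x to - wv (x^q), so that
    its commutator with E(f_0, - w_1 / 2) is tau. *)
Lemma D_t : D t.
Proof.
have T := two_L H; pose x : L := (- 2^-1)%R.
have fx : (- frob F x - x = 1)%R.
  rewrite /x (frobN H) (frobV H) (frob2 H); by field.
rewrite (t_eichler H) -fx -E_half_w -commgEl; apply: D_comm; last exact: (z1_isom H).
exact: (eichler_isom sJ tF (eich_fw H _ mgt0)).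
Qed.

Lemma D_E0w x : D (E (fv 0) (wv x)).
Proof. by have [g Dg /= <-] := lift0_in LG x D_subgrp D_t (D_nrm (d_isom H)). Qed.
Lemma E0w_z x : E (ev 0) (wv x) = E (fv 0) (wv (- frob F x)%R) ^ z.
Proof.
rewrite (eichlerJ sJ tF (z_isom H) (eich_fw H _ mgt0)) (z_actw H) (frobN H) (frobK H) opprK.
by have [[[_ f0] _] _] := zA H; rewrite f0.
Qed.
Lemma zd_split : z * dl = weyl J (ev 0) (fv 0) (wv omega^-1)%R (wv ((emb (Q (wv omega^-1))^-1) * omega^-1))%R.
Proof. by rewrite (wvZ H) -(zd_weyl H). Qed.
Lemma z_split : z = weyl J (ev 0) (fv 0) (wv 1)%R (wv (- 1))%R.
Proof. by rewrite (wvN H) -(z_weyl H). Qed.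

(** sigma is, up to conjugation, the commutator of sigma and sigma^V; U is a product
    of conjugates of sigma; V is one of conjugates of U; z and z delta are
    products of conjugates of the E(f_0, wv x). *)
Lemma gens_D x : X x -> D x.
Proof.
have sD := D_subgrp; have [_ DM DV] := sD.
have dE0e x' : D (E (ev 0) (wv x')) by rewrite E0w_z; apply: (D_nrm (z_isom H)); exact: D_E0w.
have Dw x' y : D (weyl J (ev 0) (fv 0) (wv x') (wv y)).
  have DEE := DM _ _ (D_E0w y) (dE0e x'); exact: (DM _ _ DEE (D_E0w y)).
have Dz : D z by rewrite z_split.
have Dd : D dl by rewrite -[dl](mulKg z) zd_split; apply: (DM); [exact: DV|exact: Dw].
have Ds : D s.
  have OVU := VU_isom; rewrite -[s](conjgK (V * U^-1)); apply: D_nrm; first exact: isomV.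
  by rewrite -rel_A_GL; apply: D_comm; rewrite ?isomJ ?(s_isom H) ?(V_isom H).
have DU : D U.
  rewrite (K_u LG) /x0; apply: (DM) => //; apply: (DM) => //.
  by apply: (D_nrm (U_isom H)).
have DVV : D V.
  rewrite (V_prod H); have : (m.-1 < m)%N by rewrite prednK.
  elim: (m.-1) => [|k IH] hk; first by case: sD.
  rewrite (PmS H); apply: (DM); last exact: IH (ltnW hk).
  by rewrite -(UmVX H hk); apply: D_nrm => //; exact: VX_isom.
by move: x; apply: (gen_sub sD) => x [->|->|->|[->|[->|->]]] //; exact: D_t.
Qed.

Local Notation Gam := (Gam s t dl z U V).
Local Notation inV := (inV emb omega).
Local Notation frob := (frob F).
Local Notation r := (omega ^+ q.-1)%R.
Local Notation zk k := (z ^ (V ^+ k)).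
Local Notation dk k := (dl ^ (V ^+ k)).

Lemma X_subgrp : subgrp X. Proof. exact: gen_subgrp. Qed.
Lemma XM x y : X x -> X y -> X (x * y). Proof. by case: X_subgrp => _ + _; apply. Qed.
Lemma XVg x : X x -> X x^-1. Proof. by case: X_subgrp => _ _; apply. Qed.
Lemma Gam_X k g : Gam k g -> X g.
Proof.
have XU : X U by apply: gen_in; apply: Or44; right; left.
have XV : X V by apply: gen_in; apply: Or44; right; right.
move: g; apply: (gen_sub X_subgrp) => x [->|->|->|[[_ ->]|[i _ ->]]].
- by apply: gen_in; apply: Or42.
- by apply: gen_in; apply: Or43.
- by apply: gen_in; apply: Or44; left.
- by apply: gen_in; apply: Or41.
by apply: (subgrpJ X_subgrp) => //; apply: (subgrpX _ X_subgrp).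
Qed.

Lemma E_f_Gam k x : (k < m)%N -> inV k x -> Gam k.+1 (E (fv k) x).
Proof. by move=> hk Vx; have [g Qg /= <-] := Qs_lift LG hk Vx; exact: (Qs_Gam LG Qg). Qed.

Lemma zk_act k : (k < m)%N -> ev k *v zk k = fv k /\ fv k *v zk k = ev k.
Proof. exact: (pi_zk LG). Qed.
Lemma zk_sqr k : zk k * zk k = 1.
Proof. by rewrite -(conjMg z) (z_sqr H) conj1g. Qed.
Lemma zk_isom k : zk k \in O.
Proof. by rewrite isomJ ?(z_isom H) ?VX_isom. Qed.

(** z_k exchanges e_k and f_k. *)
Lemma E_e_Gam k x : (k < m)%N -> inV k x -> Gam k.+1 (E (ev k) x).
Proof.
move=> hk Vx; have Oz := zk_isom k; have [ze zf] := zk_act hk.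
have Kz : Gam k.+1 (zk k) by exact: (Gam_zk LG).
have Vxz : inV k (x *v zk k).
  move=> i; rewrite leq_eqVlt => /orP[/eqP<-|ki] hi.
    by have [ex fx] := Vx k (leqnn k) hk; rewrite -{1}zf -{2}ze !(isomB _ _ Oz).
  have [ei fi] := Gam_fix LG (ltn0Sn k) Kz ki hi; have [ex fx] := Vx i (ltnW ki) hi.
  by rewrite -{1}ei -{1}fi !(isomB _ _ Oz).
have -> : E (ev k) x = E (fv k) (x *v zk k) ^ zk k.
  rewrite (eichlerJ sJ tF Oz (eichV H hk Vxz)) zf; congr (E _ _).
  by rewrite -actM zk_sqr act1.
by apply: (GamJ LG) => //; exact: E_f_Gam.
Qed.

(** Move the image of e_k to e_k + c f_k; it is singular, so c = 0. The image of f_k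
    is then f_k + w - Q(w) e_k with w orthogonal to the plane k, which is the
    image of f_k under E(e_k, w). *)
Lemma descend_step k g : (k < m)%N -> g \in O ->
  (forall i, (k < i)%N -> (i < m)%N -> ev i *v g = ev i /\ fv i *v g = fv i) ->
  exists2 a, X a & g * a \in O /\
    forall i, (k <= i)%N -> (i < m)%N -> ev i *v (g * a)%g = ev i /\ fv i *v (g * a)%g = fv i.
Proof.
move=> hk Og fix_g; have [Ve Vf] := inV_e H (ltnSn k) hk.
have Vx := inV_act H Og fix_g Ve.
have bef : B (ev k) (fv k) = 1%R by rewrite bE // eqxx.
have x0 : ev k *v g != 0%R.
  apply/eqP=> x0; have := isomB (ev k) (fv k) Og; rewrite x0 (bform0l J) bef.
  by move/esym/eqP; rewrite oner_eq0.
have [a1 Ka1 [c xa]] := Gam_transitive LG hk Vx x0.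
have Oa1 : a1 \in O := gen_isom LG Ka1.
have Oga : g * a1 \in O by rewrite isomM.
have ega : ev k *v (g * a1)%g = ev k.
  move: xa; rewrite /= -actM => xa; have := isomB (ev k) (ev k) Oga; rewrite xa.
  rewrite !(bformE sJ) !bE // eqxx !mulr0 !mulr1 !addr0 add0r -mulr2n -mulr_natl => /eqP.
  by rewrite mulf_eq0 (negbTE (two_F H)) /= => /eqP->; rewrite scale0r addr0.
have fix_ga i : (k < i)%N -> (i < m)%N -> ev i *v (g * a1)%g = ev i /\ fv i *v (g * a1)%g = fv i.
  move=> ki hi; have [e1 f1] := fix_g i ki hi; rewrite !actM e1 f1.
  exact: (Gam_fix LG (ltn0Sn k) Ka1 ki hi).
have Vy := inV_act H Oga fix_ga Vf.
have [w Vw yE] := inV_dec H hk Vy; have [ew fw] := Vw k (leqnn k) hk.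
have by1 : B (ev k) (fv k *v (g * a1)%g) = 1%R by rewrite -{1}ega (isomB _ _ Oga).
move: yE; rewrite by1 scale1r; move: (B (fv k) _) => alpha yE.
have aE : alpha = (- Q w)%R.
  have := isomB (fv k) (fv k) Oga; rewrite yE !(bformE sJ) !(bformC sJ w) ew fw !bE // eqxx.
  rewrite /= !mulr1n !mulr0 !mulr1 !addr0 !add0r (bformQ J tF) => E0.
  apply: (mulfI tF); rewrite mulrN; apply/eqP; rewrite -addr_eq0 addrC -E0.
  by apply/eqP; ring.
have ee : eich J (ev k) w by split; rewrite ?bE.
have ye : fv k *v E (ev k) w = fv k *v (g * a1)%g.
  rewrite yE (eichlerE sJ tF ee) (bformC sJ _ (ev k)) bef fw scale0r subr0 mulr1 scale1r aE.
  by rewrite scaleNr [RHS]addrA [RHS]addrC [RHS]addrA.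
have eke : ev k *v E (ev k) w = ev k.
  by rewrite (eichlerE sJ tF ee) ew bE // mulr0 !scale0r addr0 !subr0.
have Ke := E_e_Gam hk Vw; have Oe := eichler_isom sJ tF ee.
exists (a1 * (E (ev k) w)^-1); first exact: (XM (Gam_X Ka1) (XVg (Gam_X Ke))).
rewrite mulgA; split; first by rewrite isomM ?isomV.
move=> i; rewrite leq_eqVlt => /orP[/eqP<-|ki] hi.
  rewrite (actM (ev k)) (actM (fv k)) ega; split; first exact: act_inv.
  by rewrite -ye actK.
have [ei fi] := fix_ga i ki hi; rewrite (actM (ev i)) (actM (fv i)) ei fi.
have [ei' fi'] := Gam_fix LG (ltn0Sn k) Ke ki hi; split; exact: act_inv.
Qed.

(** The isometries of W, extended by the identity. *)
Definition OW g := g \in O /\ forall i, (i < m)%N -> ev i *v g = ev i /\ fv i *v g = fv i.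

Lemma descend_OW g : g \in O -> exists2 a, X a & OW (g * a).
Proof.
move=> Og; suff D l : (l <= m)%N -> exists2 a, X a & g * a \in O /\
    forall i, (m - l <= i)%N -> (i < m)%N -> ev i *v (g * a)%g = ev i /\ fv i *v (g * a)%g = fv i.
  have [a Xa [Oga fix_ga]] := D m (leqnn m); exists a => //; split=> // i hi.
  by apply: fix_ga => //; rewrite subnn.
elim: l => [|l IH] hl.
  exists 1; first exact: gen_1.
  by rewrite mulg1; split=> // i; rewrite subn0 leqNgt => /negP.
have [a Xa [Oga fix_ga]] := IH (ltnW hl).
have hk : (m - l.+1 < m)%N by rewrite ltn_subrL (leq_ltn_trans _ hl).
have [|b Xb [Ogab fix_gab]] := descend_step hk Oga.
  by move=> i; rewrite -subSn // subSS; apply: fix_ga.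
by exists (a * b); [exact: XM|rewrite mulgA].
Qed.

(** On W = L an isometry is x |-> zeta x or x |-> zeta x^q with zeta of norm 1: zeta is
    the image of 1, and the image eta of psi has the norm of zeta psi and is
    orthogonal to zeta, so that eta = zeta psi or eta = - zeta psi. *)
Lemma OW_act h : OW h -> exists j (c : bool), forall x,
  wv x *v h = wv (r ^+ j * (if c then frob x else x))%R.
Proof.
case=> Oh fix_h.
have act_w x : exists y, wv x *v h = wv y.
  by apply: (inV0 H); apply: (inV_act H Oh) => [i _|]; [exact: fix_h|exact: (inV_wv H)].
have [zt hz] := act_w 1%R; have [eta he] := act_w (Defs.psi F omega).
have Nz : (zt * frob zt = 1)%R.
  have := congr1 emb (qform_isom (wv 1)%R Oh); rewrite hz !(Q_w H) => /oppr_inj ->.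
  by rewrite mul1r (frob1 H).
have z0 : zt != 0%R by apply: contra_eq_neq Nz => ->; rewrite mul0r eq_sym oner_neq0.
have fz : frob zt = zt^-1%R by apply: (mulfI z0); rewrite mulfV.
have Ne : (eta * frob eta = - Defs.psi F omega ^+ 2)%R.
  have := congr1 emb (qform_isom (wv (Defs.psi F omega)) Oh); rewrite he !(Q_w H) => /oppr_inj ->.
  by rewrite (frob_psi H) mulrN.
have Te : (zt * frob eta + frob zt * eta = 0)%R.
  have := congr1 emb (isomB (wv 1)%R (wv (Defs.psi F omega)) Oh); rewrite hz he !(B_ww H) => /oppr_inj ->.
  by rewrite (frob_psi H) (frob1 H) !mul1r addNr.
have e2 : (eta ^+ 2 == (zt * Defs.psi F omega) ^+ 2)%R.
  have -> : (eta ^+ 2 = - zt ^+ 2 * (eta * frob eta))%R.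
    have -> : (frob eta = - (zt^-1 * zt^-1 * eta))%R.
      apply: (mulfI z0); apply/eqP; rewrite mulrN -addr_eq0 !mulrA mulfV // mul1r -fz.
      by rewrite Te.
    by field.
  by rewrite Ne exprMn mulrNN.
have [|j zj] := norm1_log H (_ : zt ^+ q.+1 = 1)%R; first by rewrite exprS.
have E x : wv x *v h = (re emb x *: wv zt + im emb omega x *: wv eta)%R.
  by rewrite (wvE H) actD !actZ -(wv1 H) -(wvpsi H) hz he.
exists j; rewrite -exprM -zj; move: e2; rewrite eqf_sqr => /orP[] /eqP ee.
  exists false => x; rewrite E ee -!(wvZ H) -(wvD H); congr (wv _).
  by rewrite [in RHS](re_im H x); ring.
exists true => x; rewrite E ee -!(wvZ H) -(wvD H); congr (wv _).
rewrite [in RHS](re_im H x) (frobD H) (frobM H) !(frob_emb H) (frob_psi H); ring.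
Qed.

(** For the two kinds of isometries the commutator is multiplication by a square
    zeta^2 of an element of norm 1, that is, by a power of r^(q-1) = r^-2, where
    r = omega^(q-1); delta^(q-1) acts on W in this way and fixes e_0 and f_0. *)
Lemma OW_comm h1 h2 : OW h1 -> OW h2 -> exists j, h1 * h2 = h2 * h1 * dl ^+ (q.-1 * j).
Proof.
move=> W1 W2; have [j1 [c1 E1]] := OW_act W1; have [j2 [c2 E2]] := OW_act W2.
case: W1 W2 => [O1 F1] [O2 F2]; pose k := (c2 * j1 + c1 * (q * j2))%N; exists k.
have o1 : (om0 ^+ (q.-1 * k) = 1)%R by rewrite exprM (om0_q1 H) expr1n.
apply: (basis_ext H) => [i hi|i hi|x].
- rewrite !actM; have [-> _] := F1 i hi; have [e2 _] := F2 i hi; rewrite e2; have [-> _] := F1 i hi.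
  case: i hi {e2} => [|i] hi; last by rewrite (dF H _ hi).
  by have [[[-> _] _] _] := dA H (q.-1 * k); rewrite o1 invr1 scale1r.
- rewrite !actM; have [_ ->] := F1 i hi; have [_ e2] := F2 i hi; rewrite e2; have [_ ->] := F1 i hi.
  case: i hi {e2} => [|i] hi; last by rewrite (dF H _ hi).
  by have [[[_ ->] _] _] := dA H (q.-1 * k); rewrite o1 scale1r.
have R := r_neq0 H; have rq : (r ^+ q.-1 = r ^- 2)%R.
  apply: (mulIf R); rewrite -exprSr prednK ?(q_gt0 H) // [(r ^+ q)%R](frob_r H).
  by field.
have rqq i : (r ^+ (q * i) = r ^- i)%R by exact: (frob_X H).
rewrite !actM E1 !E2 E1 (dw H); congr (wv _).
have fr := frob_rX H; move: (omega ^+ q.-1)%R R rq rqq fr => r0 R rq rqq fr.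
have aux i : ((r0 ^- 2) ^+ i = (r0 ^+ i) ^- 2)%R by rewrite exprVn exprAC.
have Rj1 := expf_neq0 j1 R; have Rj2 := expf_neq0 j2 R.
rewrite exprM rq /k exprD !aux; case: (c1); case: (c2).
all: rewrite ?mul1n ?mul0n ?expr0 ?rqq ?(frobM H, fr, frobK H); field; rewrite ?Rj1 ?Rj2 ?oner_neq0 //.
Qed.

Lemma X_Ew x : X (E (fv 0) (wv x)) /\ X (E (ev 0) (wv x)).
Proof.
have V0 : inV 0 (wv x) := inV_wv H (k := 0) x.
by split; apply: Gam_X; [exact: (E_f_Gam mgt0 V0)|exact: (E_e_Gam mgt0 V0)].
Qed.
Lemma X_weylw x y : X (weyl J (ev 0) (fv 0) (wv x) (wv y)).
Proof.
have [[_ Xe] [Xf _]] := (X_Ew x, X_Ew y).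
exact: (XM (XM Xf Xe) Xf).
Qed.

Lemma nrm_X_OW h : OW h -> nrm X h.
Proof.
move=> Wh; have [j [c hw]] := OW_act Wh; case: Wh => Oh fix_h.
have wJ x y : X (weyl J (ev 0) (fv 0) (wv x) (wv y) ^ h).
  rewrite (weylJ sJ tF (eich_ew H x mgt0) (eich_fw H y mgt0) Oh).
  by have [-> ->] := fix_h 0%N mgt0; rewrite !hw; exact: X_weylw.
have Xzh : X (z ^ h) by have := wJ 1%R (- 1)%R; rewrite -z_split.
have Xdh : X (dl ^ h).
  have -> : dl ^ h = (z ^ h)^-1 * (z * dl) ^ h by rewrite (conjMg z) mulKg.
  by apply: (XM (XVg Xzh)); rewrite zd_split.
have fixU i : (i.+1 < m)%N -> commute (Um i) h.
  move=> hi; apply: fix_conj; rewrite (weylJm H hi Oh) (UmE H).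
  by have [-> ->] := fix_h i (ltnW hi); have [-> ->] := fix_h i.+1 hi.
have cU : U ^ h = U by rewrite (Um0 H) (conj_fix (fixU 0%N mgt1)).
have cV : V ^ h = V.
  apply: conj_fix; rewrite (V_prod H); have : (m.-1 < m)%N by rewrite prednK.
  elim: (m.-1) => [|k IH] hk; first exact/commute_sym/commute1.
  by rewrite (PmS H); apply/commute_sym/commuteM; apply/commute_sym; [exact: fixU|exact: IH (ltnW hk)].
have cs : s ^ h = s.
  by apply: conj_fix; have [_ f0] := fix_h 0%N mgt0; have [e1 _] := fix_h 1%N mgt1; apply: s_fix.
have Xth : X (t ^ h).
  have [_ f0] := fix_h 0%N mgt0.
  have -> : t ^ h = E (fv 0) (wv (r ^+ j * (if c then frob 1 else 1))%R).
    by rewrite (t_eichler H) (eichlerJ sJ tF Oh (eich_fw H _ mgt0)) hw f0.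
  by have [] := X_Ew (r ^+ j * (if c then frob 1 else 1))%R.
apply: gen_nrm_gen => x [->|->|->|[->|[->|->]]] //.
- by rewrite cs; apply: gen_in; apply: Or41.
- by rewrite cU; apply: gen_in; apply: Or44; right; left.
by rewrite cV; apply: gen_in; apply: Or44; right; right.
Qed.

Lemma OW_split g : g \in O -> exists h b, [/\ OW h, X b & g = h * b].
Proof.
move=> Og; have [a Xa Wga] := descend_OW Og.
exists (g * a), a^-1; split=> //; [exact: XVg|exact: esym (mulgK a g)].
Qed.
Lemma nrm_X g : g \in O -> nrm X g.
Proof.
case/OW_split=> h [b [Wh Xb ->]]; apply: nrmM; first exact: nrm_X_OW.
by move=> x Xx; apply: (subgrpJ X_subgrp).
Qed.

(** Since O = O(W) X and O normalises X, commutators of O reduce modulo X to those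
    of O(W). *)
Lemma X_comm g1 g2 : g1 \in O -> g2 \in O -> X [~ g1, g2].
Proof.
move=> O1 O2; have [h1 [b1 [W1 X1 E1]]] := OW_split O1; have [h2 [b2 [W2 X2 E2]]] := OW_split O2.
rewrite E1 (commMgJ h1); apply: XM; last first.
  by rewrite commgEl; apply: (XM (XVg X1)); apply: nrm_X.
apply: (subgrpJ X_subgrp) X1; rewrite E2 (commgMJ h1); apply: XM.
  by rewrite commgEr; apply: (XM _ X2); apply: (nrm_X_OW W1); exact: XVg.
apply: (subgrpJ X_subgrp) X2; have [j hj] := OW_comm W1 W2.
suff -> : [~ h1, h2] = dl ^+ (q.-1 * j).
  by apply: (subgrpX _ X_subgrp); apply: gen_in; apply: Or43.
by apply: (mulgI (h2 * h1)); rewrite -hj -commgC.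
Qed.

Lemma D_gens g : D g <-> X g.
Proof.
split; last exact: gens_D.
move=> Dg; apply: D_min Dg; [exact: X_subgrp|exact: X_comm].
Qed.

Local Open Scope ring_scope.
Local Notation P := ('I_m.-1.+1).
Local Notation GLp := {'GL_m[F]}.
Local Notation sU := (signed_perm_U F n).
Local Notation sV := (signed_perm_V F n).
(** * Signed permutation matrices of degree m *)

Definition pv (i : nat) : 'rV[F]_m.-1.+1 := bvec F (p_pos n i.+1).

Lemma m_pred : m.-1.+1 = m. Proof. exact: prednK. Qed.
Lemma p_pos_val i : (i < m)%N -> p_pos n i.+1 = i :> nat.
Proof. by move=> hi; rewrite inordK // m_pred. Qed.
Lemma p_pos_inj i j : (i < m)%N -> (j < m)%N -> p_pos n i.+1 = p_pos n j.+1 -> i = j.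
Proof. by move=> hi hj /(congr1 val); rewrite /= !p_pos_val. Qed.
Lemma p_posE (a : P) : (a < m)%N /\ a = p_pos n a.+1.
Proof.
have ha : (a < m)%N by have := ltn_ord a; rewrite [X in (_ < X)%N]m_pred.
by split=> //; apply: val_inj; rewrite /= p_pos_val.
Qed.

Lemma pv_U i : (i < m)%N ->
  pv i *m GLval sU = if i == 0%N then pv 1 else if i == 1%N then - pv 0 else pv i.
Proof.
move=> hi; have [-> _] := signed_permsE F (n_ge3 H).
rewrite /signed_perm_U_mx; case: (ltnP i 2) => i2.
  have inj a b : (a < 2)%N -> (b < 2)%N -> p_pos n a.+1 = p_pos n b.+1 -> a = b.
    by move=> ha hb; apply: p_pos_inj; [exact: leq_trans ha mgt1|exact: leq_trans hb mgt1].
  have := @signed_cycle_iota F _ (p_pos n) 2 (-1) i inj i2; rewrite [map _ _]/= => ->.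
  by case: i i2 {hi} => [|[|i]] //= _; rewrite scaleN1r.
rewrite signed_cycle_notin; first by case: i i2 {hi} => [|[|i]].
rewrite !inE; apply/norP; split; apply/eqP => /p_pos_inj E1; move: i2; rewrite E1 //.
Qed.
Lemma pv_V i : (i < m)%N ->
  pv i *m GLval sV = if i.+1 == m then (-1) ^+ n *: pv 0 else pv i.+1.
Proof.
move=> hi; have [_ ->] := signed_permsE F (n_ge3 H).
by rewrite (@signed_cycle_iota F _ (p_pos n) m) //; exact: p_pos_inj.
Qed.

Definition Pe : 'M[F]_(m.-1.+1, N) := \matrix_(a < m.-1.+1) ev a.
Definition Pf : 'M[F]_(m.-1.+1, N) := \matrix_(a < m.-1.+1) fv a.
Lemma pv_Pe i : (i < m)%N -> pv i *m Pe = ev i.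
Proof. by move=> hi; rewrite /pv /(bvec F _) -rowE rowK p_pos_val. Qed.
Lemma pv_Pf i : (i < m)%N -> pv i *m Pf = fv i.
Proof. by move=> hi; rewrite /pv /(bvec F _) -rowE rowK p_pos_val. Qed.

(** M acts on the row vectors of degree m as g does on the e_i and on the f_i. *)
Definition same_action (M : GLp) (g : GL) :=
  [/\ GLval M *m Pe = Pe *m GLval g, GLval M *m Pf = Pf *m GLval g & forall x, wv x *v g = wv x].

Lemma pv_ext k (A B' : 'M[F]_(m.-1.+1, k)) : (forall i, (i < m)%N -> pv i *m A = pv i *m B') -> A = B'.
Proof.
move=> AB; apply/row_matrixP=> a; have [ha aE] := p_posE a.
by have := AB a ha; rewrite /pv -aE !rowE.
Qed.

Lemma same_U : same_action sU U.
Proof.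
split; last exact: (U_actw H).
  apply: pv_ext => i hi; rewrite !mulmxA pv_Pe // pv_U //; have [-> _] := U_act H hi.
  by case: ifP => _; rewrite ?pv_Pe //; case: ifP => _; rewrite ?mulNmx pv_Pe.
apply: pv_ext => i hi; rewrite !mulmxA pv_Pf // pv_U //; have [_ ->] := U_act H hi.
by case: ifP => _; rewrite ?pv_Pf //; case: ifP => _; rewrite ?mulNmx pv_Pf.
Qed.
Lemma same_V : same_action sV V.
Proof.
have lt i : (i < m)%N -> (i.+1 == m) = false -> (i.+1 < m)%N by move=> hi; rewrite ltn_neqAle hi => ->.
split; last exact: (V_actw H).
  apply: pv_ext => i hi; rewrite !mulmxA pv_Pe // pv_V //; have [-> _] := V_act H hi.
  by case: ifP => [_|/(lt _ hi) hi']; rewrite -?scalemxAl pv_Pe.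
apply: pv_ext => i hi; rewrite !mulmxA pv_Pf // pv_V //; have [_ ->] := V_act H hi.
by case: ifP => [_|/(lt _ hi) hi']; rewrite -?scalemxAl pv_Pf.
Qed.

Lemma same_1 : same_action 1%g 1%g.
Proof. by split=> [||x]; rewrite ?act1 // !GL_1E mulmx1 mul1mx. Qed.
Lemma same_M M1 g1 M2 g2 : same_action M1 g1 -> same_action M2 g2 -> same_action (M1 * M2)%g (g1 * g2)%g.
Proof.
move=> [e1 f1 w1] [e2 f2 w2']; split=> [||x]; last by rewrite actM w1 w2'.
  by rewrite !GL_MxE -mulmxA e2 !mulmxA e1.
by rewrite !GL_MxE -mulmxA f2 !mulmxA f1.
Qed.
Lemma same_Vg M1 g1 : same_action M1 g1 -> same_action M1^-1%g g1^-1%g.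
Proof.
have inv (A : 'M[F]_(m.-1.+1, N)) : GLval M1 *m A = A *m GLval g1 -> GLval M1^-1%g *m A = A *m GLval g1^-1%g.
  move=> E1; have gg : GLval g1 *m GLval g1^-1%g = 1%:M by rewrite -GL_MxE mulgV GL_1E.
  have MM : GLval M1^-1%g *m GLval M1 = 1%:M by rewrite -GL_MxE mulVg GL_1E.
  by rewrite -[LHS]mulmx1 -gg mulmxA -(mulmxA _ A) -E1 !mulmxA MM mul1mx.
by move=> [e1 f1 w1]; split=> [||x]; [exact: inv|exact: inv|exact: act_inv].
Qed.

(** The rows of Pe are distinct basis vectors, so that Pe has a right inverse. *)
Lemma same_eq1 M g : same_action M g -> M = 1%g <-> g = 1%g.
Proof.
move=> [e1 f1 w1]; split=> [M1|g1].
  apply: (basis_ext H) => [i hi|i hi|x]; rewrite ?act1 //.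
    by rewrite -pv_Pe // -mulmxA -e1 M1 GL_1E mul1mx.
  by rewrite -pv_Pf // -mulmxA -f1 M1 GL_1E mul1mx.
suff M1 : GLval M = 1%:M by apply: val_inj; apply: (etrans M1); apply/esym/GL_1E.
rewrite -[LHS]mulmx1.
have PP : Pe *m Pe^T = 1%:M.
  apply: pv_ext => i hi; rewrite mulmxA pv_Pe // mulmx1; apply/rowP=> b.
  have [hb bE] := p_posE b; transitivity ((ev i *m (ev b)^T) 0 0).
    by rewrite !mxE; apply: eq_bigr => c _; rewrite !mxE.
  rewrite (bvec_dot H) (pos_ee H) // /pv /bvec mxE eqxx /=; congr (nat_of_bool _)%:R.
  by rewrite -val_eqE /= p_pos_val // eq_sym.
by rewrite -PP mulmxA e1 g1 GL_1E mulmx1.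
Qed.

Lemma signed_perm_word w : free_lift [tuple sU; sV] w = 1%g <-> free_lift [tuple U; V] w = 1%g.
Proof.
apply: same_eq1; apply: free_lift_rel.
- exact: same_1.
- exact: same_M.
- exact: same_Vg.
by case=> [[|[|//]] i2]; rewrite !(tnth_nth 1%g) /=; [exact: same_U|exact: same_V].
Qed.
End MatrixGroup.

Local Close Scope ring_scope.

(** * The isomorphism *)

Lemma commute_comm1 (G : groupType) (x y : G) : commute x y -> [~ x, y] = 1.
Proof. by move=> c; rewrite commgEl (conj_fix c) mulVg. Qed.
Lemma comm1_commute (G : groupType) (x y : G) : [~ x, y] = 1 -> commute x y.
Proof. by move=> c; rewrite /commute commgC c mulg1. Qed.

Lemma free_liftX k (G : groupType) (g : k.-tuple G) w i : free_lift g (w ^+ i) = free_lift g w ^+ i.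
Proof. exact: gmulfXn. Qed.

Section Glue.
Variables (p e n : nat) (F L : finFieldType) (emb : {rmorphism F -> L}) (omega : L).
Variables (R1 : free_group 2 -> Prop) (R4 : free_group 5 -> Prop).
Hypothesis H : setting p e n emb omega.
Local Notation GL := {'GL_n.*2[F]}.
Local Notation s0 := (sigma_gen F n).
Local Notation t0 := (tau_gen F n).
Local Notation dl0 := (delta_gen emb omega n).
Local Notation zz0 := (z_gen F n).
Local Notation U0 := (U_gen F n).
Local Notation V0 := (V_gen F n).
Hypothesis R1_presents : presents
  (fun r => R1 r \/ r = free_gen (@Ordinal 2 0 isT) ^+ 4) [tuple signed_perm_U F n; signed_perm_V F n].
Hypothesis R4_presents : presents R4 [tuple s0; t0; dl0; zz0; U0].
Local Notation Rl := (relator n R1 R4).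
Local Notation T6 := [tuple s0; t0; dl0; zz0; U0; V0].
Local Notation LG := (lifting_GL H).
Local Notation gn i := (free_gen (@Ordinal 6 i isT)).
Set Default Proof Using "All".

Lemma gn_val : [/\ [/\ free_lift T6 (gn 0) = s0, free_lift T6 (gn 1) = t0 & free_lift T6 (gn 2) = dl0],
  free_lift T6 (gn 3) = zz0, free_lift T6 (gn 4) = U0 & free_lift T6 (gn 5) = V0].
Proof. by rewrite !free_lift_gen !(tnth_nth 1). Qed.

Lemma tuple2_case (P : 'I_2 -> Prop) : P (@Ordinal 2 0 isT) -> P (@Ordinal 2 1 isT) -> forall i, P i.
Proof. by move=> P0 P1 [[|[|//]] hi]; rewrite (bool_irrelevance hi isT). Qed.
Lemma tuple5_case (P : 'I_5 -> Prop) : P (@Ordinal 5 0 isT) -> P (@Ordinal 5 1 isT) ->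
  P (@Ordinal 5 2 isT) -> P (@Ordinal 5 3 isT) -> P (@Ordinal 5 4 isT) -> forall i, P i.
Proof. by move=> P0 P1 P2 P3 P4 [[|[|[|[|[|//]]]]] hi]; rewrite (bool_irrelevance hi isT). Qed.
Lemma tuple6_case (P : 'I_6 -> Prop) : P (@Ordinal 6 0 isT) -> P (@Ordinal 6 1 isT) ->
  P (@Ordinal 6 2 isT) -> P (@Ordinal 6 3 isT) -> P (@Ordinal 6 4 isT) -> P (@Ordinal 6 5 isT) -> forall i, P i.
Proof. by move=> P0 P1 P2 P3 P4 P5 [[|[|[|[|[|[|//]]]]]] hi]; rewrite (bool_irrelevance hi isT). Qed.

Lemma relators_hold w : Rl w -> free_lift T6 w = 1.
Proof.
have [[v0 v1 v2] v3 v4 v5] := gn_val.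
have fR x y : free_lift T6 [~ x, y] = [~ free_lift T6 x, free_lift T6 y] by exact: gmulfR.
have fM x y : free_lift T6 (x * y) = free_lift T6 x * free_lift T6 y by exact: gmulfM.
have fV x : free_lift T6 x^-1 = (free_lift T6 x)^-1 by exact: gmulfV.
have fJ x y : free_lift T6 (x ^ y) = free_lift T6 x ^ free_lift T6 y by exact: gmulfJ.
have fX x i : free_lift T6 (x ^+ i) = free_lift T6 x ^+ i by exact: gmulfXn.
case=> [r R1r||n4||n4|n4|n5||||n4|r R4r||||n4|].
- rewrite (free_lift_nat (phi := free_lift T6) (b := [tuple U0; V0])).
    by apply/(signed_perm_word H)/R1_presents; apply: normal_closure_base; left.
  by apply: tuple2_case; rewrite !(tnth_nth 1).
- by rewrite fR fJ v3 v4 v5; apply: commute_comm1; exact: (rel_zu LG).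
- by rewrite fR fM fV v3 v4 v5; apply: commute_comm1; exact: (rel_zc LG n4).
- by rewrite fR fJ v2 v4 v5; apply: commute_comm1; exact: (rel_du LG).
- by rewrite fR fM fV v2 v4 v5; apply: commute_comm1; exact: (rel_dc LG n4).
- by rewrite fR fJ fX v0 v4 v5; apply: commute_comm1; exact: (rel_su LG n4).
- by rewrite fR (fM (gn 5 * (gn 4)^-1)) (fM (gn 5)) fJ !fV v0 v4 v5; apply: commute_comm1; exact: (rel_sc LG n5).
- by rewrite fR fJ fX v0 v3 v5; apply: commute_comm1; exact: (rel_sz LG).
- by rewrite fR fJ fX v0 v2 v5; apply: commute_comm1; exact: (rel_sd LG).
- by rewrite fR fJ v1 v4 v5; apply: commute_comm1; exact: (rel_tu LG).
- by rewrite fR fM fV v1 v4 v5; apply: commute_comm1; exact: (rel_tc LG n4).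
- rewrite (free_lift_nat (phi := free_lift T6) (b := [tuple s0; t0; dl0; zz0; U0])).
    by apply/R4_presents; apply: normal_closure_base.
  by apply: tuple5_case; rewrite !(tnth_nth 1).
- rewrite fM fV fR !fJ fM fV v0 v4 v5; apply/eqP; rewrite mulg_eq1 invgK; apply/eqP.
  exact: (rel_A LG).
- by rewrite fR fJ fM fV v0 v4 v5; apply: commute_comm1; exact: (rel_B1 LG).
- by rewrite fR !fJ fM fV v0 v4 v5; apply: commute_comm1; exact: (rel_B2 LG).
- by rewrite fR fJ fX v0 v5; apply: commute_comm1; exact: (rel_C LG n4).
by rewrite fR fJ v0 v1 v5; apply: commute_comm1; exact: (rel_D LG).
Qed.

Local Notation PG := (presented_group Rl).
Local Notation proj := (pres_proj Rl).
Definition pi_G := pres_hom relators_hold.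
Lemma pi_GE w : pi_G (proj w) = free_lift T6 w. Proof. exact: pres_homE. Qed.
Local Notation pg i := (proj (gn i)).

(** A word in some of the generators whose matrix is trivial lies in the normal
    closure of relators that hold in the presented group. *)
Lemma faithful_on k (S : free_group k -> Prop) (c : k.-tuple (free_group 6)) (a : k.-tuple GL) :
  (forall w, free_lift a w = 1 -> normal_closure S w) ->
  (forall i, free_lift T6 (tnth c i) = tnth a i) ->
  (forall r, S r -> proj (free_lift c r) = 1) ->
  forall g, gen (fun y => exists i, y = proj (tnth c i)) g -> pi_G g = 1 -> g = 1.
Proof.
move=> aS ca Sc g; pose b := [tuple proj (tnth c i) | i < k].
have pc w : proj (free_lift c w) = free_lift b w.
  by apply: (free_lift_nat (phi := proj)) => i; rewrite tnth_mktuple.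
move=> Gg; have [w ->] : exists w, g = free_lift b w.
  apply: gen_free_lift; move: g Gg; apply: gen_sub; first exact: gen_subgrp.
  by move=> _ [i ->]; apply: gen_in; exists i; rewrite tnth_mktuple.
rewrite -pc pi_GE (free_lift_nat (phi := free_lift T6) ca) => /aS Nw; rewrite pc.
apply: (normal_closure_ker (phi := free_lift b)) Nw => r Sr.
by rewrite -[LHS]pc Sc.
Qed.

Lemma rel_comm x y : Rl [~ x, y] -> commute (proj x) (proj y).
Proof. by move/pres_proj_rel => c; apply: comm1_commute; rewrite -gmulfR. Qed.

Lemma lifting_G : lifting p e emb omega pi_G (pg 0) (pg 1) (pg 2) (pg 3) (pg 4) (pg 5).
Proof.
have [[v0 v1 v2] v3 v4 v5] := gn_val.
have fK g : Gam (pg 0) (pg 1) (pg 2) (pg 3) (pg 4) (pg 5) 2 g -> pi_G g = 1 -> g = 1.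
  move=> Kg; apply: (faithful_on (S := R4) (c := [tuple gn 0; gn 1; gn 2; gn 3; gn 4])
    (a := [tuple s0; t0; dl0; zz0; U0])).
  - by move=> w /R4_presents.
  - by apply: tuple5_case; rewrite !(tnth_nth 1).
  - by move=> r R4r; apply: pres_proj_rel; apply: rel_Omega6.
  move: g Kg; apply: gen_sub; first exact: gen_subgrp.
  move=> x [->|->|->|[[_ ->]|[[|i] // _ ->]]]; apply: gen_in.
  - by exists (@Ordinal 5 1 isT); rewrite (tnth_nth 1).
  - by exists (@Ordinal 5 2 isT); rewrite (tnth_nth 1).
  - by exists (@Ordinal 5 3 isT); rewrite (tnth_nth 1).
  - by exists (@Ordinal 5 0 isT); rewrite (tnth_nth 1).
  by exists (@Ordinal 5 4 isT); rewrite (tnth_nth 1) /uw expg0 conjg1.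
have u4 : pg 4 ^+ 4 = 1.
  apply: fK; last first.
    have -> : pi_G (pg 4 ^+ 4) = U0 ^+ 4 by rewrite gmulfXn; congr (_ ^+ 4); apply: etrans v4; exact: pi_GE.
    suff /(signed_perm_word H) : free_lift [tuple signed_perm_U F n; signed_perm_V F n]
        (free_gen (@Ordinal 2 0 isT) ^+ 4) = 1.
      by rewrite free_liftX free_lift_gen (tnth_nth 1).
    by apply/R1_presents; apply: normal_closure_base; right.
  apply: (subgrpX _ (gen_subgrp _)); apply: gen_in; apply: Or44; right.
  by exists 0%N; rewrite // /uw expg0 conjg1.
have pR x y : [~ proj x, proj y] = proj [~ x, y] by rewrite -gmulfR.
have pM x y : proj x * proj y = proj (x * y) by rewrite -gmulfM.
have pV x : (proj x)^-1 = proj x^-1 by rewrite -gmulfV.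
have pJ x y : proj x ^ proj y = proj (x ^ y) by rewrite -gmulfJ.
have pX x i : proj x ^+ i = proj (x ^+ i) by rewrite -gmulfXn.
split=> //; rewrite ?[pi_G _]pi_GE //.
- move=> g Wg; apply: (faithful_on (S := fun r => R1 r \/ r = free_gen (@Ordinal 2 0 isT) ^+ 4)
    (c := [tuple gn 4; gn 5]) (a := [tuple U0; V0])).
  - by move=> w /(signed_perm_word H)/R1_presents.
  - by apply: tuple2_case; rewrite !(tnth_nth 1).
  - move=> r [R1r|->]; first by apply: pres_proj_rel; apply: rel_signed_perm.
    by rewrite free_liftX free_lift_gen (tnth_nth 1) -[RHS]u4; exact: gmulfXn.
  move: g Wg; apply: gen_sub; first exact: gen_subgrp.
  by move=> x [->|->]; apply: gen_in; [exists (@Ordinal 2 0 isT)|exists (@Ordinal 2 1 isT)]; rewrite (tnth_nth 1).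
- by rewrite pJ; apply/rel_comm/rel_z_UV.
- by move=> n4; rewrite pV pM; apply/rel_comm/rel_z_VU.
- by rewrite pJ; apply/rel_comm/rel_delta_UV.
- by move=> n4; rewrite pV pM; apply/rel_comm/rel_delta_VU.
- by rewrite pJ; apply/rel_comm/rel_tau_UV.
- by move=> n4; rewrite pV pM; apply/rel_comm/rel_tau_VU.
- by move=> n4; rewrite pX pJ; apply/rel_comm/rel_sigma_UV2.
- by move=> n5; rewrite pV pJ (pM (gn 5)) pM; apply/rel_comm/rel_sigma_VUUV.
- by rewrite pX pJ; apply/rel_comm/rel_sigma_zV2.
- by rewrite pX pJ; apply/rel_comm/rel_sigma_deltaV2.
- have := pres_proj_rel (rel_sigma_sigmaV n R1 R4); rewrite -pM -pV => /divg1_eq.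
  by rewrite -pR -!pJ -pM -pV.
- by rewrite pV pM pJ; apply/rel_comm/rel_sigma_sigmaVU.
- by rewrite pV (pM (gn 5)) (pJ (gn 4)) (pJ (gn 0)); apply: rel_comm; apply: rel_sigma_sigmaW.
- by move=> n4; rewrite pX pJ; apply/rel_comm/rel_sigma_sigmaV2.
by rewrite pJ; apply/rel_comm/rel_sigmaV_tau.
Qed.

Local Notation Omega := (Omega_minus emb omega n).
Local Notation X := (gen (fun x : GL => [\/ x = s0, x = t0, x = dl0 | x = zz0 \/ x = U0 \/ x = V0])).

Lemma PG_gen (g : PG) :
  gen (fun x => [\/ x = pg 0, x = pg 1, x = pg 2 | x = pg 3 \/ x = pg 4 \/ x = pg 5]) g.
Proof.
have [w ->] := pres_proj_surj g; have := free_group_gen w.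
pose A w := gen (fun x => [\/ x = pg 0, x = pg 1, x = pg 2 | x = pg 3 \/ x = pg 4 \/ x = pg 5]) (proj w).
apply: (@gen_sub _ _ A).
  split=> [|x y Ax Ay|x Ax]; rewrite /A ?gmulf1 ?gmulfM ?gmulfV; [exact: gen_1|exact: gen_M|exact: gen_V].
move=> _ [i ->]; apply: gen_in; move: i.
by apply: tuple6_case; [apply: Or41|apply: Or42|apply: Or43|apply: Or44; left|apply: Or44; right; left|apply: Or44; right; right].
Qed.

Lemma pi_G_X g : X (pi_G g).
Proof.
have [[v0 v1 v2] v3 v4 v5] := gn_val.
move: g (PG_gen g); apply: (@gen_sub _ _ (fun g => X (pi_G g))).
  split=> [|x y Ax Ay|x Ax]; rewrite ?gmulf1 ?gmulfM ?gmulfV; [exact: gen_1|exact: gen_M|exact: gen_V].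
move=> _ [->|->|->|[->|[->|->]]]; rewrite pi_GE ?v0 ?v1 ?v2 ?v3 ?v4 ?v5; apply: gen_in.
- exact: Or41.
- exact: Or42.
- exact: Or43.
- by apply: Or44; left.
- by apply: Or44; right; left.
by apply: Or44; right; right.
Qed.

Lemma X_pi_G x : X x -> exists g, pi_G g = x.
Proof.
have [[v0 v1 v2] v3 v4 v5] := gn_val.
elim=> [_ [->|->|->|[->|[->|->]]]||_ _ _ [g1 <-] _ [g2 <-]|_ _ [g <-]].
- by exists (pg 0); rewrite pi_GE.
- by exists (pg 1); rewrite pi_GE.
- by exists (pg 2); rewrite pi_GE.
- by exists (pg 3); rewrite pi_GE.
- by exists (pg 4); rewrite pi_GE.
- by exists (pg 5); rewrite pi_GE.
- by exists 1; rewrite gmulf1.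
- by exists (g1 * g2); rewrite gmulfM.
by exists g^-1; rewrite gmulfV.
Qed.

Lemma Omega_X x : x \in Omega <-> X x.
Proof. exact: (D_gens H). Qed.

Lemma pi_G_inj : injective pi_G.
Proof.
move=> x y xy; apply: divg1_eq; apply: (pi_faithful lifting_G (PG_gen _)).
by rewrite gmulfM gmulfV xy mulgV.
Qed.

Local Notation OmT := [subg Omega]%type.
Lemma isomorphic_Omega : isomorphic PG OmT.
Proof.
have inO g : pi_G g \in Omega by apply/Omega_X/pi_G_X.
pose f (g : PG) : OmT := subg Omega (pi_G g).
have fE g : sgval (f g) = pi_G g by apply: subgK.
have fM : {morph f : x y / x * y}.
  by move=> x y; apply: val_inj; rewrite [LHS]fE gmulfM -!fE.
have [h hK] : exists h : OmT -> PG, forall y, f (h y) = y.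
  have ex (y : OmT) : exists g, f g = y.
    have /Omega_X/X_pi_G[g gy] := valP y; exists g; apply: val_inj.
    by rewrite [LHS]fE.
  by exists (fun y => sval (cid (ex y))) => y; case: (cid _).
exists (HB.pack_for {multiplicative PG -> OmT} f (isMultiplicative.Build PG OmT f fM)).
exists h => // x; apply: pi_G_inj; rewrite -!fE; congr (sgval _); exact: hK.
Qed.
End Glue.

Local Close Scope ring_scope.
Local Close Scope group_scope.
Local Close Scope group_scope.

Theorem theorem11p5 (p e n : nat) (F L : finFieldType)
    (emb : {rmorphism F -> L}) (omega : L)
    (R1 : free_group 2 -> Prop) (R4 : free_group 5 -> Prop)
    (p_prime : prime p) (p_odd : odd p) (e_gt0 : 0 < e) (n_ge4 : 4 <= n)
    (card_F : #|F| = p ^ e) (card_L : #|L| = (p ^ e) ^ 2)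
    (omega_primitive : ((#|L|.-1).-primitive_root omega)%R)
    (R1_presents :
       presents
         (fun r => R1 r \/ r = (free_gen (@Ordinal 2 0 isT) ^+ 4)%g)
         [tuple signed_perm_U F n; signed_perm_V F n])
    (R4_presents :
       presents R4
         [tuple sigma_gen F n; tau_gen F n; delta_gen emb omega n;
                z_gen F n; U_gen F n]) :
  isomorphic
    (presented_group (relator n R1 R4))
    [subg Omega_minus emb omega n].
Proof.
have H : setting p e n emb omega by split; rewrite ?card_F.
exact: (isomorphic_Omega H R1_presents R4_presents).
Qed.
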